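(* Let $p,r,q,Q,y_0,l,b,\rho$ be as in the context. Let $g$ be a solution of $(p(y)g')'-q(y)g=0$ on $(A,B)$ satisfying $g(y_0)=(p(y_0)r(y_0))^{-1/4}$ and such that $g^2r$ and $1/(g^2p)$ are continuous on $[A,B]$, let $$h=\sqrt{\frac{p(y_0)}{r(y_0)}}\left(\frac{g'(y_0)}{g(y_0)}+\frac{\rho'(y_0)}{\rho(y_0)}\right),$$ and let $\Phi_n$ be the formal powers constructed from $g$ with base point $y_0$. Let $v_1(\omega,y)$ and $v_2(\omega,y)$ be the solutions of $(p(y)v')'-q(y)v=-\omega^2r(y)v$ on $(A,B)$ satisfying $$v_1(\omega,y_0)=\frac1{\rho(y_0)},\quad v_1'(\omega,y_0)=-\frac{\rho'(y_0)}{\rho^2(y_0)}+\frac{h}{\rho(y_0)}\sqrt{\frac{r(y_0)}{p(y_0)}},\qquad v_2(\omega,y_0)=0,\quad v_2'(\omega,y_0)=\frac1{\rho(y_0)}\sqrt{\frac{r(y_0)}{p(y_0)}}.$$ Then $v_1$ and $v_2$ can be approximated by the functions $$v_{1,N}(\omega,y)=\frac{1}{\rho(y)}\cos(\omega l(y))+2\sum_{n=0}^{N}a_n\sum_{\text{even }k=0}^{n}\binom nk\Phi_{n-k}(y)\int_0^{l(y)}t^k\cos\omega t\,dt$$ and $$v_{2,N}(\omega,y)=\frac1\omega\left(\frac{\sin(\omega l(y))}{\rho(y)}+2\sum_{n=1}^{N}b_n\sum_{\text{odd }k=1}^{n}\binom nk\Phi_{n-k}(y)\int_0^{l(y)}t^k\sin\omega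 t\,dt\right),$$ where the coefficients $\{a_n\}_{n=0}^N$ and $\{b_n\}_{n=1}^N$ are such that $$\left|G_1(y)-\sum_{n=0}^Na_n\widetilde{\mathbf c}_n(y)\right|\le\varepsilon_1\quad\text{and}\quad\left|G_2(y)-\sum_{n=1}^Nb_n\widetilde{\mathbf s}_n(y)\right|\le\varepsilon_2\qquad\text{for all }y\in[A,B],$$ in the following sense: there is a number $\varepsilon\ge0$, depending only on $\varepsilon_1$, $\varepsilon_2$ and $Q$, such that $$\|v_1-v_{1,N}\|\le\frac{\varepsilon\rho_0\sinh(Cb)}{C}\qquad\text{and}\qquad\|v_2-v_{2,N}\|\le\frac{\varepsilon\rho_0\sinh(Cb)}{|\omega|C}$$ for any $\omega\in\mathbb{C}$, $\omega\neq0$, belonging to the strip $|\operatorname{Im}\omega|\le C$, $C\ge0$. Here $\rho_0:=\|1/\rho\|$, $\|\cdot\|$ denotes the maximum norm over $y\in[A,B]$, and $\sinh(Cb)/C$ is understood as $b$ when $C=0$.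
   Context: Coefficients. $(A,B)$ is a finite real interval; $AC_{loc}(A,B)$ denotes the complex-valued functions absolutely continuous on every compact subinterval of $(A,B)$. The functions $p,r:(A,B)\to\mathbb{R}$ satisfy $p,p',r,r'\in AC_{loc}(A,B)$ and $p(y),r(y)>0$ on $(A,B)$; they extend to continuous positive functions on $[A,B]$. The function $q$ on $(A,B)$ may be complex-valued. Put $\rho(y)=(p(y)r(y))^{1/4}$. A solution $v$ of $(pv')'-qv=-\omega^2rv$ (or of this equation with $\omega=0$) is a function with $v,pv'\in AC_{loc}(A,B)$ satisfying it almost everywhere. Change of variable. $y_0\in(A,B)$ is such that $\int_A^{y_0}\{r(s)/p(s)\}^{1/2}ds=\int_{y_0}^B\{r(s)/p(s)\}^{1/2}ds=:b$, and $l(y)=\int_{y_0}^y\{r(s)/p(s)\}^{1/2}ds$, a bijection $[A,B]\to[-b,b]$. (The associated Liouville transformation is $L:C[A,B]\to C[-b,b]$, $L[v](x)=\rho(l^{-1}(x))v(l^{-1}(x))$.) Potential. With $x=l(y)$, $Q(x)=r(y)^{-1}q(y)-\{r(y)^{-3}p(y)\}^{1/4}\bigl[p(y)(\{p(y)r(y)\}^{-1/4})'\bigr]'$ (primes are derivatives in $y$). It is assumed that $Q$ is continuous on $[-b,b]$. Formal powers. $\widetilde Y^{(0)}\equiv Y^{(0)}\equiv1$ and, for $k\ge1$, $\widetilde Y^{(k)}(y)=k\int_{y_0}^{y}\widetilde Y^{(k-1)}(s)g^2(s)r(s)\,ds$ for $k$ odd, $\widetilde Y^{(k)}(y)=k\int_{y_0}^{y}\widetilde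 Y^{(k-1)}(s)\frac{1}{g^2(s)p(s)}\,ds$ for $k$ even; $Y^{(k)}(y)=k\int_{y_0}^{y}Y^{(k-1)}(s)\frac{1}{g^2(s)p(s)}\,ds$ for $k$ odd, $Y^{(k)}(y)=k\int_{y_0}^{y}Y^{(k-1)}(s)g^2(s)r(s)\,ds$ for $k$ even. Then $\Phi_k=gY^{(k)}$ for $k$ odd and $\Phi_k=g\widetilde Y^{(k)}$ for $k$ even. Functions in the approximation conditions. $$G_2(y)=\frac14\int_{y_0}^{y}\frac{1}{(pr)^{1/4}}\left\{\frac{q}{(pr)^{1/4}}-\bigl[p\{(pr)^{-1/4}\}'\bigr]'\right\}(s)\,ds\;=\;\frac14\int_0^{l(y)}Q(s)\,ds,\qquad G_1(y)=\frac h2+G_2(y),$$ $\widetilde{\mathbf c}_0(y)=\rho(y)g(y)$ and, for $m\ge1$, $$\widetilde{\mathbf c}_m(y)=\rho(y)\sum_{\text{even }k=0}^{m}\binom mk(l(y))^k\Phi_{m-k}(y),\qquad \widetilde{\mathbf s}_m(y)=\rho(y)\sum_{\text{odd }k=1}^{m}\binom mk(l(y))^k\Phi_{m-k}(y).$$ Sums ''even $k=0$ to $m$'' (resp. ''odd $k=1$ to $m$'') run over the even (resp. odd) integers $k$ in the indicated range. *)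

(* Defs.v *)
From Stdlib Require Import Reals.
From Coquelicot Require Import Coquelicot.
Open Scope R_scope.

(** ** Complex-valued functions of a real variable *)

(* Coquelicot's [C] is a normed module both over itself and over [R]; the
   structure over [R] has to be given explicitly. *)
Definition CInt (f : R -> C) (a b : R) : C :=
  @RInt C_R_CompleteNormedModule f a b.

Definition differentiable_at (f : R -> C) (y : R) : Prop :=
  @ex_derive R_AbsRing C_R_NormedModule f y.

(* Meaningful only where [differentiable_at f y]; every use below comes with
   a differentiability condition. *)
Definition deriv (f : R -> C) (y : R) : C :=
  (Derive (fun s => Re (f s)) y, Derive (fun s => Im (f s)) y).

Definition Cexp (z : C) : C :=
  (RtoC (exp (Re z)) * (cos (Im z), sin (Im z)))%C.
Definition Ccos (z : C) : C := ((Cexp (Ci * z) + Cexp (- (Ci * z))) / RtoC 2)%C.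
Definition Csin (z : C) : C :=
  ((Cexp (Ci * z) - Cexp (- (Ci * z))) / (RtoC 2 * Ci))%C.

(** ** Null sets and absolute continuity *)

Definition null_set (E : R -> Prop) : Prop :=
  forall eps : R, 0 < eps ->
  exists c d : nat -> R,
    (forall n, c n <= d n) /\
    (forall x, E x -> exists n, c n < x < d n) /\
    (forall n, sum_n (fun i => d i - c i) n <= eps).

Definition almost_everywhere (A B : R) (P : R -> Prop) : Prop :=
  null_set (fun y => A < y < B /\ ~ P y).

Definition AC (a b : R) (f : R -> C) : Prop :=
  forall eps : R, 0 < eps ->
  exists delta : R, 0 < delta /\
  forall (n : nat) (c d : nat -> R),
    (forall i, (i <= n)%nat -> a <= c i /\ c i <= d i /\ d i <= b) ->
    (forall i j, (i < j)%nat -> (j <= n)%nat -> d i <= c j \/ d j <= c i) ->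
    sum_n (fun i => d i - c i) n < delta ->
    sum_n (fun i => Cmod (f (d i) - f (c i))%C) n < eps.

Definition AC_loc (A B : R) (f : R -> C) : Prop :=
  forall a b : R, A < a -> a <= b -> b < B -> AC a b f.

(** ** Continuity and maximum norm on [[A,B]] of functions given on [(A,B)] *)

(* Functions on (A,B) are represented by total functions whose values outside
   (A,B) are irrelevant: [F] is the continuous extension of [f] to [A,B]
   (unique on [A,B]). *)
Definition extends (A B : R) (f F : R -> C) : Prop :=
  (forall y, A < y < B -> F y = f y) /\
  continuous_on (fun y => A <= y <= B) F.

Definition continuous_closed (A B : R) (f : R -> C) : Prop :=
  exists F, extends A B f F.

Definition bounded_closed (A B : R) (f : R -> C) (M : R) : Prop :=
  exists F, extends A B f F /\ forall y, A <= y <= B -> Cmod (F y) <= M.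

(* [Lub_Rbar] of a set unbounded above would be sent to 0 by [real]; this is
   only applied to functions continuous on [A,B], where it is the maximum. *)
Definition max_norm (A B : R) (F : R -> C) : R :=
  real (Lub_Rbar (fun s => exists y, A <= y <= B /\ s = Cmod (F y))).

Definition norm_le (A B : R) (f : R -> C) (M : R) : Prop :=
  exists F, extends A B f F /\ max_norm A B F <= M.

(** ** The equation and the Liouville change of variable *)

(* [p] and [r] denote the continuous positive extensions to [A,B]. *)
Definition coefficients (A B : R) (p r : R -> R) : Prop :=
  (forall y, A < y < B -> ex_derive p y /\ ex_derive r y) /\
  AC_loc A B (fun y => RtoC (p y)) /\
  AC_loc A B (fun y => RtoC (Derive p y)) /\
  AC_loc A B (fun y => RtoC (r y)) /\
  AC_loc A B (fun y => RtoC (Derive r y)) /\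
  continuous_on (fun y => A <= y <= B) p /\
  continuous_on (fun y => A <= y <= B) r /\
  (forall y, A <= y <= B -> 0 < p y /\ 0 < r y).

(* (p v')' - q v = - omega^2 r v *)
Definition is_solution (A B : R) (p r : R -> R) (q : R -> C) (omega : C)
    (v : R -> C) : Prop :=
  let pv' := fun y => (RtoC (p y) * deriv v y)%C in
  (forall y, A < y < B -> differentiable_at v y) /\
  AC_loc A B v /\
  AC_loc A B pv' /\
  almost_everywhere A B (fun y =>
    differentiable_at pv' y /\
    (deriv pv' y - q y * v y)%C = (- (omega ^ 2 * RtoC (r y) * v y))%C).

Definition rho (p r : R -> R) (y : R) : R := Rpower (p y * r y) (1 / 4).

Definition ell (p r : R -> R) (y0 y : R) : R :=
  RInt (fun s => sqrt (r s / p s)) y0 y.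

(* The bracket [p ((p r)^(-1/4))']' exists only almost everywhere, so the
   formula determines Q up to a null set; continuity of Q refers to the
   representative [Q]. *)
Definition potential (A B : R) (p r : R -> R) (q : R -> C) (y0 : R)
    (Q : R -> C) : Prop :=
  let w := fun y => p y * Derive (fun s => Rpower (p s * r s) (- (1 / 4))) y in
  almost_everywhere A B (fun y =>
    ex_derive w y /\
    Q (ell p r y0 y) =
      (q y / RtoC (r y)
       - RtoC (Rpower ((/ r y) ^ 3 * p y) (1 / 4) * Derive w y))%C).

(** ** Formal powers *)

Section FormalPowers.
Variables (p r : R -> R) (y0 : R) (g : R -> C).

Definition g2r (s : R) : C := (g s ^ 2 * RtoC (r s))%C.
Definition inv_g2p (s : R) : C := (/ (g s ^ 2 * RtoC (p s)))%C.

Fixpoint Ytilde (k : nat) (y : R) : C :=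
  match k with
  | O => RtoC 1
  | S j => (RtoC (INR k) *
      CInt (fun s => Ytilde j s * (if Nat.odd k then g2r s else inv_g2p s))
        y0 y)%C
  end.

Fixpoint Y (k : nat) (y : R) : C :=
  match k with
  | O => RtoC 1
  | S j => (RtoC (INR k) *
      CInt (fun s => Y j s * (if Nat.odd k then inv_g2p s else g2r s))
        y0 y)%C
  end.

Definition Phi (k : nat) (y : R) : C :=
  (g y * (if Nat.odd k then Y k y else Ytilde k y))%C.

End FormalPowers.

(** ** Approximating functions *)

Definition sum_even (m : nat) (F : nat -> C) : C :=
  sum_n (fun k => if Nat.even k then F k else RtoC 0) m.
Definition sum_odd (m : nat) (F : nat -> C) : C :=
  sum_n (fun k => if Nat.odd k then F k else RtoC 0) m.

(* For m = 0 the sum reduces to [Phi 0 = g]. *)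
Definition ctilde (p r : R -> R) (y0 : R) (g : R -> C) (m : nat) (y : R) : C :=
  (RtoC (rho p r y) *
   sum_even m (fun k => RtoC (Binomial.C m k * ell p r y0 y ^ k) *
                        Phi p r y0 g (m - k) y))%C.

Definition stilde (p r : R -> R) (y0 : R) (g : R -> C) (m : nat) (y : R) : C :=
  (RtoC (rho p r y) *
   sum_odd m (fun k => RtoC (Binomial.C m k * ell p r y0 y ^ k) *
                       Phi p r y0 g (m - k) y))%C.

Definition G2 (p r : R -> R) (y0 : R) (Q : R -> C) (y : R) : C :=
  (RtoC (1 / 4) * CInt Q 0 (ell p r y0 y))%C.

Definition G1 (p r : R -> R) (y0 : R) (Q : R -> C) (h : C) (y : R) : C :=
  (h / RtoC 2 + G2 p r y0 Q y)%C.

Definition v1N (p r : R -> R) (y0 : R) (g : R -> C) (a : nat -> C) (N : nat)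
    (omega : C) (y : R) : C :=
  (Ccos (omega * RtoC (ell p r y0 y)) / RtoC (rho p r y) +
   RtoC 2 * sum_n (fun n => a n *
     sum_even n (fun k => RtoC (Binomial.C n k) * Phi p r y0 g (n - k) y *
       CInt (fun t => RtoC (t ^ k) * Ccos (omega * RtoC t))
         0 (ell p r y0 y))) N)%C.

Definition v2N (p r : R -> R) (y0 : R) (g : R -> C) (b : nat -> C) (N : nat)
    (omega : C) (y : R) : C :=
  (/ omega *
   (Csin (omega * RtoC (ell p r y0 y)) / RtoC (rho p r y) +
    RtoC 2 * sum_n_m (fun n => b n *
      sum_odd n (fun k => RtoC (Binomial.C n k) * Phi p r y0 g (n - k) y *
        CInt (fun t => RtoC (t ^ k) * Csin (omega * RtoC t))
          0 (ell p r y0 y))) 1 N))%C.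

(* sinh(c b)/c, with its limit value at c = 0. *)
Definition sinh_quot (c b : R) : R :=
  if Req_EM_T c 0 then b else sinh (c * b) / c.

(* Main.v *)
Require Import Defs.
From Stdlib Require Import Reals Lra Lia.
From Coquelicot Require Import Coquelicot.
Open Scope R_scope.

(** The function [u = rho v] of the variable [x = l(y)] satisfies
    [u'' = (Q - omega^2) u], with [u(0) = 1], [u'(0) = h] for [v1]. Likewise
    [phi_k = rho Phi_k] satisfies [phi_k'' = Q phi_k + k (k-1) phi_(k-2)]. Hence
    [W(x,t)], the sum of [a_n C(n,k) phi_(n-k)(x) t^k] over even [k], is a solution,
    even in [t], of the wave equation [W_xx - Q W = W_tt], and
    [rho v_(1,N) = cos omega x + 2 S(x)], where [S(x)] is the integral of
    [W(x,t) cos omega t] over [0 <= t <= x].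

    The bound is obtained without a transmutation kernel, from the differential
    equation of the error [E = u - cos omega x - 2 S]. Differentiating under the
    integral and integrating by parts twice in [t] gives
    [E'' + omega^2 E = Q E + 4 w'(x) cos omega x], where [w(x) = G1 - W(x,x)] is
    the quantity that the choice of the [a_n] makes small. As [w'] is not
    controlled, one works with the pair [E], [Theta = E' - 4 w cos omega x], whose
    system involves [w] only ([is_Cderive_error], [is_Cderive_quasi_derivative]).
    Variation of constants then reads

      [E(x) = - 2 w(0) sin (omega x) / omega + 4 int_0^x cos (omega (x - 2s)) w(s) ds
              + int_0^x sin (omega (x - s)) / omega * Q(s) E(s) ds].

    In the strip [|Im omega| <= c] put [S_c(x) = sinh (c x) / c]. The first two
    terms are at most [6 eps S_c(x)], whatever the real part of [omega], because
    [cosh (c (x - 2s))] integrates to [S_c(x)]. In the last one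
    [S_c(x - s) S_c(s) <= s S_c(x)], so a Gronwall argument applies to the quotient
    [E / S_c] and yields [|E| <= 12 eps exp (2 M b^2) S_c(b)] with [M] a bound for
    [|Q|] ([volterra_bound]). For [v2] everything holds with the sine, odd [k] and
    [omega v2] in place of the cosine, even [k] and [v1]; one lemma,
    [approximation_error], covers both.

    Two points need care. The equations hold almost everywhere only, but the
    derivative of [u] in [x] is absolutely continuous and its derivative agrees
    almost everywhere with a continuous function, so it is continuously
    differentiable ([AC_loc_C1_of_ae], [liouville_second]). And the solutions live
    on the open interval: the derivative of [E] turns out to be bounded, so [E]
    extends continuously to the end points ([bounded_derivative_extension]). *)

(** * Differentiation of complex-valued functions *)

(** Working with the real and imaginary parts makes the product and quotient
    rules available, which the R-module structure of C alone does not give; it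
    is also the derivative that [deriv] computes. *)
Definition is_Cderive (f : R -> C) (y : R) (l : C) : Prop :=
  is_derive (fun s => Re (f s)) y (Re l) /\
  is_derive (fun s => Im (f s)) y (Im l).

Lemma is_derive_eq (f : R -> R) (x l l' : R) :
  is_derive f x l -> l = l' -> is_derive f x l'.
Proof. intros H <-; exact H. Qed.

Lemma is_Cderive_eq f y l l' : is_Cderive f y l -> l = l' -> is_Cderive f y l'.
Proof. intros H <-; exact H. Qed.

Lemma is_Cderive_of_native (f : R -> C) y (l : C) :
  @is_derive R_AbsRing C_R_NormedModule f y l -> is_Cderive f y l.
Proof.
  intros H; split.
  - exact (filterdiff_comp' f (fun z : C_R_NormedModule => fst z) y _ _ H
      (filterdiff_linear _ (@is_linear_fst R_AbsRing R_NormedModule R_NormedModule))).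
  - exact (filterdiff_comp' f (fun z : C_R_NormedModule => snd z) y _ _ H
      (filterdiff_linear _ (@is_linear_snd R_AbsRing R_NormedModule R_NormedModule))).
Qed.

Lemma is_Cderive_deriv (f : R -> C) y l : is_Cderive f y l -> deriv f y = l.
Proof.
  intros [H1 H2]; apply injective_projections; apply is_derive_unique;
    assumption.
Qed.

Lemma differentiable_at_Cderive (f : R -> C) y :
  differentiable_at f y -> is_Cderive f y (deriv f y).
Proof.
  intros [l H]; apply is_Cderive_of_native in H.
  now rewrite (is_Cderive_deriv _ _ _ H).
Qed.

Lemma is_Cderive_ext_loc (f g : R -> C) y l :
  locally y (fun s => f s = g s) -> is_Cderive f y l -> is_Cderive g y l.
Proof.
  intros H [H1 H2]; split.
  - apply is_derive_ext_loc with (2 := H1).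
    revert H; apply filter_imp; now intros s ->.
  - apply is_derive_ext_loc with (2 := H2).
    revert H; apply filter_imp; now intros s ->.
Qed.

Lemma is_Cderive_ext (f g : R -> C) y l :
  (forall s, f s = g s) -> is_Cderive f y l -> is_Cderive g y l.
Proof. intros H; apply is_Cderive_ext_loc; now apply filter_forall. Qed.

Lemma is_Cderive_const (c : C) y : is_Cderive (fun _ => c) y (RtoC 0).
Proof. split; exact (is_derive_const (V := R_NormedModule) _ y). Qed.

Lemma is_Cderive_RtoC (f : R -> R) y l :
  is_derive f y l -> is_Cderive (fun s => RtoC (f s)) y (RtoC l).
Proof. intros H; split; [exact H | exact (is_derive_const (V := R_NormedModule) _ y)]. Qed.

Lemma is_Cderive_plus (f g : R -> C) y lf lg :
  is_Cderive f y lf -> is_Cderive g y lg ->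
  is_Cderive (fun s => f s + g s)%C y (lf + lg)%C.
Proof.
  intros [H1 H2] [H3 H4]; split.
  - exact (is_derive_plus _ _ _ _ _ H1 H3).
  - exact (is_derive_plus _ _ _ _ _ H2 H4).
Qed.

Lemma is_Cderive_mult (f g : R -> C) y lf lg :
  is_Cderive f y lf -> is_Cderive g y lg ->
  is_Cderive (fun s => f s * g s)%C y (lf * g y + f y * lg)%C.
Proof.
  intros [H1 H2] [H3 H4]; split.
  - eapply is_derive_eq.
    + exact (is_derive_minus _ _ _ _ _ (Derive.is_derive_mult _ _ _ _ _ H1 H3)
                                       (Derive.is_derive_mult _ _ _ _ _ H2 H4)).
    + unfold minus, plus, opp; simpl; unfold Re, Im; ring.
  - eapply is_derive_eq.
    + exact (is_derive_plus _ _ _ _ _ (Derive.is_derive_mult _ _ _ _ _ H1 H4)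
                                       (Derive.is_derive_mult _ _ _ _ _ H2 H3)).
    + unfold minus, plus, opp; simpl; unfold Re, Im; ring.
Qed.

Lemma is_Cderive_scal (c : C) (f : R -> C) y lf :
  is_Cderive f y lf -> is_Cderive (fun s => c * f s)%C y (c * lf)%C.
Proof.
  intros H; eapply is_Cderive_eq.
  - exact (is_Cderive_mult _ _ _ _ _ (is_Cderive_const c y) H).
  - simpl; ring.
Qed.

Lemma is_Cderive_minus (f g : R -> C) y lf lg :
  is_Cderive f y lf -> is_Cderive g y lg ->
  is_Cderive (fun s => f s - g s)%C y (lf - lg)%C.
Proof.
  intros [H1 H2] [H3 H4]; split.
  - exact (is_derive_minus _ _ _ _ _ H1 H3).
  - exact (is_derive_minus _ _ _ _ _ H2 H4).
Qed.

Lemma is_Cderive_inv (f : R -> C) y lf :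
  is_Cderive f y lf -> f y <> RtoC 0 ->
  is_Cderive (fun s => / f s)%C y (- (lf / (f y * f y)))%C.
Proof.
  intros [H1 H2] H0.
  assert (Hn : Re (f y) ^ 2 + Im (f y) ^ 2 <> 0).
  { rewrite <- Cmod2_alt. apply pow_nonzero. intros E; apply H0.
    now apply Cmod_eq_0. }
  assert (Hd := is_derive_plus _ _ _ _ _ (is_derive_pow _ 2 _ _ H1)
                                         (is_derive_pow _ 2 _ _ H2)).
  split.
  - eapply is_derive_eq.
    + exact (is_derive_div _ _ _ _ _ H1 Hd Hn).
    + destruct lf as [a b]; destruct (f y) as [u v].
      unfold minus, plus, opp; simpl in *; unfold Re, Im in *; simpl in *.
      field. split; intros E; apply Hn; [|nra].
      assert (E1 : (u * u + v * v) * (u * u + v * v) = 0) by nra.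
      assert (u * u + v * v = 0) by nra. nra.
  - eapply is_derive_eq.
    + exact (is_derive_div _ _ _ _ _ (is_derive_opp _ _ _ H2) Hd Hn).
    + destruct lf as [a b]; destruct (f y) as [u v].
      unfold minus, plus, opp; simpl in *; unfold Re, Im in *; simpl in *.
      field. split; intros E; apply Hn; [|nra].
      assert (E1 : (u * u + v * v) * (u * u + v * v) = 0) by nra.
      assert (u * u + v * v = 0) by nra. nra.
Qed.

Lemma is_Cderive_comp (f : R -> C) (l : R -> R) y lf dl :
  is_Cderive f (l y) lf -> is_derive l y dl ->
  is_Cderive (fun s => f (l s)) y (RtoC dl * lf)%C.
Proof.
  intros [H1 H2] H; split.
  - eapply is_derive_eq.
    + exact (is_derive_comp (fun s => Re (f s)) l y _ _ H1 H).
    + unfold scal; simpl; unfold mult, Re; simpl; ring.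
  - eapply is_derive_eq.
    + exact (is_derive_comp (fun s => Im (f s)) l y _ _ H2 H).
    + unfold scal; simpl; unfold mult, Im; simpl; ring.
Qed.

Lemma is_Cderive_sum_n (f : nat -> R -> C) (df : nat -> C) n y :
  (forall k, (k <= n)%nat -> is_Cderive (f k) y (df k)) ->
  is_Cderive (fun s => sum_n (fun k => f k s) n) y (sum_n df n).
Proof.
  induction n as [|n IH]; intros H.
  - rewrite sum_O. apply is_Cderive_ext with (2 := H 0%nat (le_n _)).
    intros s; now rewrite sum_O.
  - rewrite sum_Sn.
    apply is_Cderive_ext with (fun s => sum_n (fun k => f k s) n + f (S n) s)%C.
    { intros s; now rewrite sum_Sn. }
    apply is_Cderive_plus; [apply IH; intros; apply H | apply H]; lia.
Qed.

Lemma continuous_C_components (f : R -> C) y :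
  continuous (fun s => Re (f s)) y -> continuous (fun s => Im (f s)) y ->
  continuous f y.
Proof.
  intros H1 H2.
  apply filterlim_ext with (fun s => (Re (f s), Im (f s))).
  { intros s; now destruct (f s). }
  intros P [d Hd].
  assert (G1 := H1 (ball (Re (f y)) d) (locally_ball _ d)).
  assert (G2 := H2 (ball (Im (f y)) d) (locally_ball _ d)).
  unfold filtermap in *.
  generalize (filter_and _ _ G1 G2); apply filter_imp.
  intros s [K1 K2]; apply Hd; split; assumption.
Qed.

Lemma continuous_Re (f : R -> C) y : continuous f y -> continuous (fun s => Re (f s)) y.
Proof.
  intros H; apply (continuous_comp f (fun z : C => fst z) y H).
  destruct (f y); apply continuous_fst.
Qed.

Lemma continuous_Im (f : R -> C) y : continuous f y -> continuous (fun s => Im (f s)) y.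
Proof.
  intros H; apply (continuous_comp f (fun z : C => snd z) y H).
  destruct (f y); apply continuous_snd.
Qed.

Lemma is_Cderive_continuous (f : R -> C) y l : is_Cderive f y l -> continuous f y.
Proof.
  intros [H1 H2]; apply continuous_C_components;
    apply (ex_derive_continuous (V := R_NormedModule)); eexists; eassumption.
Qed.

Lemma continuous_Cmult (f g : R -> C) y :
  continuous f y -> continuous g y -> continuous (fun s => f s * g s)%C y.
Proof.
  intros Hf Hg.
  assert (F1 := continuous_Re _ _ Hf). assert (F2 := continuous_Im _ _ Hf).
  assert (G1 := continuous_Re _ _ Hg). assert (G2 := continuous_Im _ _ Hg).
  apply continuous_C_components.
  - exact (continuous_minus _ _ _ (continuous_mult _ _ _ F1 G1) (continuous_mult _ _ _ F2 G2)).
  - exact (continuous_plus _ _ _ (continuous_mult _ _ _ F1 G2) (continuous_mult _ _ _ F2 G1)).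
Qed.

Lemma continuous_RtoC (f : R -> R) y : continuous f y -> continuous (fun s => RtoC (f s)) y.
Proof. intros H; apply continuous_C_components; [exact H | apply continuous_const]. Qed.

Lemma locally_open_interval (A B y : R) (P : R -> Prop) :
  A < y < B -> (forall s, A < s < B -> P s) -> locally y P.
Proof.
  intros Hy HP.
  assert (H : 0 < Rmin (y - A) (B - y)) by (apply Rmin_glb_lt; lra).
  exists (mkposreal _ H); intros s Hs.
  change (Rabs (s - y) < Rmin (y - A) (B - y)) in Hs.
  assert (M1 := Rmin_l (y - A) (B - y)). assert (M2 := Rmin_r (y - A) (B - y)).
  apply HP; revert Hs; unfold Rabs; destruct Rcase_abs; lra.
Qed.
Lemma is_Cderive_CInt (f : R -> C) (a b x0 x : R) :
  a < x0 < b -> a < x < b ->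
  (forall t, a < t < b -> continuous f t) ->
  is_Cderive (fun s => CInt f x0 s) x (f x).
Proof.
  intros H0 Hx Hc. apply is_Cderive_of_native.
  apply (@is_derive_RInt C_R_NormedModule f _ x0).
  - apply (locally_open_interval a b x); [exact Hx|]. intros s Hs.
    apply (@RInt_correct C_R_CompleteNormedModule).
    apply (@ex_RInt_continuous C_R_CompleteNormedModule).
    intros t Ht; apply (Hc t).
    revert Ht; unfold Rmin, Rmax; destruct Rle_dec; lra.
  - exact (Hc x Hx).
Qed.

Lemma CInt_point (f : R -> C) a : CInt f a a = RtoC 0.
Proof. exact (@RInt_point C_R_CompleteNormedModule a f). Qed.

(** Serves as a substitute for estimating integrals: to bound the increment of
    [f] it is enough to exhibit an antiderivative [G] of the bound. There is no
    mean value theorem for complex values, so [f] is first projected on the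
    direction of its increment. *)
Lemma Cmod_increment_le (f df : R -> C) (G dG : R -> R) (a b : R) :
  a <= b ->
  (forall t, a <= t <= b -> is_Cderive f t (df t)) ->
  (forall t, a <= t <= b -> is_derive G t (dG t)) ->
  (forall t, a <= t <= b -> Cmod (df t) <= dG t) ->
  Cmod (f b - f a)%C <= G b - G a.
Proof.
  intros Hab Hf HG Hle.
  set (z := (f b - f a)%C).
  set (phi := fun t => (Re z * Re (f t) + Im z * Im (f t)) - Cmod z * G t).
  assert (D : forall t, a <= t <= b -> is_derive phi t
     ((Re z * Re (df t) + Im z * Im (df t)) - Cmod z * dG t)).
  { intros t Ht. destruct (Hf t Ht) as [H1 H2].
    apply (is_derive_minus (V := R_NormedModule)).
    - apply (is_derive_plus (V := R_NormedModule)); now apply is_derive_scal.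
    - apply is_derive_scal; auto. }
  destruct (MVT_gen phi a b (fun t => (Re z * Re (df t) + Im z * Im (df t)) - Cmod z * dG t))
    as [c [Hc E]].
  - rewrite Rmin_left, Rmax_right by lra. intros; apply D; lra.
  - rewrite Rmin_left, Rmax_right by lra. intros t Ht.
    apply continuity_pt_filterlim.
    apply (ex_derive_continuous phi t). eexists; apply D; lra.
  - rewrite Rmin_left, Rmax_right in Hc by lra.
    assert (CS : Re z * Re (df c) + Im z * Im (df c) <= Cmod z * Cmod (df c)).
    { replace (Re z * Re (df c) + Im z * Im (df c)) with (Re (Cconj z * df c)%C)
        by (simpl; unfold Re, Im; ring).
      rewrite <- (Cmod_conj z), <- Cmod_mult.
      eapply Rle_trans; [apply Rle_abs | apply re_le_Cmod]. }
    assert (P := Cmod_ge_0 z).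
    assert (Cmod z * Cmod (df c) <= Cmod z * dG c)
      by (apply Rmult_le_compat_l; auto).
    assert (E2 : phi b - phi a = Cmod z ^ 2 - Cmod z * (G b - G a)).
    { rewrite Cmod2_alt. unfold phi.
      replace (Re z) with (Re (f b) - Re (f a)) by (unfold z; simpl; unfold Re; ring).
      replace (Im z) with (Im (f b) - Im (f a)) by (unfold z; simpl; unfold Im; ring).
      ring. }
    destruct (Req_dec (Cmod z) 0) as [Z|Z].
    (* The increment vanishes; what remains is that [G] is nondecreasing. *)
    + rewrite Z.
      destruct (MVT_gen G a b dG) as [c' [Hc' E']].
      * rewrite Rmin_left, Rmax_right by lra. intros; apply HG; lra.
      * rewrite Rmin_left, Rmax_right by lra. intros t Ht.
        apply continuity_pt_filterlim.
        apply (ex_derive_continuous G t). eexists; apply HG; lra.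
      * rewrite Rmin_left, Rmax_right in Hc' by lra.
        assert (0 <= dG c') by (eapply Rle_trans; [apply Cmod_ge_0 | apply Hle; lra]).
        rewrite E'. apply Rmult_le_pos; lra.
    + assert (0 < Cmod z) by lra.
      assert (phi b - phi a <= 0).
      { rewrite E.
        assert (0 <= (Cmod z * dG c - (Re z * Re (df c) + Im z * Im (df c))) * (b - a))
          by (apply Rmult_le_pos; lra). nra. }
      apply Rmult_le_reg_l with (Cmod z); [lra|]. nra.
Qed.

(** * Absolutely continuous functions with derivative given almost everywhere *)

(** Replaces Cousin's lemma on tagged partitions: a property that can be carried
    across a small interval around each point can be carried from [a] to [b], by
    considering the supremum of the points already reached. *)
Lemma interval_induction (P : R -> Prop) (a b : R) :
  a <= b -> P a ->
  (forall t, a <= t <= b -> exists delta, 0 < delta /\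
     forall u v, a <= u -> t - delta < u -> u <= t <= v -> v < t + delta ->
       v <= b -> P u -> P v) ->
  P b.
Proof.
  intros Hab Ha Hstep.
  destruct (completeness (fun x => a <= x <= b /\ P x)) as [T [HT1 HT2]].
  - exists b; intros x [Hx _]; lra.
  - exists a; split; [lra | exact Ha].
  - assert (aT : a <= T) by (apply HT1; split; [lra | exact Ha]).
    assert (Tb : T <= b) by (apply HT2; intros x [Hx _]; lra).
    destruct (Hstep T (conj aT Tb)) as [d [Hd Hs]].
    assert (Hu : exists u, a <= u <= b /\ P u /\ T - d < u /\ u <= T).
    { destruct (Classical_Prop.classic
        (exists u, a <= u <= b /\ P u /\ T - d < u /\ u <= T)) as [|N]; [assumption|].
      exfalso. assert (T <= T - d); [|lra].
      apply HT2; intros x [Hx Px].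
      destruct (Rle_or_lt x (T - d)) as [|L]; [assumption|].
      exfalso; apply N; exists x; repeat split; try lra; [assumption|].
      apply HT1; split; [lra | assumption]. }
    destruct Hu as [u [Hu [Pu [H1 H2]]]].
    assert (Pv : P (Rmin b (T + d / 2))).
    { assert (M1 := Rmin_l b (T + d / 2)). assert (M2 := Rmin_r b (T + d / 2)).
      assert (T <= Rmin b (T + d / 2)) by (apply Rmin_glb; lra).
      apply Hs with u; try lra; auto. }
    destruct (Rle_or_lt b (T + d / 2)).
    + now rewrite Rmin_left in Pv by lra.
    + rewrite Rmin_right in Pv by lra.
      assert (T + d / 2 <= T) by (apply HT1; split; [lra | assumption]). lra.
Qed.

(** Compactness of [[a,b]] in the form needed for functions that are merely
    continuous on [[a,b]] and may be wild outside. *)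
Lemma bounded_of_locally_bounded (f : R -> R) (a b : R) :
  a <= b ->
  (forall t, a <= t <= b -> exists delta M, 0 < delta /\
     forall y, a <= y <= b -> Rabs (y - t) < delta -> f y <= M) ->
  exists M, forall y, a <= y <= b -> f y <= M.
Proof.
  intros Hab H.
  apply (interval_induction (fun x => exists M, forall y, a <= y <= x -> f y <= M) a b Hab).
  - exists (f a); intros y Hy; replace y with a by lra; lra.
  - intros t Ht; destruct (H t Ht) as [d [M [Hd HM]]]; exists d; split; [exact Hd|].
    intros u v H1 H2 H3 H4 H5 [M' HM']; exists (Rmax M M'); intros y Hy.
    destruct (Rle_or_lt y u).
    + eapply Rle_trans; [apply HM'; lra | apply Rmax_r].
    + eapply Rle_trans; [apply HM; [lra|] | apply Rmax_l].
      unfold Rabs; destruct Rcase_abs; lra.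
Qed.

Lemma continuous_on_bounded (f : R -> C) (a b : R) :
  a <= b -> continuous_on (fun x => a <= x <= b) f ->
  exists M, forall y, a <= y <= b -> Cmod (f y) <= M.
Proof.
  intros Hab H; apply (bounded_of_locally_bounded (fun y => Cmod (f y))); auto.
  intros t Ht.
  destruct (H t Ht (ball (f t) 1)) as [d Hd].
  { exact (locally_ball (f t) (mkposreal 1 Rlt_0_1)). }
  exists d, (Cmod (f t) + 2); split; [apply cond_pos|].
  intros y Hy Hyt.
  assert (B := Hd y Hyt Hy).
  destruct B as [B1 B2].
  change (Rabs (Re (f y) - Re (f t)) < 1) in B1.
  change (Rabs (Im (f y) - Im (f t)) < 1) in B2.
  replace (f y) with (f t + (f y - f t))%C by ring.
  eapply Rle_trans; [apply Cmod_triangle|]. apply Rplus_le_compat_l.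
  eapply Rle_trans; [apply Cmod_2Rmax|].
  assert (sqrt 2 <= 2).
  { rewrite <- (sqrt_Rsqr 2) at 2 by lra. apply sqrt_le_1; unfold Rsqr; lra. }
  assert (0 <= sqrt 2) by apply sqrt_pos.
  assert (Rmax (Rabs (fst (f y - f t)%C)) (Rabs (snd (f y - f t)%C)) <= 1).
  { apply Rmax_lub; [replace (fst (f y - f t)%C) with (Re (f y) - Re (f t)) |
      replace (snd (f y - f t)%C) with (Im (f y) - Im (f t))];
      try (simpl; unfold Re, Im; ring); lra. }
  nra.
Qed.

Lemma Cmod_Re_Im (z : C) : Cmod z <= Rabs (Re z) + Rabs (Im z).
Proof.
  assert (P := Cmod2_alt z). assert (Q := Cmod_ge_0 z).
  rewrite <- (pow2_abs (Re z)), <- (pow2_abs (Im z)) in P.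
  assert (0 <= Rabs (Re z)) by apply Rabs_pos.
  assert (0 <= Rabs (Im z)) by apply Rabs_pos.
  apply Rsqr_incr_0_var; unfold Rsqr; nra.
Qed.

Lemma sum_n_le_upto (a b : nat -> R) n :
  (forall k, (k <= n)%nat -> a k <= b k) -> sum_n a n <= sum_n b n.
Proof.
  induction n as [|n IH]; intros H.
  - rewrite !sum_O; apply H; lia.
  - rewrite !sum_Sn; apply Rplus_le_compat; [apply IH; intros; apply H | apply H]; lia.
Qed.

Lemma sum_n_le_bump (a b : nat -> R) m n x :
  (m <= n)%nat -> (forall k, a k <= b k) -> a m + x <= b m ->
  sum_n a n + x <= sum_n b n.
Proof.
  induction n as [|n IH]; intros Hm Hk Hx.
  - replace m with 0%nat in Hx by lia; now rewrite !sum_O.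
  - rewrite !sum_Sn; unfold plus; simpl.
    destruct (Nat.eq_dec m (S n)) as [->|N].
    + assert (sum_n a n <= sum_n b n) by (apply sum_n_le_upto; auto). lra.
    + assert (sum_n a n + x <= sum_n b n) by (apply IH; auto; lia).
      specialize (Hk (S n)); lra.
Qed.

Lemma sum_n_pos_mono (a : nat -> R) n m :
  (forall k, 0 <= a k) -> (n <= m)%nat -> sum_n a n <= sum_n a m.
Proof.
  intros H; induction 1 as [|m Hm IH]; [lra|].
  rewrite sum_Sn; unfold plus; simpl. specialize (H (S m)); lra.
Qed.

Lemma sum_n_scal_R (x : R) (a : nat -> R) n : sum_n (fun k => x * a k) n = x * sum_n a n.
Proof.
  induction n as [|n IH]; [now rewrite !sum_O|].
  rewrite !sum_Sn, IH; unfold plus; simpl; ring.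
Qed.

Lemma sum_n_plus_R (a b : nat -> R) n :
  sum_n (fun k => a k + b k) n = sum_n a n + sum_n b n.
Proof.
  induction n as [|n IH]; [now rewrite !sum_O|].
  rewrite !sum_Sn, IH; unfold plus; simpl; ring.
Qed.

Lemma is_Cderive_0_small (f : R -> C) t eta :
  0 < eta -> is_Cderive f t (RtoC 0) ->
  exists delta, 0 < delta /\ forall u v, t - delta < u -> u <= t <= v ->
    v < t + delta -> Cmod (f v - f u)%C <= eta * (v - u).
Proof.
  intros Heta [H1 H2].
  apply is_derive_Reals in H1. apply is_derive_Reals in H2.
  destruct (H1 (eta / 2)) as [d1 K1]; [lra|].
  destruct (H2 (eta / 2)) as [d2 K2]; [lra|].
  assert (loc : forall (F : R -> R) d,
     (forall h, h <> 0 -> Rabs h < d -> Rabs ((F (t + h) - F t) / h - 0) < eta / 2) ->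
     forall s, Rabs (s - t) < d -> Rabs (F s - F t) <= eta / 2 * Rabs (s - t)).
  { intros F d K s Hs. destruct (Req_dec s t) as [->|N].
    - rewrite !Rminus_diag, Rabs_R0; lra.
    - specialize (K (s - t)). replace (t + (s - t)) with s in K by ring.
      rewrite Rminus_0_r in K. unfold Rdiv in K. rewrite Rabs_mult, Rabs_inv in K.
      assert (0 < Rabs (s - t)) by (apply Rabs_pos_lt; lra).
      assert (K' := K ltac:(lra) Hs).
      apply Rmult_le_reg_r with (/ Rabs (s - t)); [now apply Rinv_0_lt_compat|].
      rewrite Rmult_assoc, Rinv_r by lra. lra. }
  exists (Rmin d1 d2); split; [apply Rmin_glb_lt; apply cond_pos|].
  intros u v Hu Hm Hv.
  assert (M1 := Rmin_l d1 d2). assert (M2 := Rmin_r d1 d2).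
  assert (Au : Rabs (u - t) = t - u) by (rewrite Rabs_left1; lra).
  assert (Av : Rabs (v - t) = v - t) by (rewrite Rabs_right; lra).
  assert (A1 := loc (fun s => Re (f s)) _ K1 u ltac:(lra)). assert (A2 := loc (fun s => Re (f s)) _ K1 v ltac:(lra)).
  assert (A3 := loc (fun s => Im (f s)) _ K2 u ltac:(lra)). assert (A4 := loc (fun s => Im (f s)) _ K2 v ltac:(lra)).
  rewrite Au in *; rewrite Av in *.
  eapply Rle_trans; [apply Cmod_Re_Im|].
  replace (Re (f v - f u)%C) with ((Re (f v) - Re (f t)) - (Re (f u) - Re (f t)))
    by (simpl; unfold Re; ring).
  replace (Im (f v - f u)%C) with ((Im (f v) - Im (f t)) - (Im (f u) - Im (f t)))
    by (simpl; unfold Im; ring).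
  assert (T1 := Rabs_triang (Re (f v) - Re (f t)) (- (Re (f u) - Re (f t)))).
  assert (T2 := Rabs_triang (Im (f v) - Im (f t)) (- (Im (f u) - Im (f t)))).
  rewrite Rabs_Ropp in T1, T2. unfold Rminus at 1 4.
  lra.
Qed.

(** Around a point of [E], cross an interval lying in one member of a short cover
    of [E]; the increments collected there have small sum by absolute continuity.
    Around any other point the increment is at most [eps] times the length. The
    property carried from [a] to [b] records the intervals [[l i, u i]] used so
    far and compares their total length with the part of the cover to the left of
    [x], which finitely many members measure. *)
Lemma AC_deriv_0_const (a b : R) (f : R -> C) (E : R -> Prop) :
  a <= b -> AC a b f -> null_set E ->
  (forall y, a <= y <= b -> ~ E y -> is_Cderive f y (RtoC 0)) ->
  f b = f a.
Proof.
  intros Hab HAC HE Hder.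
  enough (Small : forall eps, 0 < eps -> Cmod (f b - f a)%C <= eps * (b - a) + eps).
  { assert (Z : Cmod (f b - f a)%C = 0).
    { apply Rle_antisym; [|apply Cmod_ge_0].
      apply le_epsilon; intros e He.
      assert (0 < b - a + 1) by lra.
      specialize (Small (e / (b - a + 1)) ltac:(now apply Rdiv_lt_0_compat)).
      replace (e / (b - a + 1) * (b - a) + e / (b - a + 1)) with e in Small by (field; lra).
      lra. }
    apply Cmod_eq_0 in Z.
    replace (f b) with ((f b - f a) + f a)%C by ring. rewrite Z; ring. }
  intros eps Heps.
  destruct (HAC eps Heps) as [delta [Hdelta HA]].
  destruct (HE (delta / 2) ltac:(lra)) as [c [d [Hcd [Hcov Hlen]]]].
  (* [lam k x - lam k a] is the length of the k-th interval of the cover within [[a,x]]. *)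
  set (lam := fun k x => Rmin x (d k) - Rmin x (c k)).
  assert (lam_mono : forall k u v, u <= v -> lam k u <= lam k v).
  { intros k u v Huv; specialize (Hcd k); unfold lam, Rmin; repeat destruct Rle_dec; lra. }
  assert (lam_le : forall k u v, u <= v -> lam k v - lam k u <= d k - c k).
  { intros k u v Huv; specialize (Hcd k); unfold lam, Rmin; repeat destruct Rle_dec; lra. }
  assert (lam_in : forall k u v, u <= v -> c k < u -> v < d k -> lam k v - lam k u = v - u).
  { intros k u v Huv H1 H2; specialize (Hcd k); unfold lam, Rmin; repeat destruct Rle_dec; lra. }
  set (P := fun x => exists N n (l u : nat -> R),
    (forall i, (i <= n)%nat -> a <= l i /\ l i <= u i /\ u i <= x) /\
    (forall i j, (i < j)%nat -> (j <= n)%nat -> u i <= l j) /\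
    sum_n (fun i => u i - l i) n <= sum_n (fun k => lam k x - lam k a) N /\
    Cmod (f x - f a)%C <= eps * (x - a) + sum_n (fun i => Cmod (f (u i) - f (l i))%C) n).
  assert (Pb : P b).
  { apply (interval_induction P a b Hab).
    - exists 0%nat, 0%nat, (fun _ => a), (fun _ => a); repeat split; intros; try lra.
      + rewrite !sum_O; lra.
      + rewrite sum_O. replace (f a - f a)%C with (RtoC 0) by ring.
        rewrite Cmod_0; lra.
    - intros t Ht. destruct (Classical_Prop.classic (E t)) as [Et|Et].
      + destruct (Hcov t Et) as [m Hm].
        exists (Rmin (t - c m) (d m - t)); split; [apply Rmin_glb_lt; lra|].
        intros u0 v Hu0 H1 H2 H3 H4 [N [n [l [u [K1 [K2 [K3 K4]]]]]]].
        assert (M1 := Rmin_l (t - c m) (d m - t)). assert (M2 := Rmin_r (t - c m) (d m - t)).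
        exists (Nat.max N m), (S n), (fun i => if Nat.leb i n then l i else u0),
          (fun i => if Nat.leb i n then u i else v).
        assert (Le : forall i, (i <= n)%nat -> Nat.leb i n = true)
          by (intros; now apply Nat.leb_le).
        assert (Gt : Nat.leb (S n) n = false) by (apply Nat.leb_gt; lia).
        split; [|split; [|split]].
        * intros i Hi. destruct (Nat.leb_spec i n); [|lra].
          destruct (K1 i H) as [? [? ?]]; lra.
        * intros i j Hij Hj. rewrite (Le i) by lia.
          destruct (Nat.leb_spec j n); [apply K2; lia|].
          destruct (K1 i ltac:(lia)) as [? [? ?]]; lra.
        * rewrite sum_Sn, Gt; unfold plus; simpl.
          rewrite (sum_n_ext_loc _ (fun i => u i - l i))
            by (intros k Hk; now rewrite Le).
          apply Rle_trans with (sum_n (fun k => lam k u0 - lam k a) (Nat.max N m) + (v - u0)).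
          -- apply Rplus_le_compat_r. eapply Rle_trans; [exact K3|].
             apply sum_n_pos_mono; [|lia].
             intros k; assert (lam k a <= lam k u0) by (apply lam_mono; lra); lra.
          -- apply sum_n_le_bump with m; [lia| |].
             ++ intros k; assert (lam k u0 <= lam k v) by (apply lam_mono; lra); lra.
             ++ assert (lam m v - lam m u0 = v - u0) by (apply lam_in; lra). lra.
        * rewrite sum_Sn, Gt; unfold plus; simpl.
          rewrite (sum_n_ext_loc _ (fun i => Cmod (f (u i) - f (l i))%C))
            by (intros k Hk; now rewrite Le).
          replace (f v - f a)%C with ((f u0 - f a) + (f v - f u0))%C by ring.
          eapply Rle_trans; [apply Cmod_triangle|].
          assert (0 <= eps * (v - u0)) by (apply Rmult_le_pos; lra).
          lra.
      + destruct (is_Cderive_0_small f t eps Heps (Hder t Ht Et)) as [dl [Hdl Hs]].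
        exists dl; split; [exact Hdl|].
        intros u0 v Hu0 H1 H2 H3 H4 [N [n [l [u [K1 [K2 [K3 K4]]]]]]].
        exists N, n, l, u; split; [|split; [|split]].
        * intros i Hi; destruct (K1 i Hi) as [? [? ?]]; lra.
        * exact K2.
        * eapply Rle_trans; [exact K3|]. apply sum_n_le_upto; intros k _.
          assert (lam k u0 <= lam k v) by (apply lam_mono; lra); lra.
        * replace (f v - f a)%C with ((f u0 - f a) + (f v - f u0))%C by ring.
          eapply Rle_trans; [apply Cmod_triangle|].
          specialize (Hs u0 v H1 H2 H3). lra. }
  destruct Pb as [N [n [l [u [K1 [K2 [K3 K4]]]]]]].
  assert (S1 : sum_n (fun i => u i - l i) n < delta).
  { apply Rle_lt_trans with (delta / 2); [|lra].
    eapply Rle_trans; [exact K3|]. eapply Rle_trans; [|exact (Hlen N)].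
    apply sum_n_le_upto; intros k _; now apply lam_le. }
  specialize (HA n l u).
  assert (S2 := HA K1 (fun i j Hi Hj => or_introl (K2 i j Hi Hj)) S1).
  lra.
Qed.

Lemma AC_uniform (a b : R) (f : R -> C) : AC a b f ->
  forall eps, 0 < eps -> exists delta, 0 < delta /\
    forall u v, a <= u -> u <= v -> v <= b -> v - u < delta -> Cmod (f v - f u)%C < eps.
Proof.
  intros H eps Heps; destruct (H eps Heps) as [delta [Hd K]].
  exists delta; split; [exact Hd|]. intros u v H1 H2 H3 H4.
  specialize (K 0%nat (fun _ => u) (fun _ => v)). rewrite !sum_O in K.
  apply K; auto; intros; lia.
Qed.

Lemma AC_bounded (a b : R) (f : R -> C) : a <= b -> AC a b f ->
  exists M, 0 <= M /\ forall y, a <= y <= b -> Cmod (f y) <= M.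
Proof.
  intros Hab H. destruct (AC_uniform _ _ _ H 1 Rlt_0_1) as [delta [Hd K]].
  destruct (bounded_of_locally_bounded (fun y => Cmod (f y)) a b Hab) as [M HM].
  - intros t Ht; exists delta, (Cmod (f t) + 1); split; [exact Hd|].
    intros y Hy Hyt.
    replace (f y) with (f t + (f y - f t))%C by ring.
    eapply Rle_trans; [apply Cmod_triangle|]. apply Rplus_le_compat_l.
    destruct (Rle_or_lt t y).
    + left; apply K; try lra. rewrite Rabs_right in Hyt by lra; lra.
    + replace (f y - f t)%C with (- (f t - f y))%C by ring. rewrite Cmod_opp.
      left; apply K; try lra. rewrite Rabs_left in Hyt by lra; lra.
  - exists M; split; [|exact HM].
    eapply Rle_trans; [apply (Cmod_ge_0 (f a))| apply HM; lra].
Qed.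

Lemma AC_loc_continuous (A B : R) (f : R -> C) t :
  AC_loc A B f -> A < t < B -> continuous f t.
Proof.
  intros H Ht.
  assert (K := AC_uniform _ _ _ (H ((A + t) / 2) ((t + B) / 2) ltac:(lra) ltac:(lra) ltac:(lra))).
  assert (Main : forall eps, 0 < eps -> exists delta, 0 < delta /\
     forall y, Rabs (y - t) < delta -> Cmod (f y - f t)%C < eps).
  { intros eps Heps; destruct (K eps Heps) as [d [Hd Hs]].
    assert (0 < Rmin d (Rmin ((t - A) / 2) ((B - t) / 2)))
      by (repeat apply Rmin_glb_lt; lra).
    exists (Rmin d (Rmin ((t - A) / 2) ((B - t) / 2))); split; [assumption|].
    intros y Hy.
    assert (M1 := Rmin_l d (Rmin ((t - A) / 2) ((B - t) / 2))).
    assert (M2 := Rmin_r d (Rmin ((t - A) / 2) ((B - t) / 2))).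
    assert (M3 := Rmin_l ((t - A) / 2) ((B - t) / 2)).
    assert (M4 := Rmin_r ((t - A) / 2) ((B - t) / 2)).
    destruct (Rle_or_lt t y).
    - rewrite Rabs_right in Hy by lra. apply Hs; lra.
    - rewrite Rabs_left in Hy by lra.
      replace (f y - f t)%C with (- (f t - f y))%C by ring. rewrite Cmod_opp.
      apply Hs; lra. }
  intros P [e He]; destruct (Main e (cond_pos e)) as [d [Hd Hs]].
  exists (mkposreal d Hd); intros y Hy; apply He.
  specialize (Hs y Hy).
  split.
  - change (Rabs (Re (f y) - Re (f t)) < e).
    replace (Re (f y) - Re (f t)) with (Re (f y - f t)%C) by (simpl; unfold Re; ring).
    eapply Rle_lt_trans; [apply re_le_Cmod | exact Hs].
  - change (Rabs (Im (f y) - Im (f t)) < e).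
    replace (Im (f y) - Im (f t)) with (Re (- Ci * (f y - f t))%C)
      by (simpl; unfold Re, Im; ring).
    eapply Rle_lt_trans; [apply re_le_Cmod |].
    rewrite Cmod_mult, Cmod_opp, Cmod_Ci. lra.
Qed.

Lemma AC_ext (a b : R) (f g : R -> C) :
  (forall y, a <= y <= b -> f y = g y) -> AC a b f -> AC a b g.
Proof.
  intros E H eps Heps; destruct (H eps Heps) as [d [Hd K]].
  exists d; split; [exact Hd|]. intros n c u H1 H2 H3.
  eapply Rle_lt_trans; [|exact (K n c u H1 H2 H3)].
  apply sum_n_le_upto; intros k Hk; destruct (H1 k Hk) as [? [? ?]].
  rewrite <- !E by lra; lra.
Qed.

(** Sums and products of absolutely continuous functions have increments
    dominated in this way. *)
Lemma AC_dominated (a b : R) (f g h : R -> C) (M : R) :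
  0 <= M ->
  (forall u v, a <= u -> u <= v -> v <= b ->
     Cmod (h v - h u)%C <= M * Cmod (f v - f u)%C + M * Cmod (g v - g u)%C) ->
  AC a b f -> AC a b g -> AC a b h.
Proof.
  intros HM Hdom Hf Hg eps Heps.
  set (e := eps / (2 * (M + 1))).
  assert (He : 0 < e) by (apply Rdiv_lt_0_compat; lra).
  destruct (Hf e He) as [d1 [Hd1 K1]]. destruct (Hg e He) as [d2 [Hd2 K2]].
  exists (Rmin d1 d2); split; [now apply Rmin_glb_lt|].
  intros n c d H1 H2 H3.
  assert (L1 := K1 n c d H1 H2 (Rlt_le_trans _ _ _ H3 (Rmin_l _ _))).
  assert (L2 := K2 n c d H1 H2 (Rlt_le_trans _ _ _ H3 (Rmin_r _ _))).
  apply Rle_lt_trans with (M * sum_n (fun i => Cmod (f (d i) - f (c i))%C) n +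
                           M * sum_n (fun i => Cmod (g (d i) - g (c i))%C) n).
  - rewrite <- !sum_n_scal_R, <- sum_n_plus_R.
    apply sum_n_le_upto; intros k Hk; destruct (H1 k Hk) as [? [? ?]]; now apply Hdom.
  - assert (M * sum_n (fun i => Cmod (f (d i) - f (c i))%C) n <= M * e)
      by (apply Rmult_le_compat_l; lra).
    assert (M * sum_n (fun i => Cmod (g (d i) - g (c i))%C) n <= M * e)
      by (apply Rmult_le_compat_l; lra).
    assert (eps = 2 * (M * e) + 2 * e) by (unfold e; field; lra). lra.
Qed.

Lemma AC_loc_mult (A B : R) (f g : R -> C) :
  AC_loc A B f -> AC_loc A B g -> AC_loc A B (fun y => f y * g y)%C.
Proof.
  intros Hf Hg a b Ha Hab Hb.
  destruct (AC_bounded a b f Hab (Hf a b Ha Hab Hb)) as [M1 [P1 B1]].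
  destruct (AC_bounded a b g Hab (Hg a b Ha Hab Hb)) as [M2 [P2 B2]].
  apply AC_dominated with f g (M1 + M2); auto; [lra|].
  intros u v H1 H2 H3.
  replace (f v * g v - f u * g u)%C with ((f v - f u) * g v + f u * (g v - g u))%C by ring.
  eapply Rle_trans; [apply Cmod_triangle|]. rewrite !Cmod_mult.
  assert (C1 := B1 u ltac:(lra)). assert (C2 := B2 v ltac:(lra)).
  assert (0 <= Cmod (f v - f u)%C) by apply Cmod_ge_0.
  assert (0 <= Cmod (g v - g u)%C) by apply Cmod_ge_0.
  nra.
Qed.

Lemma AC_loc_plus (A B : R) (f g : R -> C) :
  AC_loc A B f -> AC_loc A B g -> AC_loc A B (fun y => f y + g y)%C.
Proof.
  intros Hf Hg a b Ha Hab Hb.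
  apply AC_dominated with f g 1; auto; [lra|].
  intros u v H1 H2 H3.
  replace (f v + g v - (f u + g u))%C with ((f v - f u) + (g v - g u))%C by ring.
  eapply Rle_trans; [apply Cmod_triangle|]. lra.
Qed.

Lemma AC_loc_minus (A B : R) (f g : R -> C) :
  AC_loc A B f -> AC_loc A B g -> AC_loc A B (fun y => f y - g y)%C.
Proof.
  intros Hf Hg a b Ha Hab Hb.
  apply AC_dominated with f g 1; auto; [lra|].
  intros u v H1 H2 H3.
  replace (f v - g v - (f u - g u))%C with ((f v - f u) + - (g v - g u))%C by ring.
  eapply Rle_trans; [apply Cmod_triangle|]. rewrite Cmod_opp. lra.
Qed.

Lemma AC_loc_ext (A B : R) (f g : R -> C) :
  (forall y, A < y < B -> f y = g y) -> AC_loc A B f -> AC_loc A B g.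
Proof.
  intros E H a b Ha Hab Hb; apply AC_ext with f; [|now apply H].
  intros y Hy; apply E; lra.
Qed.

Lemma AC_loc_C1 (A B : R) (f df : R -> C) :
  (forall y, A < y < B -> is_Cderive f y (df y)) ->
  (forall y, A < y < B -> continuous df y) -> AC_loc A B f.
Proof.
  intros Hf Hc a b Ha Hab Hb.
  destruct (continuous_on_bounded df a b Hab) as [M HM].
  { apply continuous_on_forall; intros t Ht; apply Hc; lra. }
  assert (HM0 : 0 <= M) by (eapply Rle_trans; [apply (Cmod_ge_0 (df a)) | apply HM; lra]).
  intros eps Heps. exists (eps / (M + 1)); split; [apply Rdiv_lt_0_compat; lra|].
  intros n c d H1 _ H3.
  apply Rle_lt_trans with ((M + 1) * sum_n (fun i => d i - c i) n).
  - rewrite <- sum_n_scal_R. apply sum_n_le_upto; intros k Hk.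
    destruct (H1 k Hk) as [? [? ?]].
    eapply Rle_trans.
    + apply (Cmod_increment_le f df (fun t => (M + 1) * t) (fun _ => M + 1)); [lra|..].
      * intros; apply Hf; lra.
      * intros t Ht. auto_derive; [exact I|ring].
      * intros t Ht. eapply Rle_trans; [apply HM; lra|lra].
    + simpl; lra.
  - replace eps with ((M + 1) * (eps / (M + 1))) by (field; lra).
    apply Rmult_lt_compat_l; lra.
Qed.

(** The difference of [f] and the primitive of the continuous function [df] is
    absolutely continuous with derivative zero almost everywhere, hence constant.
    This is what turns the almost everywhere equations into classical ones. *)
Lemma AC_loc_C1_of_ae (A B : R) (f df : R -> C) :
  AC_loc A B f -> (forall y, A < y < B -> continuous df y) ->
  almost_everywhere A B (fun y => is_Cderive f y (df y)) ->
  forall y, A < y < B -> is_Cderive f y (df y).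
Proof.
  intros Hf Hc Hae y Hy.
  set (F := fun s => CInt df y s).
  assert (DF : forall s, A < s < B -> is_Cderive F s (df s)).
  { intros s Hs; now apply is_Cderive_CInt with A B. }
  assert (HD : AC_loc A B (fun s => f s - F s)%C).
  { apply AC_loc_minus; [exact Hf | now apply AC_loc_C1 with df]. }
  assert (Const : forall s t, A < s -> s <= t -> t < B -> (f t - F t = f s - F s)%C).
  { intros s t H1 H2 H3.
    apply (AC_deriv_0_const s t (fun s => f s - F s)%C _ H2 (HD s t H1 H2 H3) Hae).
    intros z Hz Nz.
    assert (Dz : is_Cderive f z (df z)).
    { destruct (Classical_Prop.classic (is_Cderive f z (df z))); [assumption|].
      exfalso; apply Nz; split; [lra|assumption]. }
    eapply is_Cderive_eq; [apply is_Cderive_minus; [exact Dz | apply DF; lra] | ring]. }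
  apply is_Cderive_ext_loc with (fun s => F s + (f y - F y))%C.
  - apply (locally_open_interval A B); [exact Hy|]. intros s Hs.
    destruct (Rle_or_lt y s).
    + rewrite <- (Const y s) by lra. ring.
    + rewrite (Const s y) by lra. ring.
  - eapply is_Cderive_eq; [apply is_Cderive_plus; [now apply DF | apply is_Cderive_const] | ring].
Qed.

(** * Complex sine and cosine in a strip *)

Lemma Cexp_plus (z w : C) : Cexp (z + w) = (Cexp z * Cexp w)%C.
Proof.
  destruct z as [a b], w as [c d]; unfold Cexp; simpl.
  rewrite exp_plus, cos_plus, sin_plus.
  apply injective_projections; simpl; ring.
Qed.

Lemma Cexp_0 : Cexp (RtoC 0) = RtoC 1.
Proof.
  unfold Cexp; simpl; rewrite exp_0, cos_0, sin_0.
  apply injective_projections; simpl; ring.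
Qed.

Lemma Cmod_Cexp (z : C) : Cmod (Cexp z) = exp (Re z).
Proof.
  unfold Cexp; rewrite Cmod_mult, Cmod_R, Rabs_right by (left; apply exp_pos).
  replace (Cmod (cos (Im z), sin (Im z))) with 1; [ring|].
  assert (T := sin2_cos2 (Im z)); unfold Rsqr in T.
  unfold Cmod; simpl. rewrite <- sqrt_1 at 1; f_equal. lra.
Qed.

Lemma is_Cderive_Cexp (z : C) (x : R) :
  is_Cderive (fun s => Cexp (z * RtoC s)) x (z * Cexp (z * RtoC x))%C.
Proof.
  destruct z as [a b].
  split; unfold Cexp; simpl; unfold Re, Im; simpl; auto_derive; auto; simpl; unfold Rminus; ring.
Qed.

Lemma Ci_neq_0 : Ci <> RtoC 0.
Proof. intros E; apply (f_equal snd) in E; simpl in E; lra. Qed.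

Lemma RtoC2_neq_0 : RtoC 2 <> RtoC 0.
Proof. intros E; apply (f_equal fst) in E; simpl in E; lra. Qed.

Ltac C_nonzero :=
  repeat split; solve [exact Ci_neq_0 | exact RtoC2_neq_0
    | intros E; apply (f_equal fst) in E; simpl in E; lra].

Lemma is_Cderive_Ccos (w : C) (x : R) :
  is_Cderive (fun s => Ccos (w * RtoC s)) x (- (w * Csin (w * RtoC x)))%C.
Proof.
  eapply is_Cderive_eq; [eapply is_Cderive_ext; [|
    apply (is_Cderive_scal (/ RtoC 2)); apply is_Cderive_plus;
    [exact (is_Cderive_Cexp (Ci * w) x) | exact (is_Cderive_Cexp (- (Ci * w)) x)]]|].
  - intros s; simpl. unfold Ccos, Cdiv.
    replace (- (Ci * (w * RtoC s)))%C with (- (Ci * w) * RtoC s)%C by ring.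
    replace (Ci * (w * RtoC s))%C with (Ci * w * RtoC s)%C by ring. ring.
  - unfold Csin, Cdiv.
    replace (Ci * (w * RtoC x))%C with (Ci * w * RtoC x)%C by ring.
    replace (- (Ci * w * RtoC x))%C with (- (Ci * w) * RtoC x)%C by ring.
    assert (I : (Ci * Ci = - RtoC 1)%C) by (apply injective_projections; simpl; ring).
    set (e := Cexp (Ci * w * RtoC x)); set (e' := Cexp (- (Ci * w) * RtoC x)).
    replace (/ RtoC 2 * (Ci * w * e + - (Ci * w) * e'))%C
      with (/ (RtoC 2 * Ci) * ((Ci * Ci) * w * (e - e')))%C.
    + rewrite I; ring.
    + field; C_nonzero.
Qed.

Lemma is_Cderive_Csin (w : C) (x : R) :
  is_Cderive (fun s => Csin (w * RtoC s)) x (w * Ccos (w * RtoC x))%C.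
Proof.
  eapply is_Cderive_eq; [eapply is_Cderive_ext; [|
    apply (is_Cderive_scal (/ (RtoC 2 * Ci))); apply is_Cderive_minus;
    [exact (is_Cderive_Cexp (Ci * w) x) | exact (is_Cderive_Cexp (- (Ci * w)) x)]]|].
  - intros s; simpl. unfold Csin, Cdiv.
    replace (- (Ci * (w * RtoC s)))%C with (- (Ci * w) * RtoC s)%C by ring.
    replace (Ci * (w * RtoC s))%C with (Ci * w * RtoC s)%C by ring. ring.
  - unfold Ccos, Cdiv.
    replace (Ci * (w * RtoC x))%C with (Ci * w * RtoC x)%C by ring.
    replace (- (Ci * w * RtoC x))%C with (- (Ci * w) * RtoC x)%C by ring.
    field; C_nonzero.
Qed.

Lemma Ccos_0 : Ccos (RtoC 0) = RtoC 1.
Proof.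
  unfold Ccos; replace (Ci * RtoC 0)%C with (RtoC 0) by ring.
  replace (- RtoC 0)%C with (RtoC 0) by ring.
  rewrite Cexp_0. field; C_nonzero.
Qed.

Lemma Csin_0 : Csin (RtoC 0) = RtoC 0.
Proof.
  unfold Csin; replace (Ci * RtoC 0)%C with (RtoC 0) by ring.
  replace (- RtoC 0)%C with (RtoC 0) by ring.
  rewrite Cexp_0. field; C_nonzero.
Qed.

Lemma Cexp_half (z : C) : Cmod (Cexp (Ci * z)) = exp (- Im z) /\ Cmod (Cexp (- (Ci * z))) = exp (Im z).
Proof.
  rewrite !Cmod_Cexp; destruct z as [a b]; split; f_equal; simpl; unfold Re, Im; simpl; ring.
Qed.

Lemma Cmod_Ccos_le (z : C) : Cmod (Ccos z) <= cosh (Im z).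
Proof.
  destruct (Cexp_half z) as [E1 E2].
  unfold Ccos. rewrite Cmod_div by exact RtoC2_neq_0.
  rewrite Cmod_R, Rabs_right by lra. unfold cosh.
  apply Rmult_le_compat_r; [lra|].
  eapply Rle_trans; [apply Cmod_triangle|]. rewrite E1, E2; lra.
Qed.

Lemma Cmod_Csin_le (z : C) : Cmod (Csin z) <= cosh (Im z).
Proof.
  destruct (Cexp_half z) as [E1 E2].
  unfold Csin. rewrite Cmod_div by (apply Cmult_neq_0; [exact RtoC2_neq_0 | exact Ci_neq_0]).
  rewrite Cmod_mult, Cmod_R, Cmod_Ci, Rabs_right by lra. unfold cosh.
  replace (2 * 1) with 2 by ring.
  apply Rmult_le_compat_r; [lra|].
  unfold Cminus. eapply Rle_trans; [apply Cmod_triangle|]. rewrite Cmod_opp, E1, E2; lra.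
Qed.

Lemma Ccos_minus (x y : C) :
  Ccos (x - y) = (Ccos x * Ccos y + Csin x * Csin y)%C.
Proof.
  unfold Ccos, Csin.
  replace (Ci * (x - y))%C with (Ci * x + - (Ci * y))%C by ring.
  replace (- (Ci * x + - (Ci * y)))%C with (- (Ci * x) + Ci * y)%C by ring.
  rewrite !Cexp_plus.
  assert (I : (Ci * Ci = - RtoC 1)%C) by (apply injective_projections; simpl; ring).
  set (a := Cexp (Ci * x)); set (a' := Cexp (- (Ci * x))).
  set (d := Cexp (Ci * y)); set (d' := Cexp (- (Ci * y))).
  replace ((a - a') / (RtoC 2 * Ci) * ((d - d') / (RtoC 2 * Ci)))%C
    with ((a - a') * (d - d') / (RtoC 2 * RtoC 2 * (Ci * Ci)))%C
    by (field; C_nonzero).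
  rewrite I. field; C_nonzero.
Qed.

Lemma Csin_minus (x y : C) :
  Csin (x - y) = (Csin x * Ccos y - Ccos x * Csin y)%C.
Proof.
  unfold Ccos, Csin.
  replace (Ci * (x - y))%C with (Ci * x + - (Ci * y))%C by ring.
  replace (- (Ci * x + - (Ci * y)))%C with (- (Ci * x) + Ci * y)%C by ring.
  rewrite !Cexp_plus.
  field; C_nonzero.
Qed.

Lemma is_derive_cosh (x : R) : is_derive cosh x (sinh x).
Proof. apply is_derive_Reals, derivable_pt_lim_cosh. Qed.
Lemma is_derive_sinh (x : R) : is_derive sinh x (cosh x).
Proof. apply is_derive_Reals, derivable_pt_lim_sinh. Qed.

Lemma cosh_pos (x : R) : 0 < cosh x.
Proof. unfold cosh; assert (A := exp_pos x); assert (B := exp_pos (- x)); lra. Qed.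

Lemma cosh_opp (x : R) : cosh (- x) = cosh x.
Proof. unfold cosh; rewrite Ropp_involutive; lra. Qed.

Lemma sinh_ge_0 (x : R) : 0 <= x -> 0 <= sinh x.
Proof.
  intros H; unfold sinh. assert (exp (- x) <= exp x); [|lra].
  destruct (Req_dec x 0) as [->|]; [rewrite Ropp_0; lra|].
  left; apply exp_increasing; lra.
Qed.

Lemma cosh_le (x y : R) : Rabs x <= y -> cosh x <= cosh y.
Proof.
  intros H.
  assert (E : cosh x = cosh (Rabs x)).
  { unfold Rabs; destruct Rcase_abs; [now rewrite cosh_opp | reflexivity]. }
  rewrite E. assert (P := Rabs_pos x). set (a := Rabs x) in *. clearbody a.
  destruct (MVT_gen cosh a y sinh) as [c [Hc K]].
  - intros; apply is_derive_cosh.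
  - intros. apply derivable_continuous_pt. eexists; apply derivable_pt_lim_cosh.
  - rewrite Rmin_left in Hc by lra.
    assert (0 <= sinh c) by (apply sinh_ge_0; lra). nra.
Qed.

Lemma cosh_Im_le (w : C) (c x : R) :
  Rabs (Im w) <= c -> cosh (Im (w * RtoC x)%C) <= cosh (c * x).
Proof.
  intros H.
  replace (Im (w * RtoC x)%C) with (Im w * x) by (simpl; unfold Re, Im; ring).
  destruct (Rle_or_lt 0 x).
  - apply cosh_le. rewrite Rabs_mult, (Rabs_right x) by lra. now apply Rmult_le_compat_r.
  - rewrite <- (cosh_opp (c * x)). apply cosh_le.
    rewrite Rabs_mult, (Rabs_left x) by lra. nra.
Qed.

Lemma is_derive_sinh_quot (c x : R) : is_derive (sinh_quot c) x (cosh (c * x)).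
Proof.
  unfold sinh_quot. destruct (Req_EM_T c 0) as [->|N].
  - rewrite Rmult_0_l, cosh_0. apply (is_derive_id (K := R_AbsRing)).
  - apply is_derive_eq with ((c * cosh (c * x)) * / c); [|now field].
    apply is_derive_ext with (fun t => / c * sinh (c * t)).
    { intros t; apply Rmult_comm. }
    rewrite Rmult_comm. apply is_derive_scal.
    apply (is_derive_comp sinh (fun t => c * t) x (cosh (c * x)) c).
    + apply is_derive_sinh.
    + auto_derive; [exact I|ring].
Qed.

Lemma sinh_quot_0 c : sinh_quot c 0 = 0.
Proof.
  unfold sinh_quot; destruct Req_EM_T; [reflexivity|].
  rewrite Rmult_0_r, sinh_0; unfold Rdiv; ring.
Qed.

Lemma sinh_quot_opp c x : sinh_quot c (- x) = - sinh_quot c x.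
Proof.
  unfold sinh_quot; destruct Req_EM_T; [reflexivity|].
  replace (c * - x) with (- (c * x)) by ring. unfold sinh; rewrite Ropp_involutive.
  field; assumption.
Qed.

Lemma R_increment_le (F dF G dG : R -> R) (a b : R) :
  a <= b ->
  (forall t, a <= t <= b -> is_derive F t (dF t)) ->
  (forall t, a <= t <= b -> is_derive G t (dG t)) ->
  (forall t, a <= t <= b -> dF t <= dG t) ->
  F b - F a <= G b - G a.
Proof.
  intros Hab HF HG Hle.
  destruct (MVT_gen (fun t => G t - F t) a b (fun t => dG t - dF t)) as [c [Hc K]].
  - rewrite Rmin_left, Rmax_right by lra. intros t Ht.
    apply (is_derive_minus (V := R_NormedModule)); [apply HG | apply HF]; lra.
  - rewrite Rmin_left, Rmax_right by lra. intros t Ht.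
    apply continuity_pt_filterlim.
    apply (ex_derive_continuous (V := R_NormedModule) (fun t => G t - F t) t).
    eexists; apply (is_derive_minus (V := R_NormedModule)); [apply HG | apply HF]; lra.
  - rewrite Rmin_left, Rmax_right in Hc by lra.
    assert (0 <= (dG c - dF c) * (b - a)) by (apply Rmult_le_pos; [specialize (Hle c Hc)|]; lra).
    lra.
Qed.

Lemma sinh_quot_mono c x y : x <= y -> sinh_quot c x <= sinh_quot c y.
Proof.
  intros H.
  assert (K := R_increment_le (fun _ => 0) (fun _ => 0) (sinh_quot c) (fun t => cosh (c * t)) x y H).
  assert (0 - 0 <= sinh_quot c y - sinh_quot c x); [apply K|lra].
  - intros; exact (is_derive_const (V := R_NormedModule) 0 t).
  - intros; apply is_derive_sinh_quot.
  - intros; left; apply cosh_pos.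
Qed.

Lemma sinh_quot_ge_0 c x : 0 <= x -> 0 <= sinh_quot c x.
Proof. intros H; rewrite <- (sinh_quot_0 c); now apply sinh_quot_mono. Qed.

Lemma sinh_quot_le_cosh c x : 0 <= c -> 0 <= x -> sinh_quot c x <= x * cosh (c * x).
Proof.
  intros Hc H.
  assert (K := R_increment_le (sinh_quot c) (fun t => cosh (c * t))
    (fun t => t * cosh (c * x)) (fun _ => cosh (c * x)) 0 x H).
  rewrite sinh_quot_0 in K.
  assert (sinh_quot c x - 0 <= x * cosh (c * x) - 0 * cosh (c * x)); [apply K|lra].
  - intros; apply is_derive_sinh_quot.
  - intros; auto_derive; [exact I|ring].
  - intros t Ht. apply cosh_le. rewrite Rabs_right; [nra|]. apply Rle_ge; nra.
Qed.

Lemma sinh_quot_plus c x y :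
  sinh_quot c (x + y) = sinh_quot c x * cosh (c * y) + cosh (c * x) * sinh_quot c y.
Proof.
  unfold sinh_quot; destruct Req_EM_T as [->|N].
  - rewrite !Rmult_0_l, cosh_0; ring.
  - replace (c * (x + y)) with (c * x + c * y) by ring.
    unfold sinh, cosh. rewrite Ropp_plus_distr, !exp_plus. field; exact N.
Qed.

(** The multiplicative estimate behind the Gronwall argument: since
    [sinh_quot c x] is at most [x * cosh (c * x)], the addition formula absorbs one
    factor at the cost of [x]. *)
Lemma sinh_quot_mult_le c x y : 0 <= c -> 0 <= x -> 0 <= y ->
  sinh_quot c x * sinh_quot c y <= x * sinh_quot c (x + y).
Proof.
  intros Hc Hx Hy.
  rewrite sinh_quot_plus.
  assert (A := sinh_quot_le_cosh c x Hc Hx).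
  assert (B := sinh_quot_ge_0 c x Hx). assert (D := sinh_quot_ge_0 c y Hy).
  assert (P := cosh_pos (c * y)).
  assert (sinh_quot c x * sinh_quot c y <= x * cosh (c * x) * sinh_quot c y)
    by (apply Rmult_le_compat_r; assumption).
  assert (0 <= x * (sinh_quot c x * cosh (c * y)))
    by (apply Rmult_le_pos; [lra | apply Rmult_le_pos; lra]).
  lra.
Qed.

(** The bound is uniform in the real part of the frequency because it is obtained
    by integrating the bound for the cosine, and the integral of the cosine is
    exactly the quotient. *)
Lemma Cmod_Csin_quot_le (w : C) (c x : R) :
  w <> RtoC 0 -> Rabs (Im w) <= c -> 0 <= x ->
  Cmod (Csin (w * RtoC x) / w)%C <= sinh_quot c x.
Proof.
  intros Hw Hc Hx.
  assert (K := Cmod_increment_le (fun t => Csin (w * RtoC t) / w)%C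
    (fun t => Ccos (w * RtoC t)) (sinh_quot c) (fun t => cosh (c * t)) 0 x Hx).
  rewrite sinh_quot_0, Rminus_0_r in K.
  replace (Csin (w * RtoC x) / w)%C with
    (Csin (w * RtoC x) / w - Csin (w * RtoC 0) / w)%C.
  - apply K.
    + intros t Ht. eapply is_Cderive_eq.
      * eapply is_Cderive_ext; [|apply (is_Cderive_scal (/ w)); apply (is_Cderive_Csin w t)].
        intros s; simpl; unfold Cdiv; ring.
      * field; exact Hw.
    + intros; apply is_derive_sinh_quot.
    + intros t Ht. eapply Rle_trans; [apply Cmod_Ccos_le | now apply cosh_Im_le].
  - replace (w * RtoC 0)%C with (RtoC 0) by ring. rewrite Csin_0. unfold Cdiv; ring.
Qed.

(** * The Volterra estimate for the error system *)

(** The first-order system of the approximation error [E], in a parameter [t]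
    with phase [l] and [l' = sigma]. Eliminating [Th] gives
    [E'' + om^2 E = K E + 4 w' tau], primes being derivatives in [l]. Only a bound
    on [w] is at hand, so the derivative of [w] is hidden in
    [Th = E' - 4 tau w]. *)
Record error_system (t0 T : R) (l sigma : R -> R) (tau tau' w K E Th : R -> C) (om : C) : Prop := {
  es_l : forall t, t0 <= t <= T -> is_derive l t (sigma t);
  es_E : forall t, t0 <= t <= T ->
    is_Cderive E t (RtoC (sigma t) * (Th t + RtoC 4 * tau t * w t))%C;
  es_Th : forall t, t0 <= t <= T ->
    is_Cderive Th t (RtoC (sigma t) * ((K t - om ^ 2) * E t - RtoC 4 * tau' t * w t))%C
}.

Arguments es_l {t0 T l sigma tau tau' w K E Th om}.
Arguments es_E {t0 T l sigma tau tau' w K E Th om}.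
Arguments es_Th {t0 T l sigma tau tau' w K E Th om}.

(** The combination by which [w] enters the variation of constants formula. For
    [tau = cos (om l)], [tau' = - om sin (om l)] it is
    [cos (om (l t - 2 l s))]. *)
Definition kernel_bound (D : R -> Prop) (l : R -> R) (tau tau' : R -> C) (om : C) (c : R) : Prop :=
  forall t s, D t -> D s ->
    Cmod (tau s * Ccos (om * RtoC (l t - l s)) - tau' s * (Csin (om * RtoC (l t - l s)) / om))%C
    <= cosh (c * (l t - 2 * l s)).

Lemma le_of_halving (x y z : R) : 0 <= z -> (forall n, x <= y + z / 2 ^ n) -> x <= y.
Proof.
  intros Hz H; apply le_epsilon; intros e He.
  destruct (pow_lt_1_zero (/ 2) ltac:(rewrite Rabs_right; lra) (e / (z + 1))
    ltac:(apply Rdiv_lt_0_compat; lra)) as [n Hn].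
  specialize (Hn n (le_n _)). rewrite pow_inv, Rabs_right in Hn
    by (apply Rle_ge; left; apply Rinv_0_lt_compat, pow_lt; lra).
  specialize (H n). unfold Rdiv at 1 in H.
  assert (z * / 2 ^ n <= e); [|lra].
  assert (0 < / 2 ^ n) by (apply Rinv_0_lt_compat, pow_lt; lra).
  apply Rle_trans with ((z + 1) * (e / (z + 1))); [nra|].
  right; field; lra.
Qed.

Lemma increasing_of_derive (l sigma : R -> R) (t0 T : R) :
  (forall t, t0 <= t <= T -> is_derive l t (sigma t)) ->
  (forall t, t0 <= t <= T -> 0 <= sigma t) ->
  forall s t, t0 <= s -> s <= t -> t <= T -> l s <= l t.
Proof.
  intros Hl Hs s t H1 H2 H3.
  assert (0 - 0 <= l t - l s); [|lra].
  apply (R_increment_le (fun _ => 0) (fun _ => 0) l sigma s t H2).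
  - intros; exact (is_derive_const (V := R_NormedModule) 0 _).
  - intros; apply Hl; lra.
  - intros; apply Hs; lra.
Qed.

Section HalfLine.
Variables (t0 T : R) (l sigma : R -> R) (tau tau' w K E Th : R -> C) (om : C) (c M eps b : R).
Hypotheses (HT : t0 <= T) (Hom : om <> RtoC 0) (Hc0 : 0 <= c) (Hc : Rabs (Im om) <= c)
  (HM : 0 <= M) (Heps : 0 <= eps) (Hb : 0 < b)
  (HS : error_system t0 T l sigma tau tau' w K E Th om)
  (Hker : kernel_bound (fun t => t0 <= t <= T) l tau tau' om c)
  (Hsg : forall t, t0 <= t <= T -> 0 <= sigma t)
  (Hl0 : l t0 = 0) (HlT : l T <= b)
  (Hw : forall t, t0 <= t <= T -> Cmod (w t) <= eps)
  (HK : forall t, t0 <= t <= T -> Cmod (K t) <= M)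
  (HE0 : E t0 = RtoC 0) (HTh0 : Cmod (Th t0) <= 2 * eps).

Let l_mono : forall s t, t0 <= s -> s <= t -> t <= T -> l s <= l t.
Proof. apply increasing_of_derive with sigma; [exact (es_l HS) | exact Hsg]. Qed.

(** One pass through the Volterra equation. The function [F] below is the
    variation of constants formula with its end point frozen at [t]: it equals
    [E t] at [s = t], and the increment of [F] is the integral of the kernel. The
    term with [w] contributes [4 eps] times the integral of
    [cosh (c (x - 2 l))] over [0 <= l <= x], that is [4 eps sinh_quot c x]; the
    initial value of [Th] gives the remaining [2 eps sinh_quot c x]. *)
Lemma volterra_step (H eta : R -> R) (t : R) :
  t0 <= t <= T ->
  (forall z, is_derive H z (eta z)) ->
  (forall s, t0 <= s <= t ->
     M * Cmod (E s) * sinh_quot c (l t - l s) <= sinh_quot c (l t) * eta (l s)) ->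
  Cmod (E t) <= sinh_quot c (l t) * (6 * eps + (H (l t) - H 0)).
Proof.
  intros Ht HH Hle.
  set (x := l t).
  assert (Hx : 0 <= x) by (rewrite <- Hl0; apply l_mono; lra).
  set (F := fun s => (E s * Ccos (om * RtoC (x - l s)) +
                      Th s * (/ om * Csin (om * RtoC (x - l s))))%C).
  set (dF := fun s => (RtoC (sigma s) * (RtoC 4 * w s *
     (tau s * Ccos (om * RtoC (x - l s)) - tau' s * (Csin (om * RtoC (x - l s)) / om)) +
      K s * E s * (Csin (om * RtoC (x - l s)) / om)))%C).
  assert (DF : forall s, t0 <= s <= t -> is_Cderive F s (dF s)).
  { intros s Hs.
    assert (Dl : is_derive (fun s => x - l s) s (- sigma s)).
    { eapply is_derive_eq.
      - apply (is_derive_minus (V := R_NormedModule)).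
        + exact (is_derive_const (V := R_NormedModule) x s).
        + apply (es_l HS); lra.
      - unfold minus, plus, opp, zero; simpl; ring. }
    assert (Dc := is_Cderive_comp (fun z => Ccos (om * RtoC z))%C (fun s => x - l s) s _ _
                    (is_Cderive_Ccos om (x - l s)) Dl).
    assert (Ds := is_Cderive_comp (fun z => Csin (om * RtoC z))%C (fun s => x - l s) s _ _
                    (is_Cderive_Csin om (x - l s)) Dl).
    assert (DE := es_E HS s ltac:(lra)).
    assert (DT := es_Th HS s ltac:(lra)).
    eapply is_Cderive_eq.
    - apply is_Cderive_plus.
      + exact (is_Cderive_mult _ _ _ _ _ DE Dc).
      + exact (is_Cderive_mult _ _ _ _ _ DT (is_Cderive_scal (/ om) _ _ _ Ds)).
    - unfold dF. simpl. rewrite RtoC_opp. field. exact Hom. }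
  assert (Inc := Cmod_increment_le F dF
    (fun s => -2 * eps * sinh_quot c (x - 2 * l s) + sinh_quot c x * H (l s))
    (fun s => sigma s * (4 * eps * cosh (c * (x - 2 * l s)) + sinh_quot c x * eta (l s)))
    t0 t (proj1 Ht) DF).
  assert (HF : F t = E t).
  { unfold F, x. rewrite Rminus_diag. replace (om * RtoC 0)%C with (RtoC 0) by ring.
    rewrite Ccos_0, Csin_0; ring. }
  assert (HF0 : F t0 = (Th t0 * (Csin (om * RtoC x) / om))%C).
  { unfold F. rewrite HE0, Hl0, Rminus_0_r. unfold Cdiv; ring. }
  replace (E t) with ((F t - F t0) + F t0)%C by (rewrite HF; ring).
  eapply Rle_trans; [apply Cmod_triangle|].
  assert (B0 : Cmod (F t0) <= 2 * eps * sinh_quot c x).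
  { rewrite HF0, Cmod_mult. apply Rmult_le_compat; try apply Cmod_ge_0; [exact HTh0|].
    now apply Cmod_Csin_quot_le. }
  apply Rle_trans with ((4 * eps * sinh_quot c x + sinh_quot c x * (H x - H 0)) +
    2 * eps * sinh_quot c x); [|right; ring].
  apply Rplus_le_compat; [|exact B0].
  eapply Rle_trans; [apply Inc|].
  - intros s Hs. eapply is_derive_eq.
    + apply (is_derive_plus (V := R_NormedModule)).
      * apply is_derive_scal.
        apply (is_derive_comp (sinh_quot c) (fun s => x - 2 * l s) s
          (cosh (c * (x - 2 * l s))) (- (2 * sigma s))).
        -- apply is_derive_sinh_quot.
        -- eapply is_derive_eq.
           ++ apply (is_derive_minus (V := R_NormedModule)).
              ** exact (is_derive_const (V := R_NormedModule) x s).
              ** apply is_derive_scal. apply (es_l HS); lra.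
           ++ unfold minus, plus, opp, zero; simpl; ring.
      * apply is_derive_scal. apply (is_derive_comp H l s (eta (l s)) (sigma s)).
        -- apply HH.
        -- apply (es_l HS); lra.
    + unfold plus, scal; simpl; unfold mult; simpl; ring.
  - intros s Hs. unfold dF. rewrite Cmod_mult, Cmod_R.
    rewrite Rabs_right by (apply Rle_ge, Hsg; lra).
    apply Rmult_le_compat_l; [apply Hsg; lra|].
    eapply Rle_trans; [apply Cmod_triangle|].
    apply Rplus_le_compat.
    + rewrite !Cmod_mult, Cmod_R, Rabs_right by lra.
      apply Rmult_le_compat; [| apply Cmod_ge_0 | | apply Hker; lra].
      * apply Rmult_le_pos; [lra | apply Cmod_ge_0].
      * apply Rmult_le_compat_l; [lra | apply Hw; lra].
    + eapply Rle_trans; [|apply Hle; lra].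
      rewrite !Cmod_mult. apply Rmult_le_compat; try apply Cmod_ge_0.
      * apply Rmult_le_pos; apply Cmod_ge_0.
      * apply Rmult_le_compat_r; [apply Cmod_ge_0 | apply HK; lra].
      * apply Cmod_Csin_quot_le; auto.
        assert (l s <= l t) by (apply l_mono; lra). unfold x; lra.
  - change (l t) with x. rewrite Hl0.
    replace (x - 2 * x) with (- x) by ring.
    rewrite sinh_quot_opp, Rmult_0_r, Rminus_0_r. right; ring.
Qed.

(** A bound [|E| <= k S(l) exp (2 M b l)] with [S = sinh_quot c] reproduces itself
    with [6 eps + k / 2] in place of [k]: the integral of [M b k exp (2 M b l)] is
    at most [k / 2 exp (2 M b l)]. The iterates converge to [12 eps]. To start, [E]
    is bounded on the compact interval, which yields some constant [k0]. *)
Lemma volterra_bound :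
  Cmod (E T) <= 12 * eps * exp (2 * (M * b) * b) * sinh_quot c b.
Proof.
  assert (Lb : forall t, t0 <= t <= T -> 0 <= l t <= b).
  { intros t Ht; split.
    - rewrite <- Hl0; apply l_mono; lra.
    - eapply Rle_trans; [apply l_mono; [| |apply Rle_refl]|]; lra. }
  assert (HMb : 0 <= M * b) by (apply Rmult_le_pos; lra).
  set (lam := 2 * (M * b)).
  destruct (continuous_on_bounded E t0 T HT) as [B HB].
  { apply continuous_on_forall; intros t Ht.
    eapply is_Cderive_continuous, (es_E HS t Ht). }
  assert (B0 : 0 <= B) by (eapply Rle_trans; [apply (Cmod_ge_0 (E T)) | apply HB; lra]).
  set (k0 := 6 * eps + M * B * b).
  assert (Hk0 : 0 <= k0).
  { unfold k0. assert (0 <= M * B * b); [|lra]. repeat apply Rmult_le_pos; lra. }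
  assert (Epos : forall t, t0 <= t <= T -> 1 <= exp (lam * l t)).
  { intros t Ht. rewrite <- exp_0.
    destruct (Lb t Ht) as [L _].
    assert (0 <= lam * l t) by (apply Rmult_le_pos; unfold lam; lra).
    destruct (Req_dec (lam * l t) 0) as [->|]; [lra|].
    left; apply exp_increasing; lra. }
  assert (Spos : forall t, t0 <= t <= T -> 0 <= sinh_quot c (l t)).
  { intros t Ht; apply sinh_quot_ge_0; apply (Lb t Ht). }
  assert (Iter : forall n t, t0 <= t <= T ->
    Cmod (E t) <= (12 * eps + k0 / 2 ^ n) * (sinh_quot c (l t) * exp (lam * l t))).
  { induction n as [|n IH]; intros t Ht.
    - assert (Cmod (E t) <= sinh_quot c (l t) * (6 * eps + (M * B * l t - M * B * 0))).
      { apply (volterra_step (fun z => M * B * z) (fun _ => M * B)); [exact Ht| |].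
        - intros z; auto_derive; [exact I|ring].
        - intros s Hs. rewrite (Rmult_comm (sinh_quot c (l t))).
          assert (Ls := Lb s ltac:(lra)). assert (l s <= l t) by (apply l_mono; lra).
          apply Rmult_le_compat.
          + apply Rmult_le_pos; [lra | apply Cmod_ge_0].
          + apply sinh_quot_ge_0; lra.
          + apply Rmult_le_compat_l; [lra | apply HB; lra].
          + apply sinh_quot_mono; lra. }
      eapply Rle_trans; [exact H|].
      assert (St := Spos t Ht). assert (P := Epos t Ht). destruct (Lb t Ht) as [L1 L2].
      assert (M * B * l t <= M * B * b) by (apply Rmult_le_compat_l; [apply Rmult_le_pos|]; lra).
      apply Rle_trans with (sinh_quot c (l t) * k0).
      + apply Rmult_le_compat_l; [exact St|]. unfold k0; lra.
      + simpl. replace (k0 / 1) with k0 by field.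
        apply Rle_trans with (k0 * (sinh_quot c (l t) * exp (lam * l t))).
        * assert (sinh_quot c (l t) * 1 <= sinh_quot c (l t) * exp (lam * l t))
            by (apply Rmult_le_compat_l; lra).
          nra.
        * apply Rmult_le_compat_r; [apply Rmult_le_pos; lra|lra].
    - set (k := 12 * eps + k0 / 2 ^ n) in *.
      assert (Hk : 0 <= k).
      { assert (0 <= k0 / 2 ^ n); [|unfold k; lra].
        apply Rmult_le_pos; [lra|]. left; apply Rinv_0_lt_compat, pow_lt; lra. }
      assert (Cmod (E t) <= sinh_quot c (l t) *
        (6 * eps + (k / 2 * exp (lam * l t) - k / 2 * exp (lam * 0)))).
      { apply (volterra_step (fun z => k / 2 * exp (lam * z))
                             (fun z => M * b * k * exp (lam * z))); [exact Ht| |].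
        - intros z; auto_derive; [exact I|]. unfold lam; field.
        - intros s Hs.
          assert (Ls := Lb s ltac:(lra)). assert (Lst : l s <= l t) by (apply l_mono; lra).
          assert (St := Spos t Ht).
          assert (X := sinh_quot_mult_le c (l s) (l t - l s) Hc0 (proj1 Ls) ltac:(lra)).
          replace (l s + (l t - l s)) with (l t) in X by ring.
          assert (Y := IH s ltac:(lra)).
          assert (P := Epos s ltac:(lra)).
          assert (S' : 0 <= sinh_quot c (l t - l s)) by (apply sinh_quot_ge_0; lra).
          apply Rle_trans with (M * k * exp (lam * l s) *
            (sinh_quot c (l s) * sinh_quot c (l t - l s))).
          + replace (M * k * exp (lam * l s) * (sinh_quot c (l s) * sinh_quot c (l t - l s)))
              with (M * (k * (sinh_quot c (l s) * exp (lam * l s))) * sinh_quot c (l t - l s))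
              by ring.
            apply Rmult_le_compat_r; [exact S'|]. apply Rmult_le_compat_l; [lra|exact Y].
          + replace (sinh_quot c (l t) * (M * b * k * exp (lam * l s)))
              with (M * k * exp (lam * l s) * (b * sinh_quot c (l t))) by ring.
            apply Rmult_le_compat_l; [repeat apply Rmult_le_pos; lra|].
            eapply Rle_trans; [exact X|]. apply Rmult_le_compat_r; lra. }
      eapply Rle_trans; [exact H|].
      assert (St := Spos t Ht). assert (P := Epos t Ht).
      rewrite Rmult_0_r, exp_0.
      replace (12 * eps + k0 / 2 ^ S n) with (6 * eps + k / 2)
        by (unfold k; simpl; field; apply pow_nonzero; lra).
      rewrite (Rmult_comm (6 * eps + k / 2)), Rmult_assoc.
      apply Rmult_le_compat_l; [exact St|].
      assert (6 * eps * 1 <= 6 * eps * exp (lam * l t)) by (apply Rmult_le_compat_l; lra).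
      lra. }
  assert (HTT : t0 <= T <= T) by lra.
  assert (Fin : Cmod (E T) <= 12 * eps * (sinh_quot c (l T) * exp (lam * l T))).
  { assert (P : 0 <= sinh_quot c (l T) * exp (lam * l T)).
    { apply Rmult_le_pos; [now apply Spos|]. specialize (Epos T HTT); lra. }
    apply le_of_halving with (k0 * (sinh_quot c (l T) * exp (lam * l T))).
    - now apply Rmult_le_pos.
    - intros n. eapply Rle_trans; [exact (Iter n T HTT)|]. right; unfold Rdiv; ring. }
  eapply Rle_trans; [exact Fin|].
  replace (12 * eps * exp (lam * b) * sinh_quot c b)
    with (12 * eps * (sinh_quot c b * exp (lam * b))) by ring.
  apply Rmult_le_compat_l; [lra|].
  apply Rmult_le_compat; [now apply Spos | specialize (Epos T HTT); lra | now apply sinh_quot_mono |].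
  destruct (Lb T HTT) as [L1 L2].
  assert (lam * l T <= lam * b) by (apply Rmult_le_compat_l; unfold lam; lra).
  destruct (Req_dec (lam * l T) (lam * b)) as [->|]; [lra|].
  left; apply exp_increasing; lra.
Qed.

End HalfLine.

Lemma is_Cderive_reflect (f : R -> C) t l :
  is_Cderive f (- t) l -> is_Cderive (fun s => f (- s)) t (- l)%C.
Proof.
  intros H. eapply is_Cderive_eq.
  - apply (is_Cderive_comp f Ropp t l (-1)).
    + exact H.
    + auto_derive; [exact I|ring].
  - apply injective_projections; simpl; ring.
Qed.

(** To the left of [y0] the substitution [t -> - t] preserves the form of the
    system once the signs of [l], [tau'], [w] and [Th] are changed. *)
Lemma volterra_bound_two_sided (A B y0 : R) (l sigma : R -> R) (tau tau' w K E Th : R -> C) (om : C) (c M eps b : R) :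
  A < y0 < B -> om <> RtoC 0 -> 0 <= c -> Rabs (Im om) <= c -> 0 <= M -> 0 <= eps -> 0 < b ->
  (forall s t, A < s -> s <= t -> t < B -> error_system s t l sigma tau tau' w K E Th om) ->
  kernel_bound (fun t => A < t < B) l tau tau' om c ->
  (forall t, A < t < B -> 0 <= sigma t) ->
  l y0 = 0 -> (forall t, A < t < B -> - b <= l t <= b) ->
  (forall t, A < t < B -> Cmod (w t) <= eps) ->
  (forall t, A < t < B -> Cmod (K t) <= M) ->
  E y0 = RtoC 0 -> Cmod (Th y0) <= 2 * eps ->
  forall y, A < y < B -> Cmod (E y) <= 12 * eps * exp (2 * (M * b) * b) * sinh_quot c b.
Proof.
  intros Hy0 Hom Hc0 Hc HM Heps Hb HS Hker Hsg Hl0 Hlb Hw HK HE0 HTh0 y Hy.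
  destruct (Rle_or_lt y0 y) as [L|L].
  - apply (volterra_bound y0 y l sigma tau tau' w K E Th om c M eps b); auto.
    + apply HS; lra.
    + intros t s Ht Hs; apply Hker; lra.
    + intros; apply Hsg; lra.
    + apply Hlb; lra.
    + intros; apply Hw; lra.
    + intros; apply HK; lra.
  - replace (E y) with (E (- - y)) by (now rewrite Ropp_involutive).
    apply (volterra_bound (- y0) (- y) (fun t => - l (- t)) (fun t => sigma (- t))
      (fun t => tau (- t)) (fun t => - tau' (- t)%R)%C (fun t => - w (- t)%R)%C
      (fun t => K (- t)) (fun t => E (- t)) (fun t => - Th (- t)%R)%C om c M eps b); auto.
    + lra.
    + destruct (HS y y0 ltac:(lra) ltac:(lra) ltac:(lra)) as [S1 S2 S3]. constructor; intros t Ht.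
      * eapply is_derive_eq.
        -- apply (is_derive_opp (V := R_NormedModule)).
           apply (is_derive_comp l Ropp t (sigma (- t)) (-1)).
           ++ apply S1; lra.
           ++ auto_derive; [exact I|ring].
        -- unfold opp, scal; simpl; unfold mult; simpl; ring.
      * eapply is_Cderive_eq; [apply is_Cderive_reflect, S2; lra|]. ring.
      * eapply is_Cderive_eq.
        -- eapply is_Cderive_ext; [|apply (is_Cderive_scal (- RtoC 1)), is_Cderive_reflect, S3; lra].
           intros s; simpl; ring.
        -- ring.
    + intros t s Ht Hs. simpl.
      assert (X := Hker (- t) (- s) ltac:(lra) ltac:(lra)).
      replace (- l (- t) - - l (- s)) with (- (l (- t) - l (- s))) by ring.
      replace (c * (- l (- t) - 2 * - l (- s))) with (- (c * (l (- t) - 2 * l (- s)))) by ring.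
      rewrite cosh_opp. eapply Rle_trans; [right|exact X]. f_equal.
      replace (om * RtoC (- (l (- t) - l (- s)))%R)%C
        with (RtoC 0 - om * RtoC (l (- t) - l (- s))%R)%C by (rewrite RtoC_opp; ring).
      rewrite Ccos_minus, Csin_minus, Ccos_0, Csin_0. unfold Cdiv; ring.
    + intros; apply Hsg; lra.
    + rewrite Ropp_involutive, Hl0; ring.
    + rewrite Ropp_involutive. specialize (Hlb y Hy); lra.
    + intros; rewrite Cmod_opp; apply Hw; lra.
    + intros; apply HK; lra.
    + now rewrite Ropp_involutive.
    + now rewrite Ropp_involutive, Cmod_opp.
Qed.

(** * Generalized wave polynomials and their moments *)

(** Finite sums live in an abelian monoid whose carrier is only convertible to C,
    and [ring] looks for the syntactic type. *)
Ltac C_ring :=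
  change (@plus C_AbelianMonoid) with Cplus;
  match goal with |- @eq _ ?x ?y => change (@eq C x y) end; ring.

Lemma sum_n_C_plus (u v : nat -> C) n :
  sum_n (fun k => u k + v k)%C n = (sum_n u n + sum_n v n)%C.
Proof. exact (sum_n_plus u v n). Qed.

Lemma sum_n_C_scal (x : C) (u : nat -> C) n :
  sum_n (fun k => x * u k)%C n = (x * sum_n u n)%C.
Proof. exact (sum_n_mult_l (K := C_Ring) x u n). Qed.

Lemma sum_n_shift2 (u : nat -> C) n :
  sum_n u (S (S n)) = (u 0%nat + u 1%nat + sum_n (fun k => u (S (S k))) n)%C.
Proof.
  induction n as [|n IH].
  - rewrite !sum_Sn, !sum_O; reflexivity.
  - rewrite sum_Sn, IH, (sum_Sn (fun k => u (S (S k)))).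
    C_ring.
Qed.

Lemma binomial_two_step n k : (S (S k) <= n)%nat ->
  Binomial.C n (S (S k)) * (INR (S (S k)) * INR (S k)) =
  Binomial.C n k * (INR (n - k) * INR (n - k - 1)).
Proof.
  intros H. unfold Binomial.C.
  destruct (Nat.le_exists_sub (S (S k)) n H) as [j [-> _]].
  replace (j + S (S k) - k)%nat with (S (S j)) by lia.
  replace (j + S (S k) - S (S k))%nat with j by lia.
  replace (S (S j) - 1)%nat with (S j) by lia.
  rewrite (fact_simpl (S k)), (fact_simpl k), (fact_simpl (S j)), (fact_simpl j).
  rewrite !mult_INR.
  field. repeat split; try apply INR_fact_neq_0; apply not_0_INR; lia.
Qed.

Section DoubleSum.
Variables (par : nat -> bool) (a : nat -> C) (N : nat).

Definition binomial_sum (n : nat) (X : nat -> C) : C :=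
  sum_n (fun k => if par k then (RtoC (Binomial.C n k) * X k)%C else RtoC 0) n.

Definition dsum (X : nat -> nat -> C) : C :=
  sum_n (fun n => a n * binomial_sum n (X n))%C N.

Lemma binomial_sum_ext n (X X' : nat -> C) :
  (forall k, (k <= n)%nat -> par k = true -> X k = X' k) ->
  binomial_sum n X = binomial_sum n X'.
Proof.
  intros H; apply sum_n_ext_loc; intros k Hk.
  destruct (par k) eqn:P; [rewrite H; auto | reflexivity].
Qed.

Lemma dsum_ext (X X' : nat -> nat -> C) :
  (forall n k, (k <= n)%nat -> par k = true -> X n k = X' n k) -> dsum X = dsum X'.
Proof.
  intros H; apply sum_n_ext_loc; intros n Hn.
  f_equal; apply binomial_sum_ext; intros; now apply H.
Qed.

Lemma dsum_plus (X X' : nat -> nat -> C) :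
  dsum (fun n k => X n k + X' n k)%C = (dsum X + dsum X')%C.
Proof.
  unfold dsum. rewrite <- sum_n_C_plus. apply sum_n_ext; intros n.
  unfold binomial_sum. rewrite <- Cmult_plus_distr_l, <- sum_n_C_plus.
  f_equal; apply sum_n_ext; intros k. destruct (par k); C_ring.
Qed.

Lemma dsum_scal (x : C) (X : nat -> nat -> C) :
  dsum (fun n k => x * X n k)%C = (x * dsum X)%C.
Proof.
  unfold dsum. rewrite <- sum_n_C_scal. apply sum_n_ext; intros n.
  unfold binomial_sum. rewrite Cmult_assoc, (Cmult_comm x), <- Cmult_assoc.
  f_equal; rewrite <- sum_n_C_scal; apply sum_n_ext; intros k. destruct (par k); C_ring.
Qed.

Lemma is_Cderive_dsum (X : nat -> nat -> R -> C) (X' : nat -> nat -> C) y :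
  (forall n k, (k <= n)%nat -> is_Cderive (X n k) y (X' n k)) ->
  is_Cderive (fun s => dsum (fun n k => X n k s)) y (dsum X').
Proof.
  intros H. unfold dsum.
  apply (is_Cderive_sum_n (fun n s => a n * binomial_sum n (fun k => X n k s))%C).
  intros n _. apply is_Cderive_scal. unfold binomial_sum.
  apply (is_Cderive_sum_n (fun k s => if par k then (RtoC (Binomial.C n k) * X n k s)%C else RtoC 0)).
  intros k Hk. destruct (par k).
  - apply is_Cderive_scal; auto.
  - apply is_Cderive_const.
Qed.

Hypothesis par2 : forall k, par (S (S k)) = par k.

(** The polynomial [sum_k C(n,k) f(n-k) t^k] satisfies a wave equation when
    [f(m)'' = m (m-1) f(m-2)]: differentiating twice in [t] shifts [k] by two and
    produces the same coefficients as differentiating twice in the other variable.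
    Both factors vanish at the ends of the range, so truncated subtraction does no
    harm. *)
Lemma binomial_sum_two_step n (f J : nat -> C) :
  binomial_sum n (fun k => RtoC (INR k * INR (k - 1)) * f (n - k)%nat * J (k - 2)%nat)%C =
  binomial_sum n (fun k => RtoC (INR (n - k) * INR (n - k - 1)) * f (n - k - 2)%nat * J k)%C.
Proof.
  unfold binomial_sum. destruct n as [|[|m]].
  - rewrite !sum_O. destruct (par 0); [|reflexivity]. simpl. rewrite Rmult_0_l. ring.
  - rewrite !sum_Sn, !sum_O. simpl. rewrite !Rmult_0_l, !Rmult_0_r.
    destruct (par 0), (par 1); C_ring.
  - rewrite sum_n_shift2, !sum_Sn.
    replace (S (S m) - S (S m) - 1)%nat with 0%nat by lia.
    replace (S (S m) - S m - 1)%nat with 0%nat by lia.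
    replace (INR 1 * INR (1 - 1)) with 0 by (simpl; ring).
    replace (INR 0) with 0 by reflexivity. rewrite ?Rmult_0_r, ?Rmult_0_l.
    rewrite (sum_n_ext_loc
      (fun k => if par (S (S k)) then
         (RtoC (Binomial.C (S (S m)) (S (S k))) *
          (RtoC (INR (S (S k)) * INR (S (S k) - 1)) * f (S (S m) - S (S k))%nat * J (S (S k) - 2)%nat))%C
       else RtoC 0)
      (fun k => if par k then
         (RtoC (Binomial.C (S (S m)) k) *
          (RtoC (INR (S (S m) - k) * INR (S (S m) - k - 1)) * f (S (S m) - k - 2)%nat * J k))%C
       else RtoC 0)).
    + destruct (par 0), (par 1), (par (S m)), (par (S (S m))); C_ring.
    + intros k Hk. rewrite par2. destruct (par k); [|reflexivity].
      replace (S (S k) - 1)%nat with (S k) by lia.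
      replace (S (S k) - 2)%nat with k by lia.
      replace (S (S m) - S (S k))%nat with (S (S m) - k - 2)%nat by lia.
      rewrite !Cmult_assoc, <- !RtoC_mult, binomial_two_step by lia. reflexivity.
Qed.

Lemma dsum_two_step (f J : nat -> C) :
  dsum (fun n k => RtoC (INR k * INR (k - 1)) * f (n - k)%nat * J (k - 2)%nat)%C =
  dsum (fun n k => RtoC (INR (n - k) * INR (n - k - 1)) * f (n - k - 2)%nat * J k)%C.
Proof.
  unfold dsum; apply sum_n_ext; intros n. f_equal. apply binomial_sum_two_step.
Qed.

End DoubleSum.

(** Twofold integration by parts of the moments [J k x], the integrals of
    [t^k T(t)] over [[0,x]]. The parity condition says that the boundary terms at
    zero vanish: even powers go with the cosine and odd powers with the sine. *)
Lemma moment_by_parts (om : C) (T T' : R -> C) (J : nat -> R -> C) (par : nat -> bool)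
  (HT : forall x, is_Cderive T x (T' x)) (HT' : forall x, is_Cderive T' x (- (om ^ 2 * T x))%C)
  (HJ : forall k x, is_Cderive (J k) x (RtoC (x ^ k) * T x)%C)
  (HJ0 : forall k, J k 0 = RtoC 0)
  (H0 : par 0%nat = true -> T' 0 = RtoC 0) (H1 : par 1%nat = true -> T 0 = RtoC 0) k x :
  par k = true ->
  (RtoC (INR k * INR (k - 1)) * J (k - 2)%nat x =
   RtoC (INR k * x ^ (k - 1)) * T x - RtoC (x ^ k) * T' x - om ^ 2 * J k x)%C.
Proof.
  intros Hk.
  set (F := fun x => (RtoC (INR k * INR (k - 1)) * J (k - 2)%nat x -
   (RtoC (INR k * x ^ (k - 1)) * T x - RtoC (x ^ k) * T' x - om ^ 2 * J k x))%C).
  assert (DF : forall x, is_Cderive F x (RtoC 0)).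
  { intros z. eapply is_Cderive_eq.
    - apply is_Cderive_minus; [apply is_Cderive_scal, HJ|].
      apply is_Cderive_minus; [|apply is_Cderive_scal, HJ].
      apply is_Cderive_minus.
      + apply is_Cderive_mult; [|apply HT]. apply is_Cderive_RtoC.
        auto_derive; [exact I|reflexivity].
      + apply is_Cderive_mult; [|apply HT']. apply is_Cderive_RtoC.
        auto_derive; [exact I|reflexivity].
    - replace (pred (k - 1)) with (k - 2)%nat by lia.
      replace (pred k) with (k - 1)%nat by lia.
      rewrite !RtoC_mult. ring. }
  assert (F0 : F 0 = RtoC 0).
  { unfold F. rewrite !HJ0. destruct k as [|[|k]].
    - rewrite H0 by exact Hk. simpl. rewrite !Rmult_0_l. ring.
    - rewrite H1 by exact Hk. simpl. rewrite !Rmult_0_l. ring.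
    - replace (S (S k) - 1)%nat with (S k) by lia.
      rewrite !pow_i, Rmult_0_r by lia. ring. }
  assert (Fx : F x = RtoC 0).
  { assert (Cst : forall s t, s <= t -> F t = F s).
    { intros s t Hst.
      assert (Z : Cmod (F t - F s)%C <= 0 - 0).
      { apply (Cmod_increment_le F (fun _ => RtoC 0) (fun _ => 0) (fun _ => 0) s t Hst).
        - intros; apply DF.
        - intros; exact (is_derive_const (V := R_NormedModule) 0 _).
        - intros; rewrite Cmod_0; lra. }
      assert (Z' : Cmod (F t - F s)%C = 0) by (assert (X := Cmod_ge_0 (F t - F s)%C); lra).
      apply Cmod_eq_0 in Z'. replace (F t) with ((F t - F s) + F s)%C by ring.
      rewrite Z'; ring. }
    destruct (Rle_or_lt 0 x); [rewrite (Cst 0 x); auto | rewrite <- (Cst x 0); auto; lra]. }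
  replace (RtoC (INR k * INR (k - 1)) * J (k - 2)%nat x)%C with
    (F x + (RtoC (INR k * x ^ (k - 1)) * T x - RtoC (x ^ k) * T' x - om ^ 2 * J k x))%C
    by (unfold F; ring).
  rewrite Fx; ring.
Qed.

Section ErrorSystem.
Variables (D : R -> Prop) (l sigma : R -> R) (K U Z G : R -> C) (phi psi : nat -> R -> C)
  (om : C) (T T' : R -> C) (J : nat -> R -> C) (par : nat -> bool) (a : nat -> C) (N : nat).
Hypotheses
  (Hl : forall y, D y -> is_derive l y (sigma y))
  (HU : forall y, D y -> is_Cderive U y (RtoC (sigma y) * Z y)%C)
  (HZ : forall y, D y -> is_Cderive Z y (RtoC (sigma y) * ((K y - om ^ 2) * U y))%C)
  (HG : forall y, D y -> is_Cderive G y (RtoC (sigma y) * (RtoC (1 / 4) * K y))%C)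
  (Hphi : forall k y, D y -> is_Cderive (phi k) y (RtoC (sigma y) * psi k y)%C)
  (Hpsi : forall k y, D y -> is_Cderive (psi k) y
     (RtoC (sigma y) * (K y * phi k y + RtoC (INR k * INR (k - 1)) * phi (k - 2)%nat y))%C)
  (HT : forall x, is_Cderive T x (T' x)) (HT' : forall x, is_Cderive T' x (- (om ^ 2 * T x))%C)
  (HJ : forall k x, is_Cderive (J k) x (RtoC (x ^ k) * T x)%C)
  (HJ0 : forall k, J k 0 = RtoC 0)
  (par2 : forall k, par (S (S k)) = par k)
  (H0 : par 0%nat = true -> T' 0 = RtoC 0) (H1 : par 1%nat = true -> T 0 = RtoC 0).

(** The polynomial wave function [sum_n a_n sum_k C(n,k) phi_(n-k)(y) t^k]
    restricted to the characteristic [t = l y]. *)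
Definition trace (y : R) : C :=
  dsum par a N (fun n k => phi (n - k)%nat y * RtoC (l y ^ k))%C.
Definition moment_sum (f : nat -> R -> C) (y : R) : C :=
  dsum par a N (fun n k => f (n - k)%nat y * J k (l y))%C.
(** Here [U] stands for the transformed solution and [phi], [psi] for the formal
    powers and their derivatives with respect to [l]. *)
Definition error (y : R) : C := (U y - T (l y) - RtoC 2 * moment_sum phi y)%C.
(** This is [error' - 4 T (G - trace)], with the derivative in [l] written out;
    in this form no derivative of [G] or of the trace occurs. *)
Definition quasi_derivative (y : R) : C :=
  (Z y - T' (l y) - RtoC 2 * moment_sum psi y + RtoC 2 * trace y * T (l y)
   - RtoC 4 * G y * T (l y))%C.

Lemma is_Cderive_moment (f f' : nat -> R -> C) y : D y ->
  (forall k, is_Cderive (f k) y (RtoC (sigma y) * f' k y)%C) ->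
  is_Cderive (moment_sum f) y
    (RtoC (sigma y) * (moment_sum f' y +
       dsum par a N (fun n k => f (n - k)%nat y * RtoC (l y ^ k))%C * T (l y)))%C.
Proof.
  intros Hy Hf. eapply is_Cderive_eq.
  - apply is_Cderive_dsum. intros n k Hk. apply is_Cderive_mult; [apply Hf|].
    exact (is_Cderive_comp (J k) l y _ _ (HJ k (l y)) (Hl y Hy)).
  - rewrite (Cmult_comm (dsum _ _ _ _)). rewrite <- dsum_scal.
    unfold moment_sum. rewrite <- dsum_plus, <- dsum_scal.
    apply dsum_ext; intros n k _ _. ring.
Qed.

Lemma is_Cderive_trace y : D y ->
  is_Cderive trace y (RtoC (sigma y) *
    (dsum par a N (fun n k => psi (n - k)%nat y * RtoC (l y ^ k))%C +
     dsum par a N (fun n k => phi (n - k)%nat y * RtoC (INR k * l y ^ (k - 1)))%C))%C.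
Proof.
  intros Hy. eapply is_Cderive_eq.
  - apply is_Cderive_dsum. intros n k Hk. apply is_Cderive_mult; [apply Hphi, Hy|].
    apply is_Cderive_RtoC. apply is_derive_pow, Hl, Hy.
  - rewrite <- dsum_plus, <- dsum_scal. apply dsum_ext; intros n k _ _.
    replace (pred k) with (k - 1)%nat by lia.
    rewrite !RtoC_mult. ring.
Qed.

Lemma is_Cderive_error y : D y ->
  is_Cderive error y
    (RtoC (sigma y) * (quasi_derivative y + RtoC 4 * T (l y) * (G y - trace y)))%C.
Proof.
  intros Hy. eapply is_Cderive_eq.
  - apply is_Cderive_minus; [apply is_Cderive_minus; [apply HU, Hy|]|].
    + exact (is_Cderive_comp T l y _ _ (HT (l y)) (Hl y Hy)).
    + apply is_Cderive_scal, (is_Cderive_moment phi psi y Hy). intros; now apply Hphi.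
  - unfold quasi_derivative. change (dsum par a N _) with (trace y).
    replace (RtoC 4) with (RtoC 2 * RtoC 2)%C by (rewrite <- RtoC_mult; f_equal; ring).
    ring.
Qed.

(** All sums cancel except the moments weighted by [phi_(m-2)], which come from
    the recursion of the formal powers. The shift identity turns them into moments
    of order [k - 2], and integration by parts returns these to the order [k]. *)
Lemma is_Cderive_quasi_derivative y : D y ->
  is_Cderive quasi_derivative y
    (RtoC (sigma y) * ((K y - om ^ 2) * error y - RtoC 4 * T' (l y) * (G y - trace y)))%C.
Proof.
  intros Hy.
  assert (DT := is_Cderive_comp T l y _ _ (HT (l y)) (Hl y Hy)).
  assert (DT' := is_Cderive_comp T' l y _ _ (HT' (l y)) (Hl y Hy)).
  eapply is_Cderive_eq.
  - apply is_Cderive_minus; [apply is_Cderive_plus; [apply is_Cderive_minus;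
      [apply is_Cderive_minus; [apply HZ, Hy|exact DT']|]|]|].
    + apply is_Cderive_scal, (is_Cderive_moment psi
        (fun k y => K y * phi k y + RtoC (INR k * INR (k - 1)) * phi (k - 2)%nat y)%C y Hy).
      intros; now apply Hpsi.
    + apply is_Cderive_mult; [apply is_Cderive_scal, is_Cderive_trace, Hy | exact DT].
    + apply is_Cderive_mult; [apply is_Cderive_scal, HG, Hy | exact DT].
  - set (P1 := dsum par a N (fun n k => psi (n - k)%nat y * RtoC (l y ^ k))%C).
    set (P2 := dsum par a N (fun n k => phi (n - k)%nat y * RtoC (INR k * l y ^ (k - 1)))%C).
    set (M1 := dsum par a N (fun n k => RtoC (INR (n - k) * INR (n - k - 1)) * phi (n - k - 2)%nat y * J k (l y))%C).
    assert (E1 : moment_sum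
       (fun k y => K y * phi k y + RtoC (INR k * INR (k - 1)) * phi (k - 2)%nat y)%C y =
       (K y * moment_sum phi y + M1)%C).
    { unfold moment_sum, M1. rewrite <- dsum_scal, <- dsum_plus.
      apply dsum_ext; intros; ring. }
    assert (E2 : M1 = (P2 * T (l y) - trace y * T' (l y) - om ^ 2 * moment_sum phi y)%C).
    { unfold M1. rewrite <- (dsum_two_step par a N par2 (fun k => phi k y) (fun k => J k (l y))).
      replace (P2 * T (l y) - trace y * T' (l y) - om ^ 2 * moment_sum phi y)%C with
        (T (l y) * P2 + (- T' (l y) * trace y + (- om ^ 2) * moment_sum phi y))%C by ring.
      unfold P2, trace, moment_sum. rewrite <- !dsum_scal, <- !dsum_plus.
      apply dsum_ext; intros n k Hk Pk.
      rewrite (Cmult_comm (RtoC _)), <- Cmult_assoc.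
      rewrite (moment_by_parts om T T' J par HT HT' HJ HJ0 H0 H1 k (l y) Pk). ring. }
    rewrite E1, E2. unfold error.
    replace (RtoC (1 / 4)) with (/ (RtoC 2 * RtoC 2))%C
      by (rewrite <- RtoC_mult, <- RtoC_inv by lra; f_equal; field).
    replace (RtoC 4) with (RtoC 2 * RtoC 2)%C by (rewrite <- RtoC_mult; f_equal; ring).
    field; C_nonzero.
Qed.

Lemma moment_sum_at_0 f y : l y = 0 -> moment_sum f y = RtoC 0.
Proof.
  intros E; unfold moment_sum.
  transitivity (dsum par a N (fun _ _ => RtoC 0 * RtoC 0)%C).
  - apply dsum_ext; intros. rewrite E, HJ0; ring.
  - rewrite dsum_scal; ring.
Qed.

Lemma error_at_0 y : l y = 0 -> U y = T 0 -> error y = RtoC 0.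
Proof. intros E EU; unfold error. rewrite moment_sum_at_0, E, EU by exact E. ring. Qed.

Lemma quasi_derivative_at_0 y : l y = 0 ->
  quasi_derivative y = (Z y - T' 0 - RtoC 2 * (RtoC 2 * G y - trace y) * T 0)%C.
Proof.
  intros E; unfold quasi_derivative. rewrite moment_sum_at_0, E by exact E.
  replace (RtoC 4) with (RtoC 2 * RtoC 2)%C by (rewrite <- RtoC_mult; f_equal; ring).
  ring.
Qed.

Lemma error_system_holds s t : (forall y, s <= y <= t -> D y) ->
  error_system s t l sigma (fun y => T (l y)) (fun y => T' (l y)) (fun y => G y - trace y)%C
    K error quasi_derivative om.
Proof.
  intros HD; constructor; intros y Hy.
  - apply Hl; auto.
  - apply is_Cderive_error; auto.
  - apply is_Cderive_quasi_derivative; auto.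
Qed.

End ErrorSystem.

(** * Continuous extension to the closed interval *)

(** McShane's formula for the least Lipschitz extension of a Lipschitz function
    from [D] to the line; it provides the continuous extension to the end points
    without any limit. *)
Definition mcshane (D : R -> Prop) (M : R) (f : R -> R) (e : R) : R :=
  real (Lub_Rbar (fun v => exists z, D z /\ v = f z - M * Rabs (z - e))).

Section McShane.
Variables (D : R -> Prop) (M : R) (f : R -> R) (z0 : R).
Hypotheses (HM : 0 <= M) (Hz0 : D z0)
  (Hf : forall s t, D s -> D t -> f t - f s <= M * Rabs (t - s)).

Lemma mcshane_lub e :
  is_lub_Rbar (fun v => exists z, D z /\ v = f z - M * Rabs (z - e)) (mcshane D M f e).
Proof.
  unfold mcshane.
  assert (L := Lub_Rbar_correct (fun v => exists z, D z /\ v = f z - M * Rabs (z - e))).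
  destruct (Lub_Rbar _) as [x| |]; [exact L| |].
  - exfalso. destruct L as [_ L2].
    apply (L2 (Finite (f z0 + M * Rabs (z0 - e)))).
    intros v [z [Hz ->]]; simpl.
    assert (F := Hf z0 z Hz0 Hz).
    assert (T := Rabs_triang (z - e) (e - z0)).
    replace (z - e + (e - z0)) with (z - z0) in T by ring.
    rewrite (Rabs_minus_sym e z0) in T.
    assert (M * Rabs (z - z0) <= M * (Rabs (z - e) + Rabs (z0 - e)))
      by (apply Rmult_le_compat_l; lra). lra.
  - exfalso. destruct L as [L1 _].
    apply (L1 (f z0 - M * Rabs (z0 - e))). now exists z0.
Qed.

Lemma mcshane_eq e : D e -> mcshane D M f e = f e.
Proof.
  intros He. destruct (mcshane_lub e) as [L1 L2].
  apply Rle_antisym.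
  - apply (L2 (Finite (f e))). intros v [z [Hz ->]]; simpl.
    assert (F := Hf e z He Hz). lra.
  - apply (L1 (f e)). exists e; split; [exact He|].
    rewrite Rminus_diag, Rabs_R0; ring.
Qed.

Lemma mcshane_lipschitz e e' :
  mcshane D M f e - mcshane D M f e' <= M * Rabs (e - e').
Proof.
  destruct (mcshane_lub e) as [_ L2]. destruct (mcshane_lub e') as [L1 _].
  assert (mcshane D M f e <= mcshane D M f e' + M * Rabs (e - e')); [|lra].
  apply (L2 (Finite _)). intros v [z [Hz ->]]; simpl.
  assert (X : f z - M * Rabs (z - e') <= mcshane D M f e') by (apply (L1 _); now exists z).
  assert (T := Rabs_triang (z - e) (e - e')).
  replace (z - e + (e - e')) with (z - e') in T by ring.
  assert (M * Rabs (z - e') <= M * (Rabs (z - e) + Rabs (e - e')))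
    by (apply Rmult_le_compat_l; lra). lra.
Qed.

Lemma mcshane_continuous e : continuous (mcshane D M f) e.
Proof.
  intros P [d Hd].
  assert (0 < d / (M + 1)) by (apply Rdiv_lt_0_compat; [apply cond_pos | lra]).
  exists (mkposreal _ H); intros y Hy; apply Hd.
  change (Rabs (y - e) < d / (M + 1)) in Hy.
  change (Rabs (mcshane D M f y - mcshane D M f e) < d).
  assert (X1 := mcshane_lipschitz y e). assert (X2 := mcshane_lipschitz e y).
  rewrite (Rabs_minus_sym e y) in X2.
  assert (Rabs (y - e) * (M + 1) < d).
  { replace (pos d) with (d / (M + 1) * (M + 1)) by (field; lra).
    apply Rmult_lt_compat_r; lra. }
  assert (0 <= Rabs (y - e)) by apply Rabs_pos.
  assert (M * Rabs (y - e) < d \/ Rabs (y - e) = 0) by nra.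
  apply Rabs_def1; destruct H2 as [|E]; try lra; rewrite E in *;
    assert (0 < d) by apply cond_pos; lra.
Qed.

End McShane.

Lemma Cmod_lipschitz (A B : R) (f f' : R -> C) (M : R) :
  (forall t, A < t < B -> is_Cderive f t (f' t)) ->
  (forall t, A < t < B -> Cmod (f' t) <= M) ->
  forall s t, A < s < B -> A < t < B -> Cmod (f t - f s)%C <= M * Rabs (t - s).
Proof.
  intros Hf HM.
  assert (W : forall s t, A < s -> s <= t -> t < B -> Cmod (f t - f s)%C <= M * (t - s)).
  { intros s t H1 H2 H3.
    replace (M * (t - s)) with (M * t - M * s) by ring.
    apply (Cmod_increment_le f f' (fun z => M * z) (fun _ => M) s t H2).
    - intros; apply Hf; lra.
    - intros; auto_derive; [exact I|ring].
    - intros; apply HM; lra. }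
  intros s t Hs Ht. destruct (Rle_or_lt s t).
  - rewrite Rabs_right by lra. apply W; lra.
  - rewrite Rabs_left by lra.
    replace (f t - f s)%C with (- (f s - f t))%C by ring.
    rewrite Cmod_opp. replace (- (t - s)) with (s - t) by ring. apply W; lra.
Qed.

Lemma bounded_derivative_extension (A B : R) (f f' : R -> C) (M N : R) :
  A < B ->
  (forall t, A < t < B -> is_Cderive f t (f' t)) ->
  (forall t, A < t < B -> Cmod (f' t) <= M) ->
  (forall t, A < t < B -> Cmod (f t) <= N) ->
  exists F : R -> C, (forall y, A < y < B -> F y = f y) /\
    (forall y, continuous F y) /\
    (forall y, A <= y <= B -> Cmod (F y) <= N).
Proof.
  intros HAB Hf HM HN.
  assert (L := Cmod_lipschitz A B f f' M Hf HM).
  set (D := fun y => A < y < B).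
  set (m := (A + B) / 2).
  assert (Dm : D m) by (unfold D, m; lra).
  assert (M0 : 0 <= M) by (eapply Rle_trans; [apply Cmod_ge_0 | apply (HM m Dm)]).
  assert (LRe : forall s t, D s -> D t -> Re (f t) - Re (f s) <= M * Rabs (t - s)).
  { intros s t Hs Ht. eapply Rle_trans; [|apply (L s t Hs Ht)].
    eapply Rle_trans; [|apply re_le_Cmod]. eapply Rle_trans; [|apply Rle_abs].
    right; simpl; unfold Re; ring. }
  assert (LIm : forall s t, D s -> D t -> Im (f t) - Im (f s) <= M * Rabs (t - s)).
  { intros s t Hs Ht. eapply Rle_trans; [|apply (L s t Hs Ht)].
    replace (Cmod (f t - f s)%C) with (Cmod (- Ci * (f t - f s))%C)
      by (rewrite Cmod_mult, Cmod_opp, Cmod_Ci; ring).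
    eapply Rle_trans; [|apply re_le_Cmod]. eapply Rle_trans; [|apply Rle_abs].
    right; simpl; unfold Re, Im; ring. }
  set (F := fun y => (mcshane D M (fun s => Re (f s)) y, mcshane D M (fun s => Im (f s)) y) : C).
  assert (FE : forall y, A < y < B -> F y = f y).
  { intros y Hy. unfold F.
    rewrite (mcshane_eq D M _ m M0 Dm LRe y Hy), (mcshane_eq D M _ m M0 Dm LIm y Hy).
    now destruct (f y). }
  exists F; split; [exact FE|split].
  - intros y; apply continuous_C_components.
    + now apply (mcshane_continuous D M _ m).
    + now apply (mcshane_continuous D M _ m).
  - intros y Hy. apply le_epsilon; intros e He.
    set (th := Rmin (1/2) (e / (2 * (M + 1) * (B - A)))).
    assert (P : 0 < 2 * (M + 1) * (B - A)) by (apply Rmult_lt_0_compat; lra).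
    assert (Hth : 0 < th) by (apply Rmin_glb_lt; [lra | now apply Rdiv_lt_0_compat]).
    assert (th1 : th <= 1 / 2) by apply Rmin_l.
    assert (th2 : th <= e / (2 * (M + 1) * (B - A))) by apply Rmin_r.
    set (z := y + th * (m - y)).
    assert (Hz : D z) by (unfold D, z, m; nra).
    assert (Hyz : Rabs (y - z) <= th * (B - A)).
    { unfold z. replace (y - (y + th * (m - y))) with (th * (y - m)) by ring.
      rewrite Rabs_mult, (Rabs_right th) by lra. apply Rmult_le_compat_l; [lra|].
      unfold m; apply Rabs_le; lra. }
    replace (F y) with (F z + (F y - F z))%C by ring.
    eapply Rle_trans; [apply Cmod_triangle|].
    apply Rplus_le_compat; [rewrite FE by exact Hz; now apply HN|].
    eapply Rle_trans; [apply Cmod_Re_Im|].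
    assert (A1 : Rabs (Re (F y - F z)%C) <= M * Rabs (y - z)).
    { replace (Re (F y - F z)%C) with (Re (F y) - Re (F z)) by (simpl; unfold Re; ring).
      simpl. assert (X1 := mcshane_lipschitz D M _ m M0 Dm LRe y z).
      assert (X2 := mcshane_lipschitz D M _ m M0 Dm LRe z y).
      rewrite (Rabs_minus_sym z y) in X2. apply Rabs_le; lra. }
    assert (A2 : Rabs (Im (F y - F z)%C) <= M * Rabs (y - z)).
    { replace (Im (F y - F z)%C) with (Im (F y) - Im (F z)) by (simpl; unfold Im; ring).
      simpl. assert (X1 := mcshane_lipschitz D M _ m M0 Dm LIm y z).
      assert (X2 := mcshane_lipschitz D M _ m M0 Dm LIm z y).
      rewrite (Rabs_minus_sym z y) in X2. apply Rabs_le; lra. }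
    apply Rle_trans with (2 * (M * (th * (B - A)))).
    { assert (M * Rabs (y - z) <= M * (th * (B - A))) by (apply Rmult_le_compat_l; lra). lra. }
    apply Rle_trans with (th * (2 * (M + 1) * (B - A))).
    { assert (0 <= th * (B - A)) by (apply Rmult_le_pos; lra). nra. }
    apply Rle_trans with (e / (2 * (M + 1) * (B - A)) * (2 * (M + 1) * (B - A))).
    { apply Rmult_le_compat_r; lra. }
    right; field; lra.
Qed.

(** The estimate of the error makes its derivative bounded: [Th] has a bounded
    derivative, hence is bounded, and then so is the derivative of [E]. *)
Lemma error_extension (A B y0 : R) (l sigma : R -> R) (tau tau' w K E Th : R -> C) (om : C)
    (c M eps b Sg Tb : R) :
  A < y0 < B -> om <> RtoC 0 -> 0 <= c -> Rabs (Im om) <= c -> 0 <= M -> 0 <= eps -> 0 < b ->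
  (forall s t, A < s -> s <= t -> t < B -> error_system s t l sigma tau tau' w K E Th om) ->
  kernel_bound (fun t => A < t < B) l tau tau' om c ->
  (forall t, A < t < B -> 0 <= sigma t <= Sg) ->
  (forall t, A < t < B -> Cmod (tau t) <= Tb /\ Cmod (tau' t) <= Tb) ->
  l y0 = 0 -> (forall t, A < t < B -> - b <= l t <= b) ->
  (forall t, A < t < B -> Cmod (w t) <= eps) ->
  (forall t, A < t < B -> Cmod (K t) <= M) ->
  E y0 = RtoC 0 -> Cmod (Th y0) <= 2 * eps ->
  exists F : R -> C, (forall y, A < y < B -> F y = E y) /\
    (forall y, continuous F y) /\
    (forall y, A <= y <= B -> Cmod (F y) <= 12 * eps * exp (2 * (M * b) * b) * sinh_quot c b).
Proof.
  intros Hy0 Hom Hc0 Hc HM Heps Hb HS Hker Hsg Htau Hl0 Hlb Hw HK HE0 HTh0.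
  assert (HE := volterra_bound_two_sided A B y0 l sigma tau tau' w K E Th om c M eps b
    Hy0 Hom Hc0 Hc HM Heps Hb HS Hker (fun t Ht => proj1 (Hsg t Ht)) Hl0 Hlb Hw HK HE0 HTh0).
  set (N := 12 * eps * exp (2 * (M * b) * b) * sinh_quot c b) in *; clearbody N.
  assert (N0 : 0 <= N) by (eapply Rle_trans; [apply Cmod_ge_0 | apply (HE y0 Hy0)]).
  assert (Sg0 : 0 <= Sg) by (specialize (Hsg y0 Hy0); lra).
  assert (Tb0 : 0 <= Tb) by (eapply Rle_trans; [apply Cmod_ge_0 | apply (proj1 (Htau y0 Hy0))]).
  set (C1 := Sg * ((M + Cmod (om ^ 2)) * N + 4 * Tb * eps)).
  assert (P4 : Cmod (RtoC 4) = 4) by (rewrite Cmod_R, Rabs_right; lra).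
  assert (HTh : forall t, A < t < B -> Cmod (Th t) <= 2 * eps + C1 * (B - A)).
  { intros t Ht.
    assert (X := Cmod_lipschitz A B Th
      (fun t => (RtoC (sigma t) * ((K t - om ^ 2) * E t - RtoC 4 * tau' t * w t))%C) C1).
    assert (X' : Cmod (Th t - Th y0)%C <= C1 * Rabs (t - y0)).
    { apply X; auto; intros s Hs.
      - apply (es_Th (HS s s ltac:(lra) ltac:(lra) ltac:(lra))); lra.
      - rewrite Cmod_mult, Cmod_R. destruct (Hsg s Hs) as [S1 S2].
        rewrite Rabs_right by lra.
        apply Rmult_le_compat; [lra | apply Cmod_ge_0 | exact S2 |].
        unfold Cminus. eapply Rle_trans; [apply Cmod_triangle|].
        rewrite Cmod_opp, !Cmod_mult, P4. apply Rplus_le_compat.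
        + apply Rmult_le_compat; try apply Cmod_ge_0; [|now apply HE].
          eapply Rle_trans; [apply Cmod_triangle|].
          rewrite Cmod_opp. apply Rplus_le_compat_r; now apply HK.
        + apply Rmult_le_compat; try apply Cmod_ge_0; [|apply Rmult_le_compat_l|now apply Hw].
          * apply Rmult_le_pos; [lra | apply Cmod_ge_0].
          * lra.
          * apply (Htau s Hs). }
    replace (Th t) with (Th y0 + (Th t - Th y0))%C by ring.
    eapply Rle_trans; [apply Cmod_triangle|]. apply Rplus_le_compat; [exact HTh0|].
    eapply Rle_trans; [exact X'|].
    apply Rmult_le_compat_l; [|apply Rabs_le; lra].
    unfold C1. assert (0 <= Cmod (om ^ 2)) by apply Cmod_ge_0.
    apply Rmult_le_pos; [exact Sg0|].
    apply Rplus_le_le_0_compat; repeat apply Rmult_le_pos; lra. }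
  apply bounded_derivative_extension with
    (f' := fun t => (RtoC (sigma t) * (Th t + RtoC 4 * tau t * w t))%C)
    (M := Sg * ((2 * eps + C1 * (B - A)) + 4 * Tb * eps)); [lra| | |exact HE].
  - intros t Ht.
    apply (es_E (HS t t ltac:(lra) ltac:(lra) ltac:(lra))); lra.
  - intros t Ht. rewrite Cmod_mult, Cmod_R. destruct (Hsg t Ht) as [S1 S2].
    rewrite Rabs_right by lra.
    apply Rmult_le_compat; [lra | apply Cmod_ge_0 | exact S2 |].
    eapply Rle_trans; [apply Cmod_triangle|].
    rewrite !Cmod_mult, P4. apply Rplus_le_compat; [now apply HTh|].
    apply Rmult_le_compat; try apply Cmod_ge_0; [|apply Rmult_le_compat_l|now apply Hw].
    + apply Rmult_le_pos; [lra | apply Cmod_ge_0].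
    + lra.
    + apply (Htau t Ht).
Qed.

(** * The coefficients and the change of variable *)

Definition clamp (A B y : R) : R := Rmax A (Rmin y B).

Lemma clamp_in A B y : A <= B -> A <= clamp A B y <= B.
Proof. intros H; unfold clamp, Rmax, Rmin; repeat destruct Rle_dec; lra. Qed.

Lemma clamp_id A B y : A <= y <= B -> clamp A B y = y.
Proof. intros H; unfold clamp, Rmax, Rmin; repeat destruct Rle_dec; lra. Qed.

Lemma clamp_continuous A B y : A <= B -> continuous (clamp A B) y.
Proof.
  intros HAB P [d Hd]; exists d; intros z Hz; apply Hd.
  change (Rabs (z - y) < d) in Hz. change (Rabs (clamp A B z - clamp A B y) < d).
  eapply Rle_lt_trans; [|exact Hz].
  unfold clamp, Rmax, Rmin, Rabs; repeat destruct Rle_dec; repeat destruct Rcase_abs; lra.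
Qed.

(** Continuity relative to [[A,B]] becomes continuity on the whole line after
    composition with the retraction onto [[A,B]], so that results on integrals of
    continuous functions apply up to the end points. *)
Lemma continuous_on_clamp {U : UniformSpace} (A B : R) (f : R -> U) y :
  A <= B -> continuous_on (fun s => A <= s <= B) f ->
  continuous (fun s => f (clamp A B s)) y.
Proof.
  intros HAB Hf P HP.
  assert (X := Hf (clamp A B y) (clamp_in A B y HAB) P HP).
  assert (Y := clamp_continuous A B y HAB _ X).
  revert Y; unfold filtermap; apply filter_imp; intros s Hs.
  apply Hs, clamp_in, HAB.
Qed.

Lemma Rpower_fourth_root (x z : R) : 0 < z -> z ^ 4 = x -> Rpower x (1 / 4) = z.
Proof.
  intros Hz <-. rewrite <- Rpower_pow, Rpower_mult by exact Hz.
  replace (INR 4 * (1 / 4)) with 1 by (simpl; field). now apply Rpower_1.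
Qed.

Lemma Rpower_4 (x : R) : 0 < x -> Rpower x (1 / 4) ^ 4 = x.
Proof.
  intros Hx. rewrite <- Rpower_pow by apply exp_pos. rewrite Rpower_mult.
  replace (1 / 4 * INR 4) with 1 by (simpl; field). now apply Rpower_1.
Qed.

Section Coefficients.
Variables (A B : R) (p r : R -> R) (y0 b : R).
Hypotheses (Hcoef : coefficients A B p r) (Hy0 : A < y0 < B)
  (HbA : RInt (fun s => sqrt (r s / p s)) A y0 = b)
  (HbB : RInt (fun s => sqrt (r s / p s)) y0 B = b).

Lemma p_pos y : A <= y <= B -> 0 < p y.
Proof. intros H; apply Hcoef, H. Qed.
Lemma r_pos y : A <= y <= B -> 0 < r y.
Proof. intros H; apply Hcoef, H. Qed.
Lemma rho_pos y : 0 < rho p r y.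
Proof. apply exp_pos. Qed.

Lemma sigma_pos y : A <= y <= B -> 0 < sqrt (r y / p y).
Proof.
  intros H. apply sqrt_lt_R0, Rdiv_lt_0_compat; [now apply r_pos | now apply p_pos].
Qed.

Lemma rho_4 y : A <= y <= B -> rho p r y ^ 4 = p y * r y.
Proof.
  intros H. apply Rpower_4, Rmult_lt_0_compat; [now apply p_pos | now apply r_pos].
Qed.

Lemma sigma_p y : A <= y <= B -> sqrt (r y / p y) * p y = rho p r y ^ 2.
Proof.
  intros H. assert (P := p_pos y H). assert (Q := r_pos y H).
  assert (S := sigma_pos y H). assert (R := rho_pos y).
  assert (E : Rsqr (sqrt (r y / p y) * p y) = Rsqr (rho p r y ^ 2)).
  { rewrite Rsqr_mult, Rsqr_sqrt by (left; now apply Rdiv_lt_0_compat).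
    replace (Rsqr (rho p r y ^ 2)) with (rho p r y ^ 4) by (unfold Rsqr; ring).
    rewrite rho_4 by exact H. unfold Rsqr; field; lra. }
  apply Rsqr_inj; [|apply pow2_ge_0|exact E].
  left; now apply Rmult_lt_0_compat.
Qed.

Lemma sigma_rho2 y : A <= y <= B -> sqrt (r y / p y) * rho p r y ^ 2 = r y.
Proof.
  intros H. assert (P := p_pos y H).
  apply Rmult_eq_reg_r with (p y); [|lra].
  replace (sqrt (r y / p y) * rho p r y ^ 2 * p y) with
    (sqrt (r y / p y) * p y * rho p r y ^ 2) by ring.
  rewrite sigma_p, (Rmult_comm (r y)), <- rho_4 by exact H. ring.
Qed.

Lemma rho_inv y : A <= y <= B -> Rpower (p y * r y) (- (1 / 4)) = / rho p r y.
Proof. intros H; apply Rpower_Ropp. Qed.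

Lemma rho_over_r y : A <= y <= B -> Rpower ((/ r y) ^ 3 * p y) (1 / 4) = rho p r y / r y.
Proof.
  intros H. assert (P := p_pos y H). assert (Q := r_pos y H).
  apply Rpower_fourth_root.
  - apply Rdiv_lt_0_compat; [apply rho_pos | exact Q].
  - unfold Rdiv. rewrite Rpow_mult_distr, rho_4 by exact H. field; lra.
Qed.

Lemma p_derive y : A < y < B -> is_derive p y (Derive p y).
Proof. intros H; apply Derive_correct, Hcoef, H. Qed.
Lemma r_derive y : A < y < B -> is_derive r y (Derive r y).
Proof. intros H; apply Derive_correct, Hcoef, H. Qed.

Lemma pr_power_derive k y : A < y < B ->
  is_derive (fun s => Rpower (p s * r s) k) y
    (k * Rpower (p y * r y) (k - 1) * (Derive p y * r y + p y * Derive r y)).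
Proof.
  intros H. assert (P := p_pos y ltac:(lra)). assert (Q := r_pos y ltac:(lra)).
  assert (PQ : 0 < p y * r y) by now apply Rmult_lt_0_compat.
  eapply is_derive_eq.
  - apply (is_derive_comp (fun x => Rpower x k) (fun s => p s * r s) y
      (k * Rpower (p y * r y) (k - 1))).
    + apply is_derive_Reals, derivable_pt_lim_power, PQ.
    + exact (Derive.is_derive_mult p r y _ _ (p_derive y H) (r_derive y H)).
  - unfold scal; simpl; unfold mult; simpl; ring.
Qed.

Lemma rho_derive y : A < y < B -> is_derive (rho p r) y (Derive (rho p r) y).
Proof.
  intros H; apply Derive_correct. eexists; apply (pr_power_derive (1 / 4) y H).
Qed.

Lemma inv_rho_derive y : A < y < B ->
  Derive (fun s => Rpower (p s * r s) (- (1 / 4))) y =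
  - (Derive (rho p r) y / rho p r y ^ 2).
Proof.
  intros H; apply is_derive_unique.
  apply is_derive_ext_loc with (fun s => / rho p r s).
  - apply (locally_open_interval A B); [exact H|].
    intros s Hs; symmetry; apply rho_inv; lra.
  - eapply is_derive_eq.
    + apply is_derive_inv; [now apply rho_derive|].
      assert (R := rho_pos y); lra.
    + unfold Rdiv; ring.
Qed.

Lemma AC_p : AC_loc A B (fun y => RtoC (p y)). Proof. apply Hcoef. Qed.
Lemma AC_p' : AC_loc A B (fun y => RtoC (Derive p y)). Proof. apply Hcoef. Qed.
Lemma AC_r : AC_loc A B (fun y => RtoC (r y)). Proof. apply Hcoef. Qed.
Lemma AC_r' : AC_loc A B (fun y => RtoC (Derive r y)). Proof. apply Hcoef. Qed.

Lemma AC_pr' : AC_loc A B (fun y => RtoC (Derive p y * r y + p y * Derive r y)).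
Proof.
  eapply AC_loc_ext; [|apply AC_loc_plus; apply AC_loc_mult;
    [exact AC_p' | exact AC_r | exact AC_p | exact AC_r']].
  intros y _; simpl. rewrite RtoC_plus, !RtoC_mult; reflexivity.
Qed.

Lemma pr_power_continuous k y : A < y < B ->
  continuous (fun s => RtoC (Rpower (p s * r s) k)) y.
Proof.
  intros H. eapply is_Cderive_continuous, is_Cderive_RtoC, pr_power_derive, H.
Qed.

Lemma AC_pr_power k : AC_loc A B (fun y => RtoC (Rpower (p y * r y) k)).
Proof.
  apply AC_loc_C1 with (fun y =>
    RtoC (k * Rpower (p y * r y) (k - 1) * (Derive p y * r y + p y * Derive r y))).
  - intros y Hy; apply is_Cderive_RtoC, pr_power_derive, Hy.
  - intros y Hy.
    apply (continuous_ext (fun y => RtoC k * RtoC (Rpower (p y * r y) (k - 1)) *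
      RtoC (Derive p y * r y + p y * Derive r y))%C).
    { intros s; rewrite <- !RtoC_mult; reflexivity. }
    apply continuous_Cmult; [apply continuous_Cmult|].
    + apply continuous_const.
    + now apply pr_power_continuous.
    + exact (AC_loc_continuous A B _ y AC_pr' Hy).
Qed.

(** The flux [p ((p r)^(-1/4))'], whose derivative enters the potential. *)
Lemma AC_p_inv_rho' : AC_loc A B (fun y =>
  RtoC (p y * Derive (fun s => Rpower (p s * r s) (- (1 / 4))) y)).
Proof.
  apply AC_loc_ext with (fun y => RtoC (p y) *
    ((RtoC (Rpower (p y * r y) (- (1 / 4) - 1)) * RtoC (Derive p y * r y + p y * Derive r y)) *
     RtoC (- (1 / 4))))%C.
  - intros y Hy.
    assert (E : Derive (fun s => Rpower (p s * r s) (- (1 / 4))) y = _)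
      by exact (is_derive_unique _ _ _ (pr_power_derive (- (1 / 4)) y Hy)).
    rewrite E.
    rewrite <- !RtoC_mult. f_equal; ring.
  - apply AC_loc_mult; [exact AC_p|]. apply AC_loc_mult; [apply AC_loc_mult|].
    + apply AC_pr_power.
    + apply AC_pr'.
    + apply AC_loc_C1 with (fun _ => RtoC 0).
      * intros; apply is_Cderive_const.
      * intros; apply continuous_const.
Qed.

Let sigma_clamped (s : R) : R := sqrt (r (clamp A B s) / p (clamp A B s)).

Lemma sigma_clamped_continuous y : continuous sigma_clamped y.
Proof.
  destruct Hcoef as [_ [_ [_ [_ [_ [Cp [Cr _]]]]]]].
  unfold sigma_clamped. apply (continuous_comp (fun s => r (clamp A B s) / p (clamp A B s)) sqrt).
  - apply (continuous_mult (K := R_AbsRing)).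
    + apply (continuous_on_clamp (U := R_UniformSpace)); [lra | exact Cr].
    + apply (continuous_comp (fun s => p (clamp A B s)) Rinv).
      * apply (continuous_on_clamp (U := R_UniformSpace)); [lra | exact Cp].
      * apply continuous_Rinv.
        assert (P := p_pos _ (clamp_in A B y ltac:(lra))); lra.
  - apply continuous_sqrt.
Qed.

Lemma sigma_sgc y : A <= y <= B -> sqrt (r y / p y) = sigma_clamped y.
Proof. intros H; unfold sigma_clamped; now rewrite clamp_id. Qed.

Lemma sigma_clamped_int x y : ex_RInt sigma_clamped x y.
Proof.
  apply (ex_RInt_continuous (V := R_CompleteNormedModule)). intros; apply sigma_clamped_continuous.
Qed.

Lemma sigma_RInt x y : A <= x <= B -> A <= y <= B ->
  RInt (fun s => sqrt (r s / p s)) x y = RInt sigma_clamped x y.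
Proof.
  intros Hx Hy. apply RInt_ext. intros s Hs. apply sigma_sgc.
  revert Hs; unfold Rmin, Rmax; destruct Rle_dec; lra.
Qed.

Lemma ell_derive y : A < y < B -> is_derive (ell p r y0) y (sqrt (r y / p y)).
Proof.
  intros Hy. rewrite (sigma_sgc y) by lra.
  apply is_derive_ext_loc with (fun s => RInt sigma_clamped y0 s).
  - apply (locally_open_interval A B); [exact Hy|].
    intros s Hs; unfold ell; rewrite sigma_RInt by lra; reflexivity.
  - apply (is_derive_RInt sigma_clamped _ y0).
    + apply filter_forall; intros s. apply (RInt_correct (V := R_CompleteNormedModule)), sigma_clamped_int.
    + apply sigma_clamped_continuous.
Qed.

Lemma ell_y0 : ell p r y0 y0 = 0.
Proof. exact (@RInt_point R_CompleteNormedModule y0 _). Qed.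

Lemma sigma_clamped_RInt_pos x y : x <= y -> 0 <= RInt sigma_clamped x y.
Proof.
  intros H. apply RInt_ge_0; [exact H | apply sigma_clamped_int|]. intros; apply sqrt_pos.
Qed.

Lemma ell_bound y : A < y < B -> - b <= ell p r y0 y <= b.
Proof.
  intros Hy. unfold ell. rewrite sigma_RInt by lra.
  assert (E1 : RInt sigma_clamped A y0 = b) by (rewrite <- HbA; symmetry; apply sigma_RInt; lra).
  assert (E2 : RInt sigma_clamped y0 B = b) by (rewrite <- HbB; symmetry; apply sigma_RInt; lra).
  assert (C1 := RInt_Chasles sigma_clamped y0 y B (sigma_clamped_int _ _) (sigma_clamped_int _ _)).
  assert (C2 := RInt_Chasles sigma_clamped A y0 y (sigma_clamped_int _ _) (sigma_clamped_int _ _)).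
  unfold plus in C1, C2; simpl in C1, C2.
  assert (P1 := sigma_clamped_RInt_pos y B ltac:(lra)). assert (P2 := sigma_clamped_RInt_pos A y ltac:(lra)).
  lra.
Qed.

Lemma sigma_bounded : exists Sg, forall y, A < y < B -> 0 <= sqrt (r y / p y) <= Sg.
Proof.
  destruct (continuous_on_bounded (fun s => RtoC (sigma_clamped s)) A B) as [M HM]; [lra| |].
  - apply continuous_on_forall; intros; apply continuous_RtoC, sigma_clamped_continuous.
  - exists M; intros y Hy; split; [apply sqrt_pos|].
    rewrite (sigma_sgc y) by lra. eapply Rle_trans; [apply Rle_abs|].
    rewrite <- Cmod_R. apply HM; lra.
Qed.

Lemma sigma_continuous y : A < y < B -> continuous (fun s => sqrt (r s / p s)) y.
Proof.
  intros Hy. apply continuous_ext_loc with sigma_clamped; [|apply sigma_clamped_continuous].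
  apply (locally_open_interval A B); [exact Hy|]. intros; rewrite sigma_sgc by lra; reflexivity.
Qed.

Let inv_rho_clamped (s : R) : R := 1 / rho p r (clamp A B s).

Lemma inv_rho_clamped_continuous y : continuous inv_rho_clamped y.
Proof.
  destruct Hcoef as [_ [_ [_ [_ [_ [Cp [Cr _]]]]]]].
  apply (continuous_ext (fun s => Rpower (p (clamp A B s) * r (clamp A B s)) (- (1 / 4)))).
  { intros s; rewrite rho_inv by (apply clamp_in; lra). unfold inv_rho_clamped, Rdiv; symmetry; apply Rmult_1_l. }
  assert (PQ : 0 < p (clamp A B y) * r (clamp A B y)).
  { apply Rmult_lt_0_compat; [apply p_pos | apply r_pos]; apply clamp_in; lra. }
  apply (continuous_comp (fun s => p (clamp A B s) * r (clamp A B s))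
    (fun x => Rpower x (- (1 / 4)))).
  - apply (continuous_mult (K := R_AbsRing)).
    + apply (continuous_on_clamp (U := R_UniformSpace)); [lra | exact Cp].
    + apply (continuous_on_clamp (U := R_UniformSpace)); [lra | exact Cr].
  - apply (ex_derive_continuous (V := R_NormedModule)). eexists.
    apply is_derive_Reals, derivable_pt_lim_power, PQ.
Qed.

Lemma inv_rho_le_max_norm y : A <= y <= B ->
  1 / rho p r y <= max_norm A B (fun y => RtoC (1 / rho p r y)).
Proof.
  intros Hy. unfold max_norm.
  set (S := fun s => exists y, A <= y <= B /\ s = Cmod (RtoC (1 / rho p r y))).
  destruct (continuous_on_bounded (fun s => RtoC (inv_rho_clamped s)) A B) as [M HM]; [lra| |].
  { apply continuous_on_forall; intros; apply continuous_RtoC, inv_rho_clamped_continuous. }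
  assert (L := Lub_Rbar_correct S).
  assert (Sy : S (1 / rho p r y)).
  { exists y; split; [exact Hy|]. rewrite Cmod_R, Rabs_right; [reflexivity|].
    apply Rle_ge; left; apply Rdiv_lt_0_compat; [lra | apply rho_pos]. }
  destruct L as [L1 L2]. assert (X := L1 _ Sy).
  assert (Y : Rbar_le (Lub_Rbar S) (Finite M)).
  { apply L2. intros s [z [Hz ->]]; simpl. specialize (HM z Hz).
    unfold inv_rho_clamped in HM; now rewrite clamp_id in HM. }
  destruct (Lub_Rbar S); simpl in *; [exact X | contradiction | contradiction].
Qed.

Lemma norm_le_of_error (f E : R -> C) (k : C) (N : R) :
  (forall y, A < y < B -> f y = (k * RtoC (1 / rho p r y) * E y)%C) ->
  (exists F : R -> C, (forall y, A < y < B -> F y = E y) /\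
    (forall y, continuous F y) /\ (forall y, A <= y <= B -> Cmod (F y) <= N)) ->
  norm_le A B f (Cmod k * (max_norm A B (fun y => RtoC (1 / rho p r y)) * N)).
Proof.
  intros Hf [F [F1 [F2 F3]]].
  exists (fun y => (k * RtoC (inv_rho_clamped y)) * F y)%C; split; [split|].
  - intros y Hy. rewrite F1, Hf by exact Hy. unfold inv_rho_clamped; rewrite clamp_id by lra; reflexivity.
  - apply continuous_on_forall; intros y _.
    apply continuous_Cmult; [apply continuous_Cmult|apply F2].
    + apply continuous_const.
    + apply continuous_RtoC, inv_rho_clamped_continuous.
  - unfold max_norm at 1.
    set (S := fun s => exists y, A <= y <= B /\ s = Cmod (k * RtoC (inv_rho_clamped y) * F y)%C).
    destruct (Lub_Rbar_correct S) as [L1 L2].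
    assert (X : Rbar_le (Lub_Rbar S)
      (Finite (Cmod k * (max_norm A B (fun y => RtoC (1 / rho p r y)) * N)))).
    { apply L2. intros s [z [Hz ->]]; simpl.
      assert (Q := inv_rho_le_max_norm z Hz).
      assert (P : 0 < 1 / rho p r z) by (apply Rdiv_lt_0_compat; [lra | apply rho_pos]).
      rewrite !Cmod_mult, Rmult_assoc. apply Rmult_le_compat_l; [apply Cmod_ge_0|].
      unfold inv_rho_clamped; rewrite clamp_id by exact Hz.
      rewrite Cmod_R, Rabs_right by lra.
      apply Rmult_le_compat; [lra | apply Cmod_ge_0 | exact Q | now apply F3]. }
    assert (Sy : S (Cmod (k * RtoC (inv_rho_clamped y0) * F y0)%C)) by (exists y0; split; [lra|reflexivity]).
    assert (Y := L1 _ Sy).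
    destruct (Lub_Rbar S); simpl in *; [exact X | contradiction | contradiction].
Qed.

End Coefficients.

(** * The Liouville transformation and the formal powers *)

Lemma sum_n_interleave (u v : nat -> R) n :
  sum_n (fun i => if Nat.even i then u (Nat.div2 i) else v (Nat.div2 i)) (S (2 * n)) =
  sum_n u n + sum_n v n.
Proof.
  induction n as [|n IH].
  - simpl. rewrite sum_Sn, !sum_O; reflexivity.
  - replace (S (2 * S n)) with (S (S (S (2 * n)))) by lia.
    rewrite sum_Sn, sum_Sn, IH, !sum_Sn.
    assert (E : Nat.even (S (S (2 * n))) = true) by (rewrite Nat.even_spec; exists (S n); lia).
    assert (O : Nat.even (S (S (S (2 * n)))) = false).
    { rewrite Nat.even_succ, <- Nat.negb_even, E; reflexivity. }
    rewrite E, O.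
    replace (S (S (S (2 * n)))) with (S (2 * S n)) by lia.
    replace (S (S (2 * n))) with (2 * S n)%nat by lia.
    rewrite Nat.div2_succ_double, Nat.div2_double.
    unfold plus; simpl; ring.
Qed.

Lemma null_set_union (E E' : R -> Prop) :
  null_set E -> null_set E' -> null_set (fun x => E x \/ E' x).
Proof.
  intros H H' eps Heps.
  destruct (H (eps / 2) ltac:(lra)) as [c [d [H1 [H2 H3]]]].
  destruct (H' (eps / 2) ltac:(lra)) as [c' [d' [K1 [K2 K3]]]].
  exists (fun i => if Nat.even i then c (Nat.div2 i) else c' (Nat.div2 i)),
         (fun i => if Nat.even i then d (Nat.div2 i) else d' (Nat.div2 i)).
  split; [|split].
  - intros n; destruct (Nat.even n); auto.
  - intros x [Hx|Hx].
    + destruct (H2 x Hx) as [n Hn]. exists (2 * n)%nat.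
      rewrite Nat.even_mul, Nat.div2_double; exact Hn.
    + destruct (K2 x Hx) as [n Hn]. exists (S (2 * n))%nat.
      rewrite Nat.even_succ, <- Nat.negb_even, Nat.even_mul, Nat.div2_succ_double; exact Hn.
  - intros n.
    apply Rle_trans with (sum_n (fun i => if Nat.even i then
      d (Nat.div2 i) - c (Nat.div2 i) else d' (Nat.div2 i) - c' (Nat.div2 i)) (S (2 * n))).
    + apply Rle_trans with (sum_n (fun i => if Nat.even i then
        d (Nat.div2 i) - c (Nat.div2 i) else d' (Nat.div2 i) - c' (Nat.div2 i)) n).
      * right; apply sum_n_ext; intros i; now destruct (Nat.even i).
      * apply sum_n_pos_mono; [|lia].
        intros i; destruct (Nat.even i);
          [specialize (H1 (Nat.div2 i)) | specialize (K1 (Nat.div2 i))]; lra.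
    + rewrite (sum_n_interleave (fun i => d i - c i) (fun i => d' i - c' i)).
      specialize (H3 n); specialize (K3 n); lra.
Qed.

Lemma almost_everywhere_impl2 A B (P P' P'' : R -> Prop) :
  (forall y, A < y < B -> P y -> P' y -> P'' y) ->
  almost_everywhere A B P -> almost_everywhere A B P' -> almost_everywhere A B P''.
Proof.
  intros Himp H H' eps Heps.
  destruct (null_set_union _ _ H H' eps Heps) as [c [d [H1 [H2 H3]]]].
  exists c, d; split; [exact H1 | split; [|exact H3]].
  intros x [Hx Nx]; apply H2.
  destruct (Classical_Prop.classic (P x)) as [Px|]; [right|left; auto].
  split; [exact Hx|]. intros Px'; apply Nx; auto.
Qed.

Section Liouville.
Variables (A B : R) (p r : R -> R) (q : R -> C) (y0 b : R) (Q : R -> C).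
Hypotheses (Hcoef : coefficients A B p r) (Hy0 : A < y0 < B)
  (HbA : RInt (fun s => sqrt (r s / p s)) A y0 = b)
  (HbB : RInt (fun s => sqrt (r s / p s)) y0 B = b)
  (HQ : continuous_on (fun x => - b <= x <= b) Q)
  (Hpot : potential A B p r q y0 Q).

Lemma potential_continuous y : A < y < B -> continuous (fun s => Q (ell p r y0 s)) y.
Proof.
  intros Hy P HP.
  assert (Hb := ell_bound A B p r y0 b Hcoef Hy0 HbA HbB).
  assert (X := HQ (ell p r y0 y) (Hb y Hy) P HP).
  assert (C : continuous (ell p r y0) y).
  { apply (ex_derive_continuous (V := R_NormedModule)). eexists.
    now apply (ell_derive A B p r y0 Hcoef Hy0). }
  assert (Y := C _ X). unfold filtermap in *.
  assert (W : locally y (fun s => A < s < B)) by (apply (locally_open_interval A B); auto).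
  generalize (filter_and _ _ Y W); apply filter_imp; intros s [S1 S2].
  apply S1, Hb, S2.
Qed.

(** The derivative of [rho v] with respect to [l], written as a combination of
    the absolutely continuous functions [p v'], [v], [(p r)^(-1/4)] and
    [p ((p r)^(-1/4))']. *)
Definition liouville_derivative (v : R -> C) (y : R) : C :=
  (RtoC (Rpower (p y * r y) (- (1 / 4))) * (RtoC (p y) * deriv v y) -
   RtoC (p y * Derive (fun s => Rpower (p s * r s) (- (1 / 4))) y) * v y)%C.

Variables (om : C) (v : R -> C).
Hypothesis (Hv : is_solution A B p r q om v).

Lemma liouville_first y : A < y < B ->
  is_Cderive (fun s => RtoC (rho p r s) * v s)%C y
    (RtoC (sqrt (r y / p y)) * liouville_derivative v y)%C.
Proof.
  intros Hy. destruct Hv as [Hd _].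
  eapply is_Cderive_eq.
  - apply is_Cderive_mult.
    + apply is_Cderive_RtoC. now apply (rho_derive A B p r Hcoef).
    + apply differentiable_at_Cderive, Hd, Hy.
  - unfold liouville_derivative.
    rewrite (inv_rho_derive A B p r Hcoef y Hy), (rho_inv A B) by lra.
    assert (S := sigma_p A B p r Hcoef y ltac:(lra)).
    assert (R := rho_pos p r y).
    set (s := sqrt (r y / p y)) in *. set (rh := rho p r y) in *.
    set (rh' := Derive (rho p r) y).
    transitivity (RtoC (s * p y / rh) * deriv v y + RtoC (s * p y * rh' / rh ^ 2) * v y)%C.
    + rewrite S. replace (rh ^ 2 / rh) with rh by (field; lra).
      replace (rh ^ 2 * rh' / rh ^ 2) with rh' by (field; lra). ring.
    + replace (s * p y / rh) with (s * (/ rh * p y)) by (field; lra).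
      replace (s * p y * rh' / rh ^ 2) with (- (s * (p y * - (rh' / rh ^ 2)))) by (field; lra).
      rewrite !RtoC_opp, !RtoC_mult, !RtoC_opp. ring.
Qed.

(** Individually [(p v')'] and the derivative of [p ((p r)^(-1/4))'] exist only
    almost everywhere, and [q] is arbitrary, but in the derivative of the
    combination they recombine into the continuous potential [Q]; the equation
    therefore holds at every point. *)
Lemma liouville_second y : A < y < B ->
  is_Cderive (liouville_derivative v) y
    (RtoC (sqrt (r y / p y)) * ((Q (ell p r y0 y) - om ^ 2) * (RtoC (rho p r y) * v y)))%C.
Proof.
  destruct Hv as [Hd [HACv [HACpv Hae]]].
  revert y. apply AC_loc_C1_of_ae.
  - apply AC_loc_minus; apply AC_loc_mult.
    + now apply AC_pr_power.
    + exact HACpv.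
    + now apply AC_p_inv_rho'.
    + exact HACv.
  - intros y Hy. apply continuous_Cmult; [|apply continuous_Cmult].
    + apply continuous_RtoC. now apply (sigma_continuous A B p r y0).
    + apply (continuous_minus (V := C_R_NormedModule)).
      * now apply potential_continuous.
      * apply continuous_const.
    + eapply is_Cderive_continuous, liouville_first, Hy.
  - revert Hae Hpot. unfold potential. cbv zeta.
    apply almost_everywhere_impl2.
    intros y Hy [D1 E1] [D2 E2].
    apply differentiable_at_Cderive in D1.
    assert (D3 := differentiable_at_Cderive _ _ (Hd y Hy)).
    assert (D4 := is_Cderive_RtoC _ _ _ (Derive_correct _ _ D2)).
    assert (P := p_pos A B p r Hcoef y ltac:(lra)).
    assert (Rp := r_pos A B p r Hcoef y ltac:(lra)).
    assert (D5 : is_derive (fun s => Rpower (p s * r s) (- (1 / 4))) y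
      (Derive (fun s => Rpower (p s * r s) (- (1 / 4))) y)).
    { apply Derive_correct. eexists. now apply (pr_power_derive A B p r Hcoef). }
    apply is_Cderive_RtoC in D5.
    eapply is_Cderive_eq.
    + apply is_Cderive_minus.
      * exact (is_Cderive_mult _ _ _ _ _ D5 D1).
      * exact (is_Cderive_mult _ _ _ _ _ D4 D3).
    + rewrite E2, (rho_over_r A B p r Hcoef), (rho_inv A B) by lra.
      set (w' := Derive (fun y => p y * _) y).
      set (m' := Derive (fun s => Rpower _ _) y).
      assert (E1' : deriv (fun y => (RtoC (p y) * deriv v y)%C) y =
        (q y * v y - om ^ 2 * RtoC (r y) * v y)%C).
      { transitivity ((deriv (fun y => (RtoC (p y) * deriv v y)%C) y - q y * v y) + q y * v y)%C;
          [ring|]. rewrite E1; ring. }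
      rewrite E1'.
      assert (S := sigma_rho2 A B p r Hcoef y ltac:(lra)).
      assert (R := rho_pos p r y).
      set (s := sqrt (r y / p y)) in *. set (rh := rho p r y) in *.
      assert (Cs : RtoC s = (RtoC (r y) / (RtoC rh * RtoC rh))%C).
      { rewrite <- RtoC_mult, <- RtoC_div by nra. f_equal. rewrite <- S; field; lra. }
      rewrite Cs. rewrite !RtoC_mult, RtoC_inv, RtoC_div by lra.
      field. split; intros E; apply RtoC_inj in E; lra.
Qed.

End Liouville.

Section FormalPowerDerivatives.
Variables (A B : R) (p r : R -> R) (q : R -> C) (y0 b : R) (Q : R -> C) (g : R -> C).
Hypotheses (Hcoef : coefficients A B p r) (Hy0 : A < y0 < B)
  (HbA : RInt (fun s => sqrt (r s / p s)) A y0 = b)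
  (HbB : RInt (fun s => sqrt (r s / p s)) y0 B = b)
  (HQ : continuous_on (fun x => - b <= x <= b) Q)
  (Hpot : potential A B p r q y0 Q)
  (Hg : is_solution A B p r q (RtoC 0) g)
  (Hg0 : forall y, A < y < B -> g y <> RtoC 0).

Lemma g_derive y : A < y < B -> is_Cderive g y (deriv g y).
Proof. intros Hy; apply differentiable_at_Cderive, Hg, Hy. Qed.

Lemma g2r_continuous y : A < y < B -> continuous (g2r r g) y.
Proof.
  intros Hy. unfold g2r.
  assert (G := is_Cderive_continuous _ _ _ (g_derive y Hy)).
  apply continuous_Cmult.
  - apply (continuous_ext (fun s => g s * g s)%C); [intros; simpl; ring|].
    now apply continuous_Cmult.
  - exact (AC_loc_continuous A B _ y (AC_r A B p r Hcoef) Hy).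
Qed.

Lemma inv_g2p_continuous y : A < y < B -> continuous (inv_g2p p g) y.
Proof.
  intros Hy.
  assert (P := p_pos A B p r Hcoef y ltac:(lra)).
  assert (PN : RtoC (p y) <> RtoC 0) by (intros E; apply RtoC_inj in E; lra).
  eapply is_Cderive_continuous, is_Cderive_inv.
  - apply is_Cderive_mult; [|apply is_Cderive_RtoC; now apply (p_derive A B p r)].
    eapply is_Cderive_ext; [|apply is_Cderive_mult; apply (g_derive y Hy)].
    intros s; simpl; ring.
  - apply Cmult_neq_0; [|exact PN].
    simpl. repeat apply Cmult_neq_0; auto. intros E; apply RtoC_inj in E; lra.
Qed.

Lemma Y_derive k y : A < y < B ->
  is_Cderive (Y p r y0 g k) y
    (RtoC (INR k) * (Y p r y0 g (k - 1) y * (if Nat.odd k then inv_g2p p g y else g2r r g y)))%C.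
Proof.
  revert y; induction k as [|k IH]; intros y Hy.
  - eapply is_Cderive_eq; [apply is_Cderive_const|]. simpl; ring.
  - cbn [Y]. replace (S k - 1)%nat with k by lia.
    apply is_Cderive_scal.
    apply (is_Cderive_CInt (fun s => (Y p r y0 g k s *
      (if Nat.odd (S k) then inv_g2p p g s else g2r r g s))%C) A B y0 y Hy0 Hy).
    intros t Ht. apply continuous_Cmult.
    + eapply is_Cderive_continuous, IH, Ht.
    + destruct (Nat.odd (S k)); [now apply inv_g2p_continuous | now apply g2r_continuous].
Qed.

Lemma Ytilde_derive k y : A < y < B ->
  is_Cderive (Ytilde p r y0 g k) y
    (RtoC (INR k) * (Ytilde p r y0 g (k - 1) y * (if Nat.odd k then g2r r g y else inv_g2p p g y)))%C.
Proof.
  revert y; induction k as [|k IH]; intros y Hy.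
  - eapply is_Cderive_eq; [apply is_Cderive_const|]. simpl; ring.
  - cbn [Ytilde]. replace (S k - 1)%nat with k by lia.
    apply is_Cderive_scal.
    apply (is_Cderive_CInt (fun s => (Ytilde p r y0 g k s *
      (if Nat.odd (S k) then g2r r g s else inv_g2p p g s))%C) A B y0 y Hy0 Hy).
    intros t Ht. apply continuous_Cmult.
    + eapply is_Cderive_continuous, IH, Ht.
    + destruct (Nat.odd (S k)); [now apply g2r_continuous | now apply inv_g2p_continuous].
Qed.

(** The coefficient of [g] in the k-th formal power. Its derivative is a multiple
    of the iterated integral of order [k - 1] from the same family, which for this
    parity is [power_cofactor]. *)
Definition power_factor (k : nat) (y : R) : C :=
  if Nat.odd k then Y p r y0 g k y else Ytilde p r y0 g k y.
Definition power_cofactor (k : nat) (y : R) : C :=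
  if Nat.odd k then Y p r y0 g (k - 1) y else Ytilde p r y0 g (k - 1) y.

Lemma odd_pred k : Nat.odd (S k - 1) = negb (Nat.odd (S k)).
Proof. replace (S k - 1)%nat with k by lia. now rewrite Nat.odd_succ, <- Nat.negb_odd, Bool.negb_involutive. Qed.

Lemma power_factor_derive k y : A < y < B ->
  is_Cderive (power_factor k) y (RtoC (INR k) * (power_cofactor k y * inv_g2p p g y))%C.
Proof.
  intros Hy. unfold power_factor, power_cofactor.
  assert (D1 := Y_derive k y Hy). assert (D2 := Ytilde_derive k y Hy).
  destruct (Nat.odd k); [exact D1 | exact D2].
Qed.

Lemma power_cofactor_derive k y : A < y < B ->
  is_Cderive (power_cofactor k) y
    (RtoC (INR (k - 1)) * (power_factor (k - 2) y * g2r r g y))%C.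
Proof.
  intros Hy. destruct k as [|[|k]].
  - apply is_Cderive_ext with (fun _ => RtoC 1); [reflexivity|].
    eapply is_Cderive_eq; [apply is_Cderive_const|].
    change (INR (0 - 1)) with 0. ring.
  - apply is_Cderive_ext with (fun _ => RtoC 1); [reflexivity|].
    eapply is_Cderive_eq; [apply is_Cderive_const|].
    change (INR (1 - 1)) with 0. ring.
  - assert (D1 := Y_derive (S (S k) - 1) y Hy). assert (D2 := Ytilde_derive (S (S k) - 1) y Hy).
    rewrite odd_pred in D1, D2. replace (S (S k) - 1 - 1)%nat with (S (S k) - 2)%nat in D1, D2 by lia.
    unfold power_factor, power_cofactor.
    assert (E : Nat.odd (S (S k) - 2) = Nat.odd (S (S k))).
    { replace (S (S k) - 2)%nat with k by lia. reflexivity. }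
    rewrite E. destruct (Nat.odd (S (S k))); [exact D1 | exact D2].
Qed.

Definition phi (k : nat) (y : R) : C := (RtoC (rho p r y) * Phi p r y0 g k y)%C.
(** The derivative of [phi k] with respect to [l]. *)
Definition psi (k : nat) (y : R) : C :=
  (liouville_derivative p r g y * power_factor k y +
   RtoC (INR k) * (power_cofactor k y * / (RtoC (rho p r y) * g y)))%C.

Lemma rho_g_neq_0 y : A < y < B -> (RtoC (rho p r y) * g y)%C <> RtoC 0.
Proof.
  intros Hy; apply Cmult_neq_0; [|now apply Hg0].
  assert (R := rho_pos p r y). intros E; apply RtoC_inj in E; lra.
Qed.

Lemma inv_g2p_eq y : A < y < B ->
  inv_g2p p g y = (RtoC (sqrt (r y / p y)) * / ((RtoC (rho p r y) * g y) * (RtoC (rho p r y) * g y)))%C.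
Proof.
  intros Hy. unfold inv_g2p.
  assert (S := sigma_p A B p r Hcoef y ltac:(lra)).
  assert (P := p_pos A B p r Hcoef y ltac:(lra)).
  assert (R := rho_pos p r y).
  assert (Cs : RtoC (sqrt (r y / p y)) = (RtoC (rho p r y) * RtoC (rho p r y) / RtoC (p y))%C).
  { rewrite <- RtoC_mult, <- RtoC_div by lra. f_equal.
    replace (rho p r y * rho p r y) with (rho p r y ^ 2) by ring. rewrite <- S; field; lra. }
  rewrite Cs. simpl. field. repeat split; auto; intros E; apply RtoC_inj in E; lra.
Qed.

Lemma g2r_eq y : A < y < B ->
  g2r r g y = (RtoC (sqrt (r y / p y)) * ((RtoC (rho p r y) * g y) * (RtoC (rho p r y) * g y)))%C.
Proof.
  intros Hy. unfold g2r.
  assert (S := sigma_rho2 A B p r Hcoef y ltac:(lra)).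
  set (s := sqrt (r y / p y)) in *. rewrite <- S. simpl. rewrite !RtoC_mult. ring.
Qed.

Lemma phi_derive k y : A < y < B ->
  is_Cderive (phi k) y (RtoC (sqrt (r y / p y)) * psi k y)%C.
Proof.
  intros Hy.
  assert (D1 := liouville_first A B p r q Hcoef (RtoC 0) g Hg y Hy).
  assert (D2 := power_factor_derive k y Hy).
  assert (N := rho_g_neq_0 y Hy).
  eapply is_Cderive_ext; [|eapply is_Cderive_eq; [exact (is_Cderive_mult _ _ _ _ _ D1 D2)|]].
  - intros s; unfold phi, Phi, power_factor; cbv beta; ring.
  - rewrite inv_g2p_eq by exact Hy. unfold psi.
    set (f := (RtoC (rho p r y) * g y)%C) in *. cbv beta. field. exact N.
Qed.

(** In terms of [f = rho g] the weights are [g^2 r = l' f^2] and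
    [1 / (g^2 p) = l' / f^2], so that the recursive integrals are those of the
    equation in Liouville form and [phi_k'' - Q phi_k = k (k-1) phi_(k-2)] in the
    variable [l]. *)
Lemma psi_derive k y : A < y < B ->
  is_Cderive (psi k) y (RtoC (sqrt (r y / p y)) *
    (Q (ell p r y0 y) * phi k y + RtoC (INR k * INR (k - 1)) * phi (k - 2)%nat y))%C.
Proof.
  intros Hy.
  assert (D1 := liouville_first A B p r q Hcoef (RtoC 0) g Hg y Hy).
  assert (D2 := liouville_second A B p r q y0 b Q Hcoef Hy0 HbA HbB HQ Hpot (RtoC 0) g Hg y Hy).
  assert (D3 := power_factor_derive k y Hy).
  assert (D4 := power_cofactor_derive k y Hy).
  assert (N := rho_g_neq_0 y Hy).
  assert (D5 := is_Cderive_inv _ _ _ D1 N).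
  eapply is_Cderive_eq.
  - apply is_Cderive_plus; [exact (is_Cderive_mult _ _ _ _ _ D2 D3)|].
    apply is_Cderive_scal. exact (is_Cderive_mult _ _ _ _ _ D4 D5).
  - rewrite inv_g2p_eq, g2r_eq by exact Hy.
    unfold phi, Phi.
    change (if Nat.odd k then Y p r y0 g k y else Ytilde p r y0 g k y) with (power_factor k y).
    change (if Nat.odd (k - 2) then Y p r y0 g (k - 2) y else Ytilde p r y0 g (k - 2) y)
      with (power_factor (k - 2) y).
    rewrite (Cmult_assoc (RtoC (rho p r y)) (g y)), (Cmult_assoc (RtoC (rho p r y)) (g y)).
    set (f := (RtoC (rho p r y) * g y)%C) in *. rewrite !RtoC_mult. simpl.
    replace (RtoC 0 * (RtoC 0 * RtoC 1))%C with (RtoC 0) by ring.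
    field. exact N.
Qed.

End FormalPowerDerivatives.

(** * The estimates *)

Lemma CInt_ext (f f' : R -> C) a b :
  (forall x, Rmin a b < x < Rmax a b -> f x = f' x) -> CInt f a b = CInt f' a b.
Proof. exact (@RInt_ext C_R_CompleteNormedModule f f' a b). Qed.

(** [Q] is continuous only relative to [[-b,b]], so the integral is taken of its
    composition with the retraction. *)
Lemma G2_derive (A B : R) (p r : R -> R) (y0 b : R) (Q : R -> C) :
  coefficients A B p r -> A < y0 < B ->
  RInt (fun s => sqrt (r s / p s)) A y0 = b ->
  RInt (fun s => sqrt (r s / p s)) y0 B = b ->
  0 < b -> continuous_on (fun x => - b <= x <= b) Q ->
  forall y, A < y < B -> is_Cderive (G2 p r y0 Q) y
    (RtoC (sqrt (r y / p y)) * (RtoC (1 / 4) * Q (ell p r y0 y)))%C.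
Proof.
  intros Hcoef Hy0 HbA HbB Hb HQ y Hy.
  assert (Hl := ell_bound A B p r y0 b Hcoef Hy0 HbA HbB).
  set (Qc := fun s => Q (clamp (- b) b s)).
  assert (HQc : forall s, continuous Qc s).
  { intros s; unfold Qc. apply (continuous_on_clamp (U := C_UniformSpace)); [lra | exact HQ]. }
  apply is_Cderive_ext_loc with (fun s => RtoC (1 / 4) * CInt Qc 0 (ell p r y0 s))%C.
  - apply (locally_open_interval A B); [exact Hy|]. intros s Hs.
    unfold G2. f_equal. apply CInt_ext. intros x Hx. unfold Qc. rewrite clamp_id; [reflexivity|].
    specialize (Hl s Hs). revert Hx; unfold Rmin, Rmax; destruct Rle_dec; lra.
  - eapply is_Cderive_eq.
    + apply is_Cderive_scal.
      apply (is_Cderive_comp (fun x => CInt Qc 0 x) (ell p r y0) y (Qc (ell p r y0 y))).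
      * specialize (Hl y Hy). apply is_Cderive_CInt with (- b - 1) (b + 1); try lra. auto.
      * now apply (ell_derive A B p r y0 Hcoef Hy0).
    + unfold Qc. rewrite clamp_id by (apply Hl, Hy). ring.
Qed.

(** Common core of the two estimates: [T] is the cosine with even powers or the
    sine with odd powers, and [kap] is [1] or [om], the normalization that makes
    [kap rho v] start like [T]. *)
Lemma approximation_error (A B : R) (p r : R -> R) (q : R -> C) (y0 b : R) (Q g v G : R -> C)
    (om kap : C) (T T' : R -> C) (par : nat -> bool) (a : nat -> C) (N : nat) (c M eps : R) :
  coefficients A B p r -> A < y0 < B ->
  RInt (fun s => sqrt (r s / p s)) A y0 = b ->
  RInt (fun s => sqrt (r s / p s)) y0 B = b ->
  0 < b -> continuous_on (fun x => - b <= x <= b) Q ->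
  potential A B p r q y0 Q ->
  is_solution A B p r q (RtoC 0) g ->
  (forall y, A < y < B -> g y <> RtoC 0) ->
  is_solution A B p r q om v ->
  om <> RtoC 0 -> 0 <= c -> Rabs (Im om) <= c ->
  0 <= M -> (forall x, - b <= x <= b -> Cmod (Q x) <= M) ->
  (forall x, is_Cderive T x (T' x)) -> (forall x, is_Cderive T' x (- (om ^ 2 * T x))%C) ->
  (forall x s, Cmod (T s * Ccos (om * RtoC (x - s)) - T' s * (Csin (om * RtoC (x - s)) / om))%C
     <= cosh (c * (x - 2 * s))) ->
  (forall k, par (S (S k)) = par k) ->
  (par 0%nat = true -> T' 0 = RtoC 0) -> (par 1%nat = true -> T 0 = RtoC 0) ->
  (forall y, A < y < B ->
     is_Cderive G y (RtoC (sqrt (r y / p y)) * (RtoC (1 / 4) * Q (ell p r y0 y)))%C) ->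
  0 <= eps ->
  let l := ell p r y0 in
  let tr := trace l (phi p r y0 g) par a N in
  let J := fun k x => CInt (fun t => RtoC (t ^ k) * T t)%C 0 x in
  (forall y, A < y < B -> Cmod (G y - tr y)%C <= eps) ->
  (kap * (RtoC (rho p r y0) * v y0))%C = T 0 ->
  Cmod (kap * liouville_derivative p r v y0 - T' 0 - RtoC 2 * (RtoC 2 * G y0 - tr y0) * T 0)%C <= 2 * eps ->
  exists F : R -> C,
    (forall y, A < y < B -> F y =
       (kap * (RtoC (rho p r y) * v y) - T (l y) - RtoC 2 * moment_sum l J par a N (phi p r y0 g) y)%C) /\
    (forall y, continuous F y) /\
    (forall y, A <= y <= B -> Cmod (F y) <= 12 * eps * exp (2 * (M * b) * b) * sinh_quot c b).
Proof.
  intros Hcoef Hy0 HbA HbB Hb HQ Hpot Hg Hg0 Hv Hom Hc0 Hc HM HQM HT HT' Hker par2 H0 H1 HG Heps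
    l tr J Hw HU0 HZ0.
  assert (Hl := ell_bound A B p r y0 b Hcoef Hy0 HbA HbB).
  assert (Hl0 : l y0 = 0) by apply ell_y0.
  assert (HJ : forall k x, is_Cderive (J k) x (RtoC (x ^ k) * T x)%C).
  { intros k x. unfold J.
    apply (is_Cderive_CInt (fun t => RtoC (t ^ k) * T t)%C (Rmin 0 x - 1) (Rmax 0 x + 1)).
    - unfold Rmin, Rmax; destruct Rle_dec; lra.
    - unfold Rmin, Rmax; destruct Rle_dec; lra.
    - intros t _. apply continuous_Cmult.
      + apply continuous_RtoC, (ex_derive_continuous (V := R_NormedModule)).
        auto_derive; exact I.
      + eapply is_Cderive_continuous, HT. }
  assert (HJ0 : forall k, J k 0 = RtoC 0) by (intros; apply CInt_point).
  destruct (sigma_bounded A B p r y0 Hcoef Hy0) as [Sg HSg].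
  destruct (continuous_on_bounded T (- b) b) as [T1 HT1]; [lra| |].
  { apply continuous_on_forall; intros; eapply is_Cderive_continuous, HT. }
  destruct (continuous_on_bounded T' (- b) b) as [T2 HT2]; [lra| |].
  { apply continuous_on_forall; intros; eapply is_Cderive_continuous, HT'. }
  set (U := fun y => (kap * (RtoC (rho p r y) * v y))%C).
  set (Z := fun y => (kap * liouville_derivative p r v y)%C).
  set (D := fun y => A < y < B).
  set (sigma := fun y => sqrt (r y / p y)).
  set (K := fun y => Q (l y)).
  assert (HU : forall y, D y -> is_Cderive U y (RtoC (sigma y) * Z y)%C).
  { intros y Hy. eapply is_Cderive_eq.
    - apply is_Cderive_scal, (liouville_first A B p r q Hcoef om v Hv y Hy).
    - unfold Z, sigma; ring. }
  assert (HZ : forall y, D y -> is_Cderive Z y (RtoC (sigma y) * ((K y - om ^ 2) * U y))%C).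
  { intros y Hy. eapply is_Cderive_eq.
    - apply is_Cderive_scal,
        (liouville_second A B p r q y0 b Q Hcoef Hy0 HbA HbB HQ Hpot om v Hv y Hy).
    - unfold U, K, sigma, l; ring. }
  destruct (error_extension A B y0 l sigma (fun y => T (l y)) (fun y => T' (l y))
    (fun y => G y - tr y)%C K
    (error l U (phi p r y0 g) T J par a N)
    (quasi_derivative l Z G (phi p r y0 g) (psi p r y0 g) T T' J par a N)
    om c M eps b Sg (Rmax T1 T2)) as [F HF]; auto.
  - intros s t Hs Hst Ht.
    apply (error_system_holds D l sigma K U Z G (phi p r y0 g) (psi p r y0 g) om T T' J par a N); auto.
    + intros y Hy; now apply (ell_derive A B p r y0).
    + intros k y Hy; now apply (phi_derive A B p r q y0 g).
    + intros k y Hy; now apply (psi_derive A B p r q y0 b Q g).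
    + intros y Hy; unfold D; lra.
  - intros t s Ht Hs; apply Hker.
  - intros t Ht; split.
    + eapply Rle_trans; [apply HT1, Hl, Ht | apply Rmax_l].
    + eapply Rle_trans; [apply HT2, Hl, Ht | apply Rmax_r].
  - intros t Ht. apply HQM, Hl, Ht.
  - now apply error_at_0.
  - now rewrite (quasi_derivative_at_0 l Z G _ _ T T' J par a N HJ0 y0 Hl0).
  - exists F; exact HF.
Qed.

Lemma sum_from_1 (a X : nat -> C) N :
  sum_n_m (fun n => a n * X n)%C 1 N =
  sum_n (fun n => match n with O => RtoC 0 | S _ => a n end * X n)%C N.
Proof.
  unfold sum_n. rewrite (sum_Sn_m _ 0 N) by lia.
  assert (E : sum_n_m (fun n => a n * X n)%C 1 N =
    sum_n_m (fun n => match n with O => RtoC 0 | S _ => a n end * X n)%C 1 N).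
  { apply sum_n_m_ext_loc; intros [|k] Hk; [lia|reflexivity]. }
  rewrite E. generalize (sum_n_m (fun n => match n with O => RtoC 0 | S _ => a n end * X n)%C 1 N).
  change (forall z : C, z = (RtoC 0 * X 0%nat + z)%C); intros z; ring.
Qed.

Lemma ctilde_trace p r y0 g a N y :
  sum_n (fun n => a n * ctilde p r y0 g n y)%C N =
  trace (ell p r y0) (phi p r y0 g) Nat.even a N y.
Proof.
  unfold trace, dsum. apply sum_n_ext; intros n. f_equal.
  unfold ctilde, sum_even, binomial_sum. rewrite <- sum_n_C_scal.
  apply sum_n_ext; intros k. destruct (Nat.even k); [|C_ring].
  unfold phi. rewrite RtoC_mult. C_ring.
Qed.

Lemma stilde_trace p r y0 g a N y :
  sum_n (fun n => a n * stilde p r y0 g n y)%C N =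
  trace (ell p r y0) (phi p r y0 g) Nat.odd a N y.
Proof.
  unfold trace, dsum. apply sum_n_ext; intros n. f_equal.
  unfold stilde, sum_odd, binomial_sum. rewrite <- sum_n_C_scal.
  apply sum_n_ext; intros k. destruct (Nat.odd k); [|C_ring].
  unfold phi. rewrite RtoC_mult. C_ring.
Qed.

Lemma approximation_moment_sum p r y0 g (par : nat -> bool) (a : nat -> C) N
    (J : nat -> R -> C) y :
  (RtoC (rho p r y) * sum_n (fun n => a n *
     sum_n (fun k => if par k then
       RtoC (Binomial.C n k) * Phi p r y0 g (n - k) y * J k (ell p r y0 y) else RtoC 0) n) N)%C =
  moment_sum (ell p r y0) J par a N (phi p r y0 g) y.
Proof.
  unfold moment_sum, dsum. rewrite <- sum_n_C_scal. apply sum_n_ext; intros n.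
  rewrite Cmult_assoc, (Cmult_comm (RtoC _)), <- Cmult_assoc. f_equal.
  unfold binomial_sum. rewrite <- sum_n_C_scal. apply sum_n_ext; intros k.
  destruct (par k); [|C_ring]. unfold phi. C_ring.
Qed.

Lemma cos_kernel (om : C) (c : R) : om <> RtoC 0 -> Rabs (Im om) <= c -> forall x s,
  Cmod (Ccos (om * RtoC s) * Ccos (om * RtoC (x - s)) -
        (- (om * Csin (om * RtoC s))) * (Csin (om * RtoC (x - s)) / om))%C
  <= cosh (c * (x - 2 * s)).
Proof.
  intros Hom Hc x s.
  replace (Ccos (om * RtoC s) * Ccos (om * RtoC (x - s)) -
        (- (om * Csin (om * RtoC s))) * (Csin (om * RtoC (x - s)) / om))%C
    with (Ccos (om * RtoC (x - s) - om * RtoC s)).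
  - replace (om * RtoC (x - s) - om * RtoC s)%C with (om * RtoC (x - 2 * s))%C
      by (rewrite !RtoC_minus, RtoC_mult; replace (RtoC 2) with (RtoC 1 + RtoC 1)%C
            by (rewrite <- RtoC_plus; f_equal; ring); ring).
    eapply Rle_trans; [apply Cmod_Ccos_le | now apply cosh_Im_le].
  - rewrite Ccos_minus. field. exact Hom.
Qed.

Lemma sin_kernel (om : C) (c : R) : om <> RtoC 0 -> Rabs (Im om) <= c -> forall x s,
  Cmod (Csin (om * RtoC s) * Ccos (om * RtoC (x - s)) -
        om * Ccos (om * RtoC s) * (Csin (om * RtoC (x - s)) / om))%C
  <= cosh (c * (x - 2 * s)).
Proof.
  intros Hom Hc x s.
  replace (Csin (om * RtoC s) * Ccos (om * RtoC (x - s)) -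
        om * Ccos (om * RtoC s) * (Csin (om * RtoC (x - s)) / om))%C
    with (- Csin (om * RtoC (x - s) - om * RtoC s))%C.
  - replace (om * RtoC (x - s) - om * RtoC s)%C with (om * RtoC (x - 2 * s))%C
      by (rewrite !RtoC_minus, RtoC_mult; replace (RtoC 2) with (RtoC 1 + RtoC 1)%C
            by (rewrite <- RtoC_plus; f_equal; ring); ring).
    rewrite Cmod_opp.
    eapply Rle_trans; [apply Cmod_Csin_le | now apply cosh_Im_le].
  - rewrite Csin_minus. field. exact Hom.
Qed.

Lemma bounded_closed_le A B f M M' : bounded_closed A B f M -> M <= M' ->
  forall y, A < y < B -> Cmod (f y) <= M'.
Proof.
  intros [F [[H1 _] H2]] HM y Hy. rewrite <- H1 by exact Hy.
  eapply Rle_trans; [apply H2; lra | exact HM].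
Qed.

Theorem theorem4p9 (b : R) (Q : R -> C) (eps1 eps2 : R)
    (hb : 0 < b) (hQ : continuous_on (fun x => - b <= x <= b) Q) :
  exists eps : R, 0 <= eps /\
  forall (A B : R) (p r : R -> R) (q : R -> C) (y0 : R)
         (g : R -> C) (h : C) (N : nat) (a_ b_ : nat -> C),
    coefficients A B p r ->
    A < y0 < B ->
    RInt (fun s => sqrt (r s / p s)) A y0 = b ->
    RInt (fun s => sqrt (r s / p s)) y0 B = b ->
    potential A B p r q y0 Q ->
    is_solution A B p r q (RtoC 0) g ->
    g y0 = RtoC (Rpower (p y0 * r y0) (- (1 / 4))) ->
    (forall y, A < y < B -> g y <> RtoC 0) ->
    continuous_closed A B (g2r r g) ->
    continuous_closed A B (inv_g2p p g) ->
    h = (RtoC (sqrt (p y0 / r y0)) *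
         (deriv g y0 / g y0 + RtoC (Derive (rho p r) y0 / rho p r y0)))%C ->
    bounded_closed A B
      (fun y => G1 p r y0 Q h y -
                sum_n (fun n => a_ n * ctilde p r y0 g n y) N)%C eps1 ->
    bounded_closed A B
      (fun y => G2 p r y0 Q y -
                sum_n_m (fun n => b_ n * stilde p r y0 g n y) 1 N)%C eps2 ->
    forall (omega : C) (v1 v2 : R -> C) (c : R),
      omega <> RtoC 0 ->
      0 <= c ->
      Rabs (Im omega) <= c ->
      is_solution A B p r q omega v1 ->
      v1 y0 = RtoC (1 / rho p r y0) ->
      deriv v1 y0 =
        (RtoC (- (Derive (rho p r) y0 / rho p r y0 ^ 2)) +
         h / RtoC (rho p r y0) * RtoC (sqrt (r y0 / p y0)))%C ->
      is_solution A B p r q omega v2 ->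
      v2 y0 = RtoC 0 ->
      deriv v2 y0 = RtoC (1 / rho p r y0 * sqrt (r y0 / p y0)) ->
      let rho0 := max_norm A B (fun y => RtoC (1 / rho p r y)) in
      norm_le A B (fun y => v1 y - v1N p r y0 g a_ N omega y)%C
        (eps * rho0 * sinh_quot c b) /\
      norm_le A B (fun y => v2 y - v2N p r y0 g b_ N omega y)%C
        (eps * rho0 * sinh_quot c b / Cmod omega).
Proof.
  destruct (continuous_on_bounded Q (- b) b) as [M HQM]; [lra | exact hQ |].
  assert (HM : 0 <= M) by (eapply Rle_trans; [apply (Cmod_ge_0 (Q 0)) | apply HQM; lra]).
  set (e := Rmax 0 (Rmax eps1 eps2)).
  assert (He : 0 <= e) by apply Rmax_l.
  assert (He1 : eps1 <= e) by (eapply Rle_trans; [apply Rmax_l | apply Rmax_r]).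
  assert (He2 : eps2 <= e) by (eapply Rle_trans; [apply Rmax_r | apply Rmax_r]).
  clearbody e.
  exists (12 * e * exp (2 * (M * b) * b)); split.
  { apply Rmult_le_pos; [lra | left; apply exp_pos]. }
  intros A B p r q y0 g h N a_ b_ Hcoef Hy0 HbA HbB Hpot Hg _ Hg0 _ _ _ Ha Hbb
    omega v1 v2 c Hom Hc0 Hc Hv1 V1 V1' Hv2 V2 V2' rho0.
  assert (Rp := rho_pos p r y0).
  assert (Pp := p_pos A B p r Hcoef y0 ltac:(lra)).
  assert (Sp := sigma_p A B p r Hcoef y0 ltac:(lra)).
  assert (NR : forall y, RtoC (rho p r y) <> RtoC 0).
  { intros y E; apply RtoC_inj in E. assert (X := rho_pos p r y); lra. }
  assert (DG2 := G2_derive A B p r y0 b Q Hcoef Hy0 HbA HbB hb hQ).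
  assert (G20 : G2 p r y0 Q y0 = RtoC 0).
  { unfold G2. rewrite ell_y0, CInt_point; ring. }
  assert (Sc : RtoC (sqrt (r y0 / p y0)) = (RtoC (rho p r y0) * RtoC (rho p r y0) / RtoC (p y0))%C).
  { rewrite <- RtoC_mult, <- RtoC_div by lra. f_equal.
    replace (rho p r y0 * rho p r y0) with (rho p r y0 ^ 2) by ring. rewrite <- Sp; field; lra. }
  assert (NP : RtoC (p y0) <> RtoC 0) by (intros E; apply RtoC_inj in E; lra).
  split.
  - replace (12 * e * exp (2 * (M * b) * b) * rho0 * sinh_quot c b) with
      (Cmod (RtoC 1) * (rho0 * (12 * e * exp (2 * (M * b) * b) * sinh_quot c b)))
      by (rewrite Cmod_1; ring).
    assert (HW : forall y, A < y < B -> Cmod (G1 p r y0 Q h y -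
       trace (ell p r y0) (phi p r y0 g) Nat.even a_ N y)%C <= e).
    { intros y Hy. rewrite <- ctilde_trace.
      exact (bounded_closed_le A B _ _ _ Ha He1 y Hy). }
    refine (norm_le_of_error A B p r y0 Hcoef Hy0 _ _ (RtoC 1) _ _
      (approximation_error A B p r q y0 b Q g v1 (G1 p r y0 Q h) omega (RtoC 1)
        (fun x => Ccos (omega * RtoC x)) (fun x => - (omega * Csin (omega * RtoC x)))%C
        Nat.even a_ N c M e Hcoef Hy0 HbA HbB hb hQ Hpot Hg Hg0 Hv1 Hom Hc0 Hc HM HQM
        _ _ _ _ _ _ _ He HW _ _)).
    + intros y Hy. cbv beta. rewrite <- approximation_moment_sum.
      unfold v1N, sum_even, Cdiv. rewrite RtoC_div by (assert (X := rho_pos p r y); lra).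
      field. apply NR.
    + intros x; apply is_Cderive_Ccos.
    + intros x. eapply is_Cderive_eq.
      * eapply is_Cderive_ext; [|apply (is_Cderive_scal (- omega)), (is_Cderive_Csin omega x)].
        intros s; simpl; ring.
      * simpl; ring.
    + now apply cos_kernel.
    + reflexivity.
    + intros _. rewrite Cmult_0_r, Csin_0; ring.
    + discriminate.
    + intros y Hy. unfold G1. eapply is_Cderive_eq.
      * apply is_Cderive_plus; [apply is_Cderive_const | apply DG2, Hy].
      * ring.
    + rewrite V1, Cmult_0_r, Ccos_0, RtoC_div by lra. field. apply NR.
    + assert (Z1 : liouville_derivative p r v1 y0 = h).
      { unfold liouville_derivative.
        rewrite (inv_rho_derive A B p r Hcoef y0 Hy0), (rho_inv A B), V1, V1' by lra.
        rewrite Sc. rewrite !RtoC_mult, !RtoC_opp, !RtoC_div, !RtoC_inv, RtoC_pow by (try apply pow_nonzero; lra).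
        simpl. field. repeat split; (exact NP || apply NR). }
      rewrite Z1. cbv beta. rewrite !Cmult_0_r, Csin_0, Ccos_0.
      specialize (HW y0 Hy0). unfold G1 in *. rewrite G20 in *.
      replace (RtoC 1 * h - - (omega * RtoC 0) - RtoC 2 * (RtoC 2 * (h / RtoC 2 + RtoC 0) -
        trace (ell p r y0) (phi p r y0 g) Nat.even a_ N y0) * RtoC 1)%C with
        (- RtoC 2 * (h / RtoC 2 + RtoC 0 - trace (ell p r y0) (phi p r y0 g) Nat.even a_ N y0))%C
        by (field; exact RtoC2_neq_0).
      rewrite Cmod_mult, Cmod_opp, Cmod_R, Rabs_right by lra. lra.
  (* Setting the coefficient of index 0 to zero makes both sums start at 0. *)
  - set (b' := fun n => match n with O => RtoC 0 | S _ => b_ n end).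
    replace (12 * e * exp (2 * (M * b) * b) * rho0 * sinh_quot c b / Cmod omega) with
      (Cmod (/ omega)%C * (rho0 * (12 * e * exp (2 * (M * b) * b) * sinh_quot c b)))
      by (rewrite Cmod_inv by exact Hom; unfold Rdiv; ring).
    assert (HW : forall y, A < y < B -> Cmod (G2 p r y0 Q y -
       trace (ell p r y0) (phi p r y0 g) Nat.odd b' N y)%C <= e).
    { intros y Hy. rewrite <- stilde_trace. unfold b'.
      assert (X := bounded_closed_le A B _ _ _ Hbb He2 y Hy). cbv beta in X.
      rewrite (sum_from_1 b_ (fun n => stilde p r y0 g n y)) in X. exact X. }
    refine (norm_le_of_error A B p r y0 Hcoef Hy0 _ _ (/ omega)%C _ _
      (approximation_error A B p r q y0 b Q g v2 (G2 p r y0 Q) omega omega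
        (fun x => Csin (omega * RtoC x)) (fun x => (omega * Ccos (omega * RtoC x)))%C
        Nat.odd b' N c M e Hcoef Hy0 HbA HbB hb hQ Hpot Hg Hg0 Hv2 Hom Hc0 Hc HM HQM
        _ _ _ _ _ _ _ He HW _ _)).
    + intros y Hy. cbv beta. rewrite <- approximation_moment_sum.
      unfold v2N, sum_odd, Cdiv.
      rewrite (sum_from_1 b_ (fun n => sum_n (fun k => if Nat.odd k then
        (RtoC (Binomial.C n k) * Phi p r y0 g (n - k) y *
         CInt (fun t => RtoC (t ^ k) * Csin (omega * RtoC t)) 0 (ell p r y0 y))%C else RtoC 0) n)).
      rewrite RtoC_div by (assert (X := rho_pos p r y); lra).
      unfold b'. field. repeat split; (apply NR || exact Hom).
    + intros x; apply is_Cderive_Csin.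
    + intros x. eapply is_Cderive_eq.
      * apply is_Cderive_scal, (is_Cderive_Ccos omega x).
      * simpl; ring.
    + now apply sin_kernel.
    + reflexivity.
    + discriminate.
    + intros _. rewrite Cmult_0_r, Csin_0; ring.
    + exact DG2.
    + rewrite V2, !Cmult_0_r, Csin_0. ring.
    + assert (Z2 : liouville_derivative p r v2 y0 = RtoC 1).
      { unfold liouville_derivative.
        rewrite (rho_inv A B), V2, V2', (RtoC_mult (1 / rho p r y0)), Sc by lra.
        rewrite !RtoC_div, RtoC_inv by lra. field. repeat split; (exact NP || apply NR). }
      rewrite Z2. cbv beta. rewrite !Cmult_0_r, Csin_0, Ccos_0, G20.
      replace (omega * RtoC 1 - omega * RtoC 1 - _)%C with (RtoC 0) by ring.
      rewrite Cmod_0; lra.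
Qed.
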